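(* Let $\mathcal{M}$ be a braided, left closed (hence closed) monoidal bicategory and let $A$ be a monoidal object in $\mathcal{M}$. Consider the truncated pseudo-cosimplicial diagram $CA$ in $\mathcal{M}$ consisting of the objects $A$, $[A,A]$, $[A\otimes A,A]$, the morphisms $\partial_0,\partial_1:A\to[A,A]$ and $\partial_0,\partial_1,\partial_2:[A,A]\to[A\otimes A,A]$ such that, under the closedness equivalences, - $\partial_0:A\to[A,A]$ corresponds to $m:A\otimes A\to A$, and $\partial_1:A\to[A,A]$ corresponds to $m\circ c_{A,A}:A\otimes A\to A$; - $\partial_0,\partial_1,\partial_2:[A,A]\to[A\otimes A,A]$ correspond respectively to the morphisms $m\circ(\mathrm{ev}\otimes 1_A)$, $\mathrm{ev}\circ(1_{[A,A]}\otimes m)$, $m\circ(1_A\otimes\mathrm{ev})\circ(c_{[A,A],A}\otimes 1_A)$ from $[A,A]\otimes A\otimes A$ to $A$; together with the coherent invertible 2-cells $\partial_0\circ\partial_0\cong\partial_1\circ\partial_0$, $\partial_0\circ\partial_1\cong\partial_2\circ\partial_0$, $\partial_2\circ\partial_1\cong\partial_1\circ\partial_1$ induced by the associativity constraint of $A$ and the structural isomorphisms of $\mathcal{M}$. Then the bicategorical limit of $CA$ is the centre $\mathcal{Z}A$ of $A$.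
   Context: Conventions. $\mathcal{M}$ is a braided monoidal bicategory with tensor product $\otimes$, unit $I$ and braiding (pseudonatural equivalence) $c_{X,Y}:X\otimes Y\xrightarrow{\sim}Y\otimes X$. By the coherence theorem one takes $\mathcal{M}$ to be a braided Gray monoid, so that associativity and unit constraints of $\otimes$ are suppressed. The coherent invertible 2-cells relating $c_{X,Y\otimes Z}$ with $(1_Y\otimes c_{X,Z})\circ(c_{X,Y}\otimes 1_Z)$, the pseudonaturality 2-cells $c_{f,g}$ of $c$, and the interchange 2-cells of $\otimes$ are written $\cong$. Closedness. $\mathcal{M}$ is left closed when, for each object $B$, the pseudofunctor $-\otimes B:\mathcal{M}\to\mathcal{M}$ has a right biadjoint $[B,-]$; thus there are equivalences $\mathcal{M}(X\otimes B,C)\simeq\mathcal{M}(X,[B,C])$, pseudonatural in each variable, called the closedness equivalences. The evaluation $\mathrm{ev}:[B,C]\otimes B\to C$ is the morphism that corresponds, up to isomorphism, to the identity of $[B,C]$. It is right closed when each $B\otimes-$ has a right biadjoint, and closed when it is both; a braided left closed monoidal bicategory is closed. Monoidal objects. A monoidal object (pseudomonoid) is an object $A$ with morphisms $m:A\otimes A\to A$ and $j:I\to A$ and invertible 2-cells $\alpha:m\circ(m\otimes 1_A)\Rightarrow m\circ(1_A\otimes m)$, $m\circ(j\otimes 1_A)\cong 1_A$, $m\circ(1_A\otimes j)\cong 1_A$ satisfying the usual pentagon and triangle coherence axioms. Bicategorical limit of $CA$. This is an object $L$ birepresenting the pseudofunctor $\mathcal{M}^{\mathrm{op}}\to\mathrm{Cat}$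 that sends $U$ to the category of pseudo-cones from $U$ over $CA$. Up to equivalence, such a pseudo-cone is a descent-like datum: a morphism $u:U\to A$ with an invertible 2-cell $\theta:\partial_0\circ u\Rightarrow\partial_1\circ u$ such that the composite $\partial_0\partial_0u\cong\partial_1\partial_0u\xRightarrow{\partial_1\theta}\partial_1\partial_1u\cong\partial_2\partial_1u$ equals the composite $\partial_0\partial_0u\xRightarrow{\partial_0\theta}\partial_0\partial_1u\cong\partial_2\partial_0u\xRightarrow{\partial_2\theta}\partial_2\partial_1u$; morphisms are 2-cells $u\Rightarrow v$ compatible with the $\theta$'s. Centre pieces. A centre piece for $A$ is a morphism $u:U\to A$ equipped with an invertible 2-cell $\gamma:m\circ(u\otimes 1_A)\Rightarrow m\circ(1_A\otimes u)\circ c_{U,A}$ such that the composite $m(m\otimes 1)(u\otimes 1\otimes 1)\xRightarrow{\alpha}m(1\otimes m)(u\otimes 1\otimes 1)\cong m(u\otimes 1)(1_U\otimes m)\xRightarrow{\gamma}m(1\otimes u)c_{U,A}(1_U\otimes m)\cong m(1\otimes u)(m\otimes 1_U)c_{U,A\otimes A}\cong m(m\otimes 1)(1\otimes 1\otimes u)c_{U,A\otimes A}\xRightarrow{\alpha}m(1\otimes m)(1\otimes 1\otimes u)c_{U,A\otimes A}$ equals the composite $m(m\otimes 1)(u\otimes 1\otimes 1)\xRightarrow{\gamma\otimes 1}m(m\otimes 1)(1\otimes u\otimes 1)(c_{U,A}\otimes 1)\xRightarrow{\alpha}m(1\otimes m)(1\otimes u\otimes 1)(c_{U,A}\otimes 1)\xRightarrow{1\otimes\gamma}m(1\otimes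 m)(1\otimes 1\otimes u)(1\otimes c_{U,A})(c_{U,A}\otimes 1)\cong m(1\otimes m)(1\otimes 1\otimes u)c_{U,A\otimes A}$. A morphism of centre pieces $(u,\gamma)\to(v,\gamma)$, with $u,v:U\to A$, is a 2-cell $\sigma:u\Rightarrow v$ such that $\gamma\,(m\circ(\sigma\otimes 1_A))=(m\circ(1_A\otimes\sigma)\circ c_{U,A})\,\gamma$. This gives a category $\mathcal{CP}(U,A)$ and a pseudofunctor $\mathcal{CP}(-,A):\mathcal{M}^{\mathrm{op}}\to\mathrm{Cat}$; for $f:V\to U$, the functor $\mathcal{CP}(f,A)$ sends $(u,\gamma)$ to $u\circ f$ with the 2-cell obtained by pasting $\gamma$ with the pseudonaturality isomorphism $c_{f,1_A}$. Centre. The centre of $A$ is a birepresenting object $\mathcal{Z}A$ for $\mathcal{CP}(-,A)$: there is a centre piece $i:\mathcal{Z}A\to A$ such that composition with $i$ induces, for every object $U$, an equivalence of categories $\mathcal{M}(U,\mathcal{Z}A)\simeq\mathcal{CP}(U,A)$. *)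

(* Defs.v *)
From Stdlib Require Import ProofIrrelevance ClassicalEpsilon.

Set Implicit Arguments.
Unset Strict Implicit.

Declare Scope cat_scope.
Delimit Scope cat_scope with cat.
Open Scope cat_scope.

(** * Categories *)

Record Category := {
  Obj :> Type;
  Hom : Obj -> Obj -> Type;
  idc : forall x, Hom x x;
  cc : forall {x y z}, Hom y z -> Hom x y -> Hom x z;
  cc_assoc : forall x y z w (h : Hom z w) (g : Hom y z) (f : Hom x y),
    cc h (cc g f) = cc (cc h g) f;
  cc_idl : forall x y (f : Hom x y), cc (idc y) f = f;
  cc_idr : forall x y (f : Hom x y), cc f (idc x) = f
}.
Arguments idc {_} _.
Arguments cc {_ _ _ _} _ _.
Notation "g ⊚ f" := (cc g f) (at level 40, left associativity) : cat_scope.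

Definition is_iso (C : Category) (x y : C) (f : Hom x y) : Prop :=
  exists g : Hom y x, g ⊚ f = idc x /\ f ⊚ g = idc y.

Record Functor (C D : Category) := {
  fob :> C -> D;
  fmap : forall {x y}, Hom x y -> Hom (fob x) (fob y);
  fmap_id : forall x, fmap (idc x) = idc (fob x);
  fmap_cc : forall x y z (g : Hom y z) (f : Hom x y), fmap (g ⊚ f) = fmap g ⊚ fmap f
}.
Arguments fmap {_ _} _ {_ _} _.

Definition functor_id (C : Category) : Functor C C.
Proof. now refine {| fob := fun x => x; fmap := fun _ _ f => f |}. Defined.

Definition functor_comp (C D E : Category) (G : Functor D E) (F : Functor C D) : Functor C E.
Proof.
  refine {| fob := fun x => G (F x); fmap := fun _ _ f => fmap G (fmap F f) |}.
  - intros x. now rewrite !fmap_id.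
  - intros x y z g f. now rewrite !fmap_cc.
Defined.

Definition nat_iso (C D : Category) (F G : Functor C D) : Prop :=
  exists eta : forall x, Hom (F x) (G x),
    (forall x y (f : Hom x y), eta y ⊚ fmap F f = fmap G f ⊚ eta x) /\
    (forall x, is_iso (eta x)).

Definition is_equivalence (C D : Category) (F : Functor C D) : Prop :=
  exists G : Functor D C,
    nat_iso (functor_comp G F) (functor_id C) /\ nat_iso (functor_comp F G) (functor_id D).

(** * 2-categories

    Strict 2-categories are presented with one type of 0-, 1- and 2-cells each, and
    source and target functions between them.  Strict associativity of a Gray tensor
    product on 0-cells would otherwise put transports in the type of every 2-cell.
    The partial composition operations are represented by total functions; every law
    is restricted to composable cells, so that nothing is said about the values
    elsewhere.  Composition is written in functional order; [g ▹ a] and [a ◃ f] are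
    the whiskerings of the 2-cell [a] by 1-cells [g] after and [f] before it. *)

Record TwoData := {
  ob : Type;
  ar : Type;
  ce : Type;
  src1 : ar -> ob;
  tgt1 : ar -> ob;
  src2 : ce -> ar;
  tgt2 : ce -> ar;
  id1 : ob -> ar;
  comp1 : ar -> ar -> ar;
  id2 : ar -> ce;
  vcomp : ce -> ce -> ce;
  lwhisk : ar -> ce -> ce;
  rwhisk : ce -> ar -> ce
}.
Arguments src1 {_} _. Arguments tgt1 {_} _. Arguments src2 {_} _. Arguments tgt2 {_} _.
Arguments id1 {_} _. Arguments comp1 {_} _ _. Arguments id2 {_} _.
Arguments vcomp {_} _ _. Arguments lwhisk {_} _ _. Arguments rwhisk {_} _ _.

Notation "g ∘ f" := (comp1 g f) (at level 40, left associativity) : cat_scope.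
Notation "b • a" := (vcomp b a) (at level 50, left associativity) : cat_scope.
Notation "a ◃ f" := (rwhisk a f) (at level 42, left associativity) : cat_scope.
Notation "g ▹ a" := (lwhisk g a) (at level 43, right associativity) : cat_scope.

Definition is1 (M : TwoData) (f : ar M) (A B : ob M) : Prop := src1 f = A /\ tgt1 f = B.
Definition is2 (M : TwoData) (a : ce M) (f g : ar M) : Prop := src2 a = f /\ tgt2 a = g.
Notation "f ⦂ A ⟶ B" := (is1 f A B) (at level 70, A at next level, B at next level) : cat_scope.
Notation "a ⦂ f ⟹ g" := (is2 a f g) (at level 70, f at next level, g at next level) : cat_scope.

Definition inverse_of (M : TwoData) (a b : ce M) : Prop :=
  b ⦂ tgt2 a ⟹ src2 a /\ b • a = id2 (src2 a) /\ a • b = id2 (tgt2 a).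

Definition invertible (M : TwoData) (a : ce M) : Prop := exists b, inverse_of a b.

(** The inverse of an invertible 2-cell, and an unspecified 2-cell otherwise. *)
Definition inv2 (M : TwoData) (a : ce M) : ce M := epsilon (inhabits a) (inverse_of a).

Definition iso2 (M : TwoData) (a : ce M) (f g : ar M) : Prop := a ⦂ f ⟹ g /\ invertible a.
Notation "a ⦂ f ≅ g" := (iso2 a f g) (at level 70, f at next level, g at next level) : cat_scope.

Record TwoCat := {
  two_data :> TwoData;
  src_id1 : forall A : ob two_data, src1 (id1 A) = A;
  tgt_id1 : forall A : ob two_data, tgt1 (id1 A) = A;
  src_comp1 : forall f g : ar two_data, tgt1 f = src1 g -> src1 (g ∘ f) = src1 f;
  tgt_comp1 : forall f g : ar two_data, tgt1 f = src1 g -> tgt1 (g ∘ f) = tgt1 g;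
  comp1_assoc : forall f g h : ar two_data, tgt1 f = src1 g -> tgt1 g = src1 h ->
    h ∘ (g ∘ f) = h ∘ g ∘ f;
  comp1_idl : forall f : ar two_data, id1 (tgt1 f) ∘ f = f;
  comp1_idr : forall f : ar two_data, f ∘ id1 (src1 f) = f;
  src_glob : forall a : ce two_data, src1 (tgt2 a) = src1 (src2 a);
  tgt_glob : forall a : ce two_data, tgt1 (tgt2 a) = tgt1 (src2 a);
  src_id2 : forall f : ar two_data, src2 (id2 f) = f;
  tgt_id2 : forall f : ar two_data, tgt2 (id2 f) = f;
  src_vcomp : forall a b : ce two_data, tgt2 a = src2 b -> src2 (b • a) = src2 a;
  tgt_vcomp : forall a b : ce two_data, tgt2 a = src2 b -> tgt2 (b • a) = tgt2 b;
  vcomp_assoc : forall a b c : ce two_data, tgt2 a = src2 b -> tgt2 b = src2 c ->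
    c • (b • a) = c • b • a;
  vcomp_idl : forall a : ce two_data, id2 (tgt2 a) • a = a;
  vcomp_idr : forall a : ce two_data, a • id2 (src2 a) = a;
  src_lwhisk : forall g (a : ce two_data), tgt1 (src2 a) = src1 g -> src2 (g ▹ a) = g ∘ src2 a;
  tgt_lwhisk : forall g (a : ce two_data), tgt1 (src2 a) = src1 g -> tgt2 (g ▹ a) = g ∘ tgt2 a;
  lwhisk_id2 : forall f g : ar two_data, tgt1 f = src1 g -> g ▹ id2 f = id2 (g ∘ f);
  lwhisk_vcomp : forall g (a b : ce two_data), tgt2 a = src2 b -> tgt1 (src2 a) = src1 g ->
    g ▹ (b • a) = (g ▹ b) • (g ▹ a);
  lwhisk_id1 : forall a : ce two_data, id1 (tgt1 (src2 a)) ▹ a = a;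
  lwhisk_comp1 : forall g h (a : ce two_data), tgt1 (src2 a) = src1 g -> tgt1 g = src1 h ->
    (h ∘ g) ▹ a = h ▹ (g ▹ a);
  src_rwhisk : forall (a : ce two_data) f, tgt1 f = src1 (src2 a) -> src2 (a ◃ f) = src2 a ∘ f;
  tgt_rwhisk : forall (a : ce two_data) f, tgt1 f = src1 (src2 a) -> tgt2 (a ◃ f) = tgt2 a ∘ f;
  rwhisk_id2 : forall f g : ar two_data, tgt1 f = src1 g -> id2 g ◃ f = id2 (g ∘ f);
  rwhisk_vcomp : forall (a b : ce two_data) f, tgt2 a = src2 b -> tgt1 f = src1 (src2 a) ->
    (b • a) ◃ f = (b ◃ f) • (a ◃ f);
  rwhisk_id1 : forall a : ce two_data, a ◃ id1 (src1 (src2 a)) = a;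
  rwhisk_comp1 : forall (a : ce two_data) f g, tgt1 f = src1 g -> tgt1 g = src1 (src2 a) ->
    a ◃ (g ∘ f) = (a ◃ g) ◃ f;
  lrwhisk : forall g (a : ce two_data) f, tgt1 (src2 a) = src1 g -> tgt1 f = src1 (src2 a) ->
    (g ▹ a) ◃ f = g ▹ (a ◃ f);
  whisk_exchange : forall a b : ce two_data, tgt1 (src2 a) = src1 (src2 b) ->
    (b ◃ tgt2 a) • (src2 b ▹ a) = (tgt2 b ▹ a) • (b ◃ src2 a)
}.

Definition equivalence1 (M : TwoCat) (f : ar M) (A B : ob M) : Prop :=
  f ⦂ A ⟶ B /\
  exists (g : ar M) (eta eps : ce M),
    g ⦂ B ⟶ A /\ eta ⦂ id1 A ≅ g ∘ f /\ eps ⦂ f ∘ g ≅ id1 B.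

(** * Gray monoids

    [A ⋉ f] and [f ⋊ B] are the actions of the 2-functors [A ⊗ -] and [- ⊗ B] on
    1-cells, [A ⋉₂ a] and [a ⋊₂ B] those on 2-cells.  For [f : A ⟶ A'] and
    [g : B ⟶ B'], [ich f g] is the interchange
    [(f ⊗ B')(A ⊗ g) ⟹ (A' ⊗ g)(f ⊗ B)]. *)

Record GrayData := {
  gray_two :> TwoCat;
  unit0 : ob gray_two;
  ten : ob gray_two -> ob gray_two -> ob gray_two;
  ltens : ob gray_two -> ar gray_two -> ar gray_two;
  rtens : ar gray_two -> ob gray_two -> ar gray_two;
  ltens2 : ob gray_two -> ce gray_two -> ce gray_two;
  rtens2 : ce gray_two -> ob gray_two -> ce gray_two;
  ich : ar gray_two -> ar gray_two -> ce gray_two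
}.
Arguments ten {_} _ _. Arguments ltens {_} _ _. Arguments rtens {_} _ _.
Arguments ltens2 {_} _ _. Arguments rtens2 {_} _ _. Arguments ich {_} _ _.

Notation "A ⊗ B" := (ten A B) (at level 30, right associativity) : cat_scope.
Notation "f ⋊ B" := (rtens f B) (at level 34, left associativity) : cat_scope.
Notation "A ⋉ f" := (ltens A f) (at level 35, right associativity) : cat_scope.
Notation "a ⋊₂ B" := (rtens2 a B) (at level 34, left associativity) : cat_scope.
Notation "A ⋉₂ a" := (ltens2 A a) (at level 35, right associativity) : cat_scope.

Record GrayMonoid := {
  gray_data :> GrayData;
  (* 2-functoriality of [A ⊗ -] *)
  src_ltens : forall A (f : ar gray_data), src1 (A ⋉ f) = A ⊗ src1 f;
  tgt_ltens : forall A (f : ar gray_data), tgt1 (A ⋉ f) = A ⊗ tgt1 f;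
  ltens_id1 : forall A B : ob gray_data, A ⋉ id1 B = id1 (A ⊗ B);
  ltens_comp1 : forall A (f g : ar gray_data), tgt1 f = src1 g ->
    A ⋉ (g ∘ f) = (A ⋉ g) ∘ (A ⋉ f);
  src_ltens2 : forall A (a : ce gray_data), src2 (A ⋉₂ a) = A ⋉ src2 a;
  tgt_ltens2 : forall A (a : ce gray_data), tgt2 (A ⋉₂ a) = A ⋉ tgt2 a;
  ltens2_id2 : forall A (f : ar gray_data), A ⋉₂ id2 f = id2 (A ⋉ f);
  ltens2_vcomp : forall A (a b : ce gray_data), tgt2 a = src2 b ->
    A ⋉₂ (b • a) = (A ⋉₂ b) • (A ⋉₂ a);
  ltens2_lwhisk : forall A g (a : ce gray_data), tgt1 (src2 a) = src1 g ->
    A ⋉₂ (g ▹ a) = (A ⋉ g) ▹ (A ⋉₂ a);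
  ltens2_rwhisk : forall A (a : ce gray_data) f, tgt1 f = src1 (src2 a) ->
    A ⋉₂ (a ◃ f) = (A ⋉₂ a) ◃ (A ⋉ f);
  (* 2-functoriality of [- ⊗ B] *)
  src_rtens : forall (f : ar gray_data) B, src1 (f ⋊ B) = src1 f ⊗ B;
  tgt_rtens : forall (f : ar gray_data) B, tgt1 (f ⋊ B) = tgt1 f ⊗ B;
  rtens_id1 : forall A B : ob gray_data, id1 A ⋊ B = id1 (A ⊗ B);
  rtens_comp1 : forall (f g : ar gray_data) B, tgt1 f = src1 g ->
    (g ∘ f) ⋊ B = (g ⋊ B) ∘ (f ⋊ B);
  src_rtens2 : forall (a : ce gray_data) B, src2 (a ⋊₂ B) = src2 a ⋊ B;
  tgt_rtens2 : forall (a : ce gray_data) B, tgt2 (a ⋊₂ B) = tgt2 a ⋊ B;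
  rtens2_id2 : forall (f : ar gray_data) B, id2 f ⋊₂ B = id2 (f ⋊ B);
  rtens2_vcomp : forall (a b : ce gray_data) B, tgt2 a = src2 b ->
    (b • a) ⋊₂ B = (b ⋊₂ B) • (a ⋊₂ B);
  rtens2_lwhisk : forall g (a : ce gray_data) B, tgt1 (src2 a) = src1 g ->
    (g ▹ a) ⋊₂ B = (g ⋊ B) ▹ (a ⋊₂ B);
  rtens2_rwhisk : forall (a : ce gray_data) f B, tgt1 f = src1 (src2 a) ->
    (a ◃ f) ⋊₂ B = (a ⋊₂ B) ◃ (f ⋊ B);
  (* strict associativity and units *)
  ten_assoc : forall A B C : ob gray_data, (A ⊗ B) ⊗ C = A ⊗ (B ⊗ C);
  ten_unitl : forall A : ob gray_data, unit0 gray_data ⊗ A = A;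
  ten_unitr : forall A : ob gray_data, A ⊗ unit0 gray_data = A;
  ltens_ltens : forall A B (f : ar gray_data), A ⋉ (B ⋉ f) = (A ⊗ B) ⋉ f;
  lrtens : forall A (f : ar gray_data) B, (A ⋉ f) ⋊ B = A ⋉ (f ⋊ B);
  rtens_rtens : forall (f : ar gray_data) A B, (f ⋊ A) ⋊ B = f ⋊ (A ⊗ B);
  ltens_unit : forall f : ar gray_data, unit0 gray_data ⋉ f = f;
  rtens_unit : forall f : ar gray_data, f ⋊ unit0 gray_data = f;
  ltens2_ltens2 : forall A B (a : ce gray_data), A ⋉₂ (B ⋉₂ a) = (A ⊗ B) ⋉₂ a;
  lrtens2 : forall A (a : ce gray_data) B, (A ⋉₂ a) ⋊₂ B = A ⋉₂ (a ⋊₂ B);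
  rtens2_rtens2 : forall (a : ce gray_data) A B, (a ⋊₂ A) ⋊₂ B = a ⋊₂ (A ⊗ B);
  ltens2_unit : forall a : ce gray_data, unit0 gray_data ⋉₂ a = a;
  rtens2_unit : forall a : ce gray_data, a ⋊₂ unit0 gray_data = a;
  (* interchange *)
  ich_iso : forall f g : ar gray_data,
    ich f g ⦂ (f ⋊ tgt1 g) ∘ (src1 f ⋉ g) ≅ (tgt1 f ⋉ g) ∘ (f ⋊ src1 g);
  ich_natl : forall (a : ce gray_data) g,
    ich (tgt2 a) g • ((a ⋊₂ tgt1 g) ◃ (src1 (src2 a) ⋉ g)) =
    ((tgt1 (src2 a) ⋉ g) ▹ (a ⋊₂ src1 g)) • ich (src2 a) g;
  ich_natr : forall f (b : ce gray_data),
    ich f (tgt2 b) • ((f ⋊ tgt1 (src2 b)) ▹ (src1 f ⋉₂ b)) =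
    ((tgt1 f ⋉₂ b) ◃ (f ⋊ src1 (src2 b))) • ich f (src2 b);
  ich_idl : forall A (g : ar gray_data), ich (id1 A) g = id2 (A ⋉ g);
  ich_idr : forall (f : ar gray_data) B, ich f (id1 B) = id2 (f ⋊ B);
  ich_compl : forall f f' g : ar gray_data, tgt1 f = src1 f' ->
    ich (f' ∘ f) g = (ich f' g ◃ (f ⋊ src1 g)) • ((f' ⋊ tgt1 g) ▹ ich f g);
  ich_compr : forall f g g' : ar gray_data, tgt1 g = src1 g' ->
    ich f (g' ∘ g) = ((tgt1 f ⋉ g') ▹ ich f g) • (ich f g' ◃ (src1 f ⋉ g));
  ich_ltens : forall A (f g : ar gray_data), ich (A ⋉ f) g = A ⋉₂ ich f g;
  ich_mid : forall (f : ar gray_data) B g, ich (f ⋊ B) g = ich f (B ⋉ g);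
  ich_rtens : forall (f g : ar gray_data) B, ich f (g ⋊ B) = ich f g ⋊₂ B
}.

(** * Braidings

    [br A B] is the braiding [A ⊗ B ⟶ B ⊗ A], with pseudonaturality 2-cells [brl f B]
    and [brr A g] in the two variables.  [brR] and [brS] are the invertible modifications
    that compare the braidings with [B ⊗ C] on the right and with [A ⊗ B] on the left
    with composites of two braidings. *)

Record BraidData := {
  braid_gray :> GrayMonoid;
  br : ob braid_gray -> ob braid_gray -> ar braid_gray;
  brl : ar braid_gray -> ob braid_gray -> ce braid_gray;
  brr : ob braid_gray -> ar braid_gray -> ce braid_gray;
  brR : ob braid_gray -> ob braid_gray -> ob braid_gray -> ce braid_gray;
  brS : ob braid_gray -> ob braid_gray -> ob braid_gray -> ce braid_gray
}.
Arguments br {_} _ _. Arguments brl {_} _ _. Arguments brr {_} _ _.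
Arguments brR {_} _ _ _. Arguments brS {_} _ _ _.

Record BraidedGrayMonoid := {
  braid_data :> BraidData;
  (* pseudonatural equivalence *)
  br_equiv : forall A B : ob braid_data, equivalence1 (br A B) (A ⊗ B) (B ⊗ A);
  brl_iso : forall (f : ar braid_data) B,
    brl f B ⦂ br (tgt1 f) B ∘ (f ⋊ B) ≅ (B ⋉ f) ∘ br (src1 f) B;
  brr_iso : forall A (g : ar braid_data),
    brr A g ⦂ br A (tgt1 g) ∘ (A ⋉ g) ≅ (g ⋊ A) ∘ br A (src1 g);
  brl_nat : forall (a : ce braid_data) B,
    brl (tgt2 a) B • (br (tgt1 (src2 a)) B ▹ (a ⋊₂ B)) =
    ((B ⋉₂ a) ◃ br (src1 (src2 a)) B) • brl (src2 a) B;
  brr_nat : forall A (b : ce braid_data),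
    brr A (tgt2 b) • (br A (tgt1 (src2 b)) ▹ (A ⋉₂ b)) =
    ((b ⋊₂ A) ◃ br A (src1 (src2 b))) • brr A (src2 b);
  brl_id : forall A B : ob braid_data, brl (id1 A) B = id2 (br A B);
  brr_id : forall A B : ob braid_data, brr A (id1 B) = id2 (br A B);
  brl_comp : forall (f f' : ar braid_data) B, tgt1 f = src1 f' ->
    brl (f' ∘ f) B = ((B ⋉ f') ▹ brl f B) • (brl f' B ◃ (f ⋊ B));
  brr_comp : forall A (g g' : ar braid_data), tgt1 g = src1 g' ->
    brr A (g' ∘ g) = ((g' ⋊ A) ▹ brr A g) • (brr A g' ◃ (A ⋉ g));
  brl_brr : forall f g : ar braid_data,
    (ich g f ◃ br (src1 f) (src1 g)) • ((g ⋊ tgt1 f) ▹ brl f (src1 g))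
      • (brr (tgt1 f) g ◃ (f ⋊ src1 g)) • (br (tgt1 f) (tgt1 g) ▹ ich f g) =
    ((tgt1 g ⋉ f) ▹ brr (src1 f) g) • (brl f (tgt1 g) ◃ (src1 f ⋉ g));
  (* the modification [brR] *)
  brR_iso : forall A B C : ob braid_data,
    brR A B C ⦂ (B ⋉ br A C) ∘ (br A B ⋊ C) ≅ br A (B ⊗ C);
  brR_mod1 : forall (f : ar braid_data) B C,
    brl f (B ⊗ C) • (brR (tgt1 f) B C ◃ (f ⋊ (B ⊗ C))) =
    (((B ⊗ C) ⋉ f) ▹ brR (src1 f) B C)
      • ((B ⋉₂ brl f C) ◃ (br (src1 f) B ⋊ C)) • ((B ⋉ br (tgt1 f) C) ▹ (brl f B ⋊₂ C));
  brR_mod2 : forall A (g : ar braid_data) C,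
    brr A (g ⋊ C) • (brR A (tgt1 g) C ◃ (A ⋉ g ⋊ C)) =
    ((g ⋊ (C ⊗ A)) ▹ brR A (src1 g) C)
      • (inv2 (ich g (br A C)) ◃ (br A (src1 g) ⋊ C)) • ((tgt1 g ⋉ br A C) ▹ (brr A g ⋊₂ C));
  brR_mod3 : forall A B (h : ar braid_data),
    brr A (B ⋉ h) • (brR A B (tgt1 h) ◃ ((A ⊗ B) ⋉ h)) =
    ((B ⋉ h ⋊ A) ▹ brR A B (src1 h))
      • ((B ⋉₂ brr A h) ◃ (br A B ⋊ src1 h)) • ((B ⋉ br A (tgt1 h)) ▹ ich (br A B) h);
  (* the modification [brS] *)
  brS_iso : forall A B C : ob braid_data,
    brS A B C ⦂ (br A C ⋊ B) ∘ (A ⋉ br B C) ≅ br (A ⊗ B) C;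
  brS_mod1 : forall (f : ar braid_data) B C,
    brl (f ⋊ B) C • (brS (tgt1 f) B C ◃ (f ⋊ (B ⊗ C))) =
    ((C ⋉ f ⋊ B) ▹ brS (src1 f) B C)
      • ((brl f C ⋊₂ B) ◃ (src1 f ⋉ br B C))
      • ((br (tgt1 f) C ⋊ B) ▹ inv2 (ich f (br B C)));
  brS_mod2 : forall A (g : ar braid_data) C,
    brl (A ⋉ g) C • (brS A (tgt1 g) C ◃ (A ⋉ g ⋊ C)) =
    (((C ⊗ A) ⋉ g) ▹ brS A (src1 g) C)
      • (ich (br A C) g ◃ (A ⋉ br (src1 g) C)) • ((br A C ⋊ tgt1 g) ▹ (A ⋉₂ brl g C));
  brS_mod3 : forall A B (h : ar braid_data),
    brr (A ⊗ B) h • (brS A B (tgt1 h) ◃ ((A ⊗ B) ⋉ h)) =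
    ((h ⋊ (A ⊗ B)) ▹ brS A B (src1 h))
      • ((brr A h ⋊₂ B) ◃ (A ⋉ br B (src1 h))) • ((br A (tgt1 h) ⋊ B) ▹ (A ⋉₂ brr B h));
  (* one object past three *)
  brR_brR : forall A B C D : ob braid_data,
    brR A (B ⊗ C) D • (((B ⊗ C) ⋉ br A D) ▹ (brR A B C ⋊₂ D)) =
    brR A B (C ⊗ D) • ((B ⋉₂ brR A C D) ◃ (br A B ⋊ (C ⊗ D)));
  (* three objects past one *)
  brS_brS : forall A B C D : ob braid_data,
    brS A (B ⊗ C) D • ((br A D ⋊ (B ⊗ C)) ▹ (A ⋉₂ brS B C D)) =
    brS (A ⊗ B) C D • ((brS A B D ⋊₂ C) ◃ ((A ⊗ B) ⋉ br C D));
  (* two objects past two *)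
  brR_brS : forall A B C D : ob braid_data,
    brR (A ⊗ B) C D
      • ((C ⋉₂ brS A B D) ◃ (br (A ⊗ B) C ⋊ D))
      • ((C ⋉ ((br A D ⋊ B) ∘ (A ⋉ br B D))) ▹ (brS A B C ⋊₂ D))
      • ((C ⋉ br A D ⋊ B) ▹ ich (br A C) (br B D) ◃ (A ⋉ br B C ⋊ D)) =
    brS A B (C ⊗ D)
      • ((brR A C D ⋊₂ B) ◃ (A ⋉ br B (C ⊗ D)))
      • ((((C ⋉ br A D) ∘ (br A C ⋊ D)) ⋊ B) ▹ (A ⋉₂ brR B C D));
  (* the two proofs of the hexagon of braidings from [A ⊗ B ⊗ C] to [C ⊗ B ⊗ A] *)
  brR_brS_hexagon : forall A B C : ob braid_data,
    inv2 ((br B C ⋊ A) ▹ brR A B C) • brr A (br B C) • (brR A C B ◃ (A ⋉ br B C)) =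
    inv2 (brS B A C ◃ (br A B ⋊ C)) • inv2 (brl (br A B) C) • ((C ⋉ br A B) ▹ brS A B C)
}.

(** * Boundaries *)

Lemma is_iso2 (M : TwoData) (a : ce M) f g : a ⦂ f ≅ g -> src2 a = f /\ tgt2 a = g.
Proof. intros [[H1 H2] _]. now split. Qed.

Lemma src_ich (M : GrayMonoid) (f g : ar M) : src2 (ich f g) = (f ⋊ tgt1 g) ∘ (src1 f ⋉ g).
Proof. apply (is_iso2 (ich_iso f g)). Qed.
Lemma tgt_ich (M : GrayMonoid) (f g : ar M) : tgt2 (ich f g) = (tgt1 f ⋉ g) ∘ (f ⋊ src1 g).
Proof. apply (is_iso2 (ich_iso f g)). Qed.
Lemma src_br (M : BraidedGrayMonoid) (A B : ob M) : src1 (br A B) = A ⊗ B.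
Proof. apply (br_equiv A B). Qed.
Lemma tgt_br (M : BraidedGrayMonoid) (A B : ob M) : tgt1 (br A B) = B ⊗ A.
Proof. apply (br_equiv A B). Qed.
Lemma src_brl (M : BraidedGrayMonoid) (f : ar M) B :
  src2 (brl f B) = br (tgt1 f) B ∘ (f ⋊ B).
Proof. apply (is_iso2 (brl_iso f B)). Qed.
Lemma tgt_brl (M : BraidedGrayMonoid) (f : ar M) B :
  tgt2 (brl f B) = (B ⋉ f) ∘ br (src1 f) B.
Proof. apply (is_iso2 (brl_iso f B)). Qed.
Lemma src_brr (M : BraidedGrayMonoid) A (g : ar M) :
  src2 (brr A g) = br A (tgt1 g) ∘ (A ⋉ g).
Proof. apply (is_iso2 (brr_iso A g)). Qed.
Lemma tgt_brr (M : BraidedGrayMonoid) A (g : ar M) :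
  tgt2 (brr A g) = (g ⋊ A) ∘ br A (src1 g).
Proof. apply (is_iso2 (brr_iso A g)). Qed.
Lemma src_brR (M : BraidedGrayMonoid) (A B C : ob M) :
  src2 (brR A B C) = (B ⋉ br A C) ∘ (br A B ⋊ C).
Proof. apply (is_iso2 (brR_iso A B C)). Qed.
Lemma tgt_brR (M : BraidedGrayMonoid) (A B C : ob M) : tgt2 (brR A B C) = br A (B ⊗ C).
Proof. apply (is_iso2 (brR_iso A B C)). Qed.
Lemma src_brS (M : BraidedGrayMonoid) (A B C : ob M) :
  src2 (brS A B C) = (br A C ⋊ B) ∘ (A ⋉ br B C).
Proof. apply (is_iso2 (brS_iso A B C)). Qed.
Lemma tgt_brS (M : BraidedGrayMonoid) (A B C : ob M) : tgt2 (brS A B C) = br (A ⊗ B) C.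
Proof. apply (is_iso2 (brS_iso A B C)). Qed.

Lemma inv2_spec (M : TwoData) (a : ce M) : invertible a -> inverse_of a (inv2 a).
Proof. intros H. unfold inv2. apply epsilon_spec. exact H. Qed.
Lemma src_inv2 (M : TwoData) (a : ce M) : invertible a -> src2 (inv2 a) = tgt2 a.
Proof. intros H. apply (inv2_spec H). Qed.
Lemma tgt_inv2 (M : TwoData) (a : ce M) : invertible a -> tgt2 (inv2 a) = src2 a.
Proof. intros H. apply (inv2_spec H). Qed.
Lemma inv2_l (M : TwoData) (a : ce M) : invertible a -> inv2 a • a = id2 (src2 a).
Proof. intros H. apply (inv2_spec H). Qed.
Lemma inv2_r (M : TwoData) (a : ce M) : invertible a -> a • inv2 a = id2 (tgt2 a).
Proof. intros H. apply (inv2_spec H). Qed.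

Lemma comp1_idl' (M : TwoCat) (f : ar M) A : tgt1 f = A -> id1 A ∘ f = f.
Proof. intros <-. apply comp1_idl. Qed.
Lemma comp1_idr' (M : TwoCat) (f : ar M) A : src1 f = A -> f ∘ id1 A = f.
Proof. intros <-. apply comp1_idr. Qed.

(** [bd] proves equations between 0- and 1-cells by computing sources and targets and
    by rewriting with the strict laws, hypotheses on the boundaries of variables
    included. *)

(** [rw E tac] rewrites syntactic occurrences of the left-hand side of [E], whose
    hypotheses are discharged by [tac]. *)
Ltac spec E tac := repeat match type of E with
  | ?H -> _ => let h := fresh in assert (h : H) by tac; specialize (E h); clear h
  end.
Ltac rw_pattern E := match type of E with
  | ?l = ?r => pattern l; match goal with |- ?G _ => refine (@eq_ind_r _ r G _ l E) end; cbv beta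
  end.
Ltac rw lem tac :=
  let E := fresh in pose proof lem as E; spec E tac; rw_pattern E; clear E.
Ltac rw_rev lem tac :=
  let E := fresh in pose proof lem as E; spec E tac; symmetry in E; rw_pattern E; clear E.

(** Extended below for the fields of the records that follow. *)
Ltac bd_gen tac := fail.

Ltac bd_step tac := match goal with
  | H : src1 ?f = _ |- context [src1 ?f] => rw H tac
  | H : tgt1 ?f = _ |- context [tgt1 ?f] => rw H tac
  | H : src2 ?f = _ |- context [src2 ?f] => rw H tac
  | H : tgt2 ?f = _ |- context [tgt2 ?f] => rw H tac
  | |- context [src1 (id1 ?A)] => rw (src_id1 A) tac
  | |- context [tgt1 (id1 ?A)] => rw (tgt_id1 A) tac
  | |- context [src2 (id2 ?f)] => rw (src_id2 f) tac
  | |- context [tgt2 (id2 ?f)] => rw (tgt_id2 f) tac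
  | |- context [src1 (tgt2 ?a)] => rw (src_glob a) tac
  | |- context [tgt1 (tgt2 ?a)] => rw (tgt_glob a) tac
  | |- context [src1 (?g ∘ ?f)] => rw (@src_comp1 _ f g) tac
  | |- context [tgt1 (?g ∘ ?f)] => rw (@tgt_comp1 _ f g) tac
  | |- context [src1 (?A ⋉ ?f)] => rw (src_ltens A f) tac
  | |- context [tgt1 (?A ⋉ ?f)] => rw (tgt_ltens A f) tac
  | |- context [src1 (?f ⋊ ?A)] => rw (src_rtens f A) tac
  | |- context [tgt1 (?f ⋊ ?A)] => rw (tgt_rtens f A) tac
  | |- context [src1 (br ?A ?B)] => rw (src_br A B) tac
  | |- context [tgt1 (br ?A ?B)] => rw (tgt_br A B) tac
  | |- context [src2 (?b • ?a)] => rw (@src_vcomp _ a b) tac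
  | |- context [tgt2 (?b • ?a)] => rw (@tgt_vcomp _ a b) tac
  | |- context [src2 (?g ▹ ?a)] => rw (@src_lwhisk _ g a) tac
  | |- context [tgt2 (?g ▹ ?a)] => rw (@tgt_lwhisk _ g a) tac
  | |- context [src2 (?a ◃ ?f)] => rw (@src_rwhisk _ a f) tac
  | |- context [tgt2 (?a ◃ ?f)] => rw (@tgt_rwhisk _ a f) tac
  | |- context [src2 (?A ⋉₂ ?a)] => rw (src_ltens2 A a) tac
  | |- context [tgt2 (?A ⋉₂ ?a)] => rw (tgt_ltens2 A a) tac
  | |- context [src2 (?a ⋊₂ ?A)] => rw (src_rtens2 a A) tac
  | |- context [tgt2 (?a ⋊₂ ?A)] => rw (tgt_rtens2 a A) tac
  | |- context [src2 (ich ?f ?g)] => rw (src_ich f g) tac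
  | |- context [tgt2 (ich ?f ?g)] => rw (tgt_ich f g) tac
  | |- context [src2 (brl ?f ?B)] => rw (src_brl f B) tac
  | |- context [tgt2 (brl ?f ?B)] => rw (tgt_brl f B) tac
  | |- context [src2 (brr ?A ?g)] => rw (src_brr A g) tac
  | |- context [tgt2 (brr ?A ?g)] => rw (tgt_brr A g) tac
  | |- context [src2 (brR ?A ?B ?C)] => rw (src_brR A B C) tac
  | |- context [tgt2 (brR ?A ?B ?C)] => rw (tgt_brR A B C) tac
  | |- context [src2 (brS ?A ?B ?C)] => rw (src_brS A B C) tac
  | |- context [tgt2 (brS ?A ?B ?C)] => rw (tgt_brS A B C) tac
  | |- _ => bd_gen tac
  | |- context [(?A ⊗ ?B) ⊗ ?C] => rw (ten_assoc A B C) tac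
  | |- context [unit0 _ ⊗ ?A] => rw (ten_unitl A) tac
  | |- context [?A ⊗ unit0 _] => rw (ten_unitr A) tac
  | |- context [?A ⋉ id1 ?B] => rw (ltens_id1 A B) tac
  | |- context [id1 ?A ⋊ ?B] => rw (rtens_id1 A B) tac
  | |- context [?A ⋉ (?B ⋉ ?f)] => rw (ltens_ltens A B f) tac
  | |- context [(?A ⋉ ?f) ⋊ ?B] => rw (lrtens A f B) tac
  | |- context [(?f ⋊ ?A) ⋊ ?B] => rw (rtens_rtens f A B) tac
  | |- context [unit0 _ ⋉ ?f] => rw (ltens_unit f) tac
  | |- context [?f ⋊ unit0 _] => rw (rtens_unit f) tac
  | |- context [?A ⋉ (?g ∘ ?f)] => rw (@ltens_comp1 _ A f g) tac
  | |- context [(?g ∘ ?f) ⋊ ?A] => rw (@rtens_comp1 _ f g A) tac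
  | |- context [?h ∘ (?g ∘ ?f)] => rw (@comp1_assoc _ f g h) tac
  | |- context [id1 ?A ∘ ?f] => rw (@comp1_idl' _ f A) tac
  | |- context [?f ∘ id1 ?A] => rw (@comp1_idr' _ f A) tac
  end.

Ltac bd := solve [ repeat bd_step bd; reflexivity ].


Lemma is2_id2 (M : TwoCat) (f : ar M) : id2 f ⦂ f ⟹ f.
Proof. split; [apply src_id2 | apply tgt_id2]. Qed.

Lemma is2_vcomp (M : TwoCat) (a b : ce M) f g h :
  a ⦂ f ⟹ g -> b ⦂ g ⟹ h -> b • a ⦂ f ⟹ h.
Proof. intros [? ?] [? ?]. split; subst; [apply src_vcomp | apply tgt_vcomp]; congruence. Qed.

Lemma is2_glob (M : TwoCat) (a : ce M) f g : a ⦂ f ⟹ g -> src1 g = src1 f /\ tgt1 g = tgt1 f.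
Proof. intros [<- <-]. split; [apply src_glob | apply tgt_glob]. Qed.

Lemma is2_lwhisk (M : TwoCat) g (a : ce M) f f' :
  a ⦂ f ⟹ f' -> tgt1 f = src1 g -> g ▹ a ⦂ g ∘ f ⟹ g ∘ f'.
Proof. intros [<- <-] ?. split; [now apply src_lwhisk | now apply tgt_lwhisk]. Qed.

Lemma is2_rwhisk (M : TwoCat) (a : ce M) f g g' :
  a ⦂ g ⟹ g' -> tgt1 f = src1 g -> a ◃ f ⦂ g ∘ f ⟹ g' ∘ f.
Proof. intros [<- <-] ?. split; [now apply src_rwhisk | now apply tgt_rwhisk]. Qed.

Lemma is1_id1 (M : TwoCat) (A : ob M) : id1 A ⦂ A ⟶ A.
Proof. split; [apply src_id1 | apply tgt_id1]. Qed.

Lemma is1_comp1 (M : TwoCat) (f g : ar M) A B C :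
  f ⦂ A ⟶ B -> g ⦂ B ⟶ C -> g ∘ f ⦂ A ⟶ C.
Proof.
  intros [? ?] [? ?]. split; subst; [apply src_comp1 | apply tgt_comp1]; congruence.
Qed.

Lemma vcomp_idl' (M : TwoCat) (a : ce M) f : tgt2 a = f -> id2 f • a = a.
Proof. intros <-. apply vcomp_idl. Qed.

Lemma vcomp_idr' (M : TwoCat) (a : ce M) f : src2 a = f -> a • id2 f = a.
Proof. intros <-. apply vcomp_idr. Qed.

(** Uniqueness and closure properties of inverses. *)

Lemma inverse_unique (M : TwoCat) (a b c : ce M) : inverse_of a b -> inverse_of a c -> b = c.
Proof.
  intros [[B1 B2] [B3 B4]] [[C1 C2] [C3 C4]].
  rewrite <- (vcomp_idr b), B1, <- C4, vcomp_assoc, B3, <- C2 by congruence.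
  apply vcomp_idl.
Qed.

Lemma inv2_eq (M : TwoCat) (a b : ce M) : inverse_of a b -> inv2 a = b.
Proof. intros H. apply (inverse_unique (inv2_spec (ex_intro _ b H)) H). Qed.

Lemma inverse_id2 (M : TwoCat) (f : ar M) : inverse_of (id2 f) (id2 f).
Proof.
  assert (E : id2 f • id2 f = id2 f).
  { rewrite <- (src_id2 f) at 2. apply vcomp_idr. }
  unfold inverse_of. rewrite src_id2, tgt_id2. split; [apply is2_id2 | now split].
Qed.

Lemma inverse_vcomp (M : TwoCat) (a b a' b' : ce M) : tgt2 a = src2 b ->
  inverse_of a a' -> inverse_of b b' -> inverse_of (b • a) (a' • b').
Proof.
  intros E [[A1 A2] [A3 A4]] [[B1 B2] [B3 B4]].
  unfold inverse_of. rewrite src_vcomp, tgt_vcomp by assumption.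
  repeat split.
  - rewrite src_vcomp; congruence.
  - rewrite tgt_vcomp; congruence.
  - rewrite <- (vcomp_assoc (a := b • a)), (vcomp_assoc (a := a)), B3, <- E, vcomp_idl
      by (rewrite ?tgt_vcomp; congruence).
    exact A3.
  - rewrite <- (vcomp_assoc (a := a' • b')), (vcomp_assoc (a := b')), A4, E, <- B2, vcomp_idl
      by (rewrite ?tgt_vcomp; congruence).
    exact B4.
Qed.

Lemma inverse_lwhisk (M : TwoCat) g (a a' : ce M) : tgt1 (src2 a) = src1 g ->
  inverse_of a a' -> inverse_of (g ▹ a) (g ▹ a').
Proof.
  intros E [[A1 A2] [A3 A4]].
  assert (E' : tgt1 (src2 a') = src1 g) by (rewrite A1, tgt_glob; exact E).
  unfold inverse_of. rewrite src_lwhisk, tgt_lwhisk by assumption.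
  repeat split.
  - rewrite src_lwhisk; congruence.
  - rewrite tgt_lwhisk; congruence.
  - rewrite <- lwhisk_vcomp, A3 by congruence. now apply lwhisk_id2.
  - rewrite <- lwhisk_vcomp, A4 by congruence. apply lwhisk_id2. now rewrite tgt_glob.
Qed.

Lemma inverse_rwhisk (M : TwoCat) (a a' : ce M) f : tgt1 f = src1 (src2 a) ->
  inverse_of a a' -> inverse_of (a ◃ f) (a' ◃ f).
Proof.
  intros E [[A1 A2] [A3 A4]].
  assert (E' : tgt1 f = src1 (src2 a')) by (rewrite A1, src_glob; exact E).
  unfold inverse_of. rewrite src_rwhisk, tgt_rwhisk by assumption.
  repeat split.
  - rewrite src_rwhisk; congruence.
  - rewrite tgt_rwhisk; congruence.
  - rewrite <- rwhisk_vcomp, A3 by congruence. now apply rwhisk_id2.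
  - rewrite <- rwhisk_vcomp, A4 by congruence. apply rwhisk_id2. now rewrite src_glob.
Qed.

Lemma inverse_sym (M : TwoCat) (a b : ce M) : inverse_of a b -> inverse_of b a.
Proof. intros [[E1 E2] [? ?]]. unfold inverse_of, is2. rewrite E1, E2. auto. Qed.

Lemma iso2_id2 (M : TwoCat) (f : ar M) : id2 f ⦂ f ≅ f.
Proof. split; [apply is2_id2 | exists (id2 f); apply inverse_id2]. Qed.

Lemma iso2_vcomp (M : TwoCat) (a b : ce M) f g h :
  a ⦂ f ≅ g -> b ⦂ g ≅ h -> b • a ⦂ f ≅ h.
Proof.
  intros [A [a' A']] [B [b' B']]. split; [eapply is2_vcomp; eassumption |].
  exists (a' • b'). apply inverse_vcomp; trivial. destruct A, B; congruence.
Qed.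

Lemma iso2_lwhisk (M : TwoCat) g (a : ce M) f f' :
  a ⦂ f ≅ f' -> tgt1 f = src1 g -> g ▹ a ⦂ g ∘ f ≅ g ∘ f'.
Proof.
  intros [A [a' A']] E. split; [now apply is2_lwhisk |].
  exists (g ▹ a'). apply inverse_lwhisk; trivial. destruct A; congruence.
Qed.

Lemma iso2_rwhisk (M : TwoCat) (a : ce M) f g g' :
  a ⦂ g ≅ g' -> tgt1 f = src1 g -> a ◃ f ⦂ g ∘ f ≅ g' ∘ f.
Proof.
  intros [A [a' A']] E. split; [now apply is2_rwhisk |].
  exists (a' ◃ f). apply inverse_rwhisk; trivial. destruct A; congruence.
Qed.

(** * Hom-categories and Cat-valued pseudofunctors *)

Record hom1 (M : TwoCat) (U V : ob M) := { hom_ar :> ar M; hom_ar_bd : hom_ar ⦂ U ⟶ V }.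
Record hom2 (M : TwoCat) (f g : ar M) := { hom_ce :> ce M; hom_ce_bd : hom_ce ⦂ f ⟹ g }.

Lemma hom2_eq (M : TwoCat) (f g : ar M) (a b : hom2 f g) : hom_ce a = hom_ce b -> a = b.
Proof.
  destruct a as [a p], b as [b q]; simpl. intros <-. f_equal. apply proof_irrelevance.
Qed.

Definition hid (M : TwoCat) (U : ob M) : hom1 U U := Build_hom1 (is1_id1 U).

Definition hcomp (M : TwoCat) (U V W : ob M) (g : hom1 V W) (f : hom1 U V) : hom1 U W :=
  Build_hom1 (is1_comp1 (hom_ar_bd f) (hom_ar_bd g)).

Definition hom2_id (M : TwoCat) (f : ar M) : hom2 f f := Build_hom2 (is2_id2 f).

Definition hom2_vcomp (M : TwoCat) (f g h : ar M) (b : hom2 g h) (a : hom2 f g) : hom2 f h :=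
  Build_hom2 (is2_vcomp (hom_ce_bd a) (hom_ce_bd b)).

Lemma hom1_meet (M : TwoCat) (U V W : ob M) (g : hom1 V W) (f : hom1 U V) : tgt1 f = src1 g.
Proof. destruct f as [f [? ?]], g as [g [? ?]]; simpl; congruence. Qed.

Definition hom2_lwhisk (M : TwoCat) (U V W : ob M) (g : hom1 V W) (f f' : hom1 U V)
    (a : hom2 f f') : hom2 (hcomp g f) (hcomp g f') :=
  Build_hom2 (is2_lwhisk (hom_ce_bd a) (hom1_meet g f)).

Definition hom2_rwhisk (M : TwoCat) (U V W : ob M) (g g' : hom1 V W) (b : hom2 g g')
    (f : hom1 U V) : hom2 (hcomp g f) (hcomp g' f) :=
  Build_hom2 (is2_rwhisk (hom_ce_bd b) (hom1_meet g f)).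

Definition hom2_of_eq (M : TwoCat) (f g : ar M) (e : f = g) : hom2 f g.
Proof. exists (id2 f). rewrite <- e. apply is2_id2. Defined.

Lemma hcomp_idl (M : TwoCat) (U V : ob M) (f : hom1 U V) : hid V ∘ f = f.
Proof. destruct f as [f [? ?]]; simpl. now apply comp1_idl'. Qed.

Lemma hcomp_idr (M : TwoCat) (U V : ob M) (f : hom1 U V) : f ∘ hid U = f.
Proof. destruct f as [f [? ?]]; simpl. now apply comp1_idr'. Qed.

Lemma hcomp_assoc (M : TwoCat) (U V W Z : ob M) (h : hom1 W Z) (g : hom1 V W) (f : hom1 U V) :
  h ∘ (g ∘ f) = h ∘ g ∘ f.
Proof. apply comp1_assoc; apply hom1_meet. Qed.

Lemma hom2_bd (M : TwoCat) (f g : ar M) (a : hom2 f g) : src2 a = f /\ tgt2 a = g.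
Proof. destruct a as [a [? ?]]. now split. Qed.

Definition homcat (M : TwoCat) (U V : ob M) : Category.
Proof.
  refine {| Obj := hom1 U V; Hom := fun f g => hom2 f g;
            idc := fun f => hom2_id f; cc := fun f g h b a => hom2_vcomp b a |}.
  - intros x y z w h g f. apply hom2_eq; simpl.
    apply vcomp_assoc;
      destruct (hom2_bd f), (hom2_bd g), (hom2_bd h); congruence.
  - intros x y f. apply hom2_eq; simpl. apply vcomp_idl', (hom2_bd f).
  - intros x y f. apply hom2_eq; simpl. apply vcomp_idr', (hom2_bd f).
Defined.

(** Pseudofunctors [M^op -> Cat]. *)
Record psfunctor (M : TwoCat) := {
  ps_ob :> ob M -> Category;
  ps_ar : forall U V : ob M, hom1 U V -> Functor (ps_ob V) (ps_ob U);
  ps_ce : forall (U V : ob M) (f g : hom1 U V), hom2 f g ->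
    forall x : ps_ob V, Hom (ps_ar f x) (ps_ar g x);
  ps_ce_nat : forall (U V : ob M) (f g : hom1 U V) (a : hom2 f g) (x y : ps_ob V) (h : Hom x y),
    ps_ce a y ⊚ fmap (ps_ar f) h = fmap (ps_ar g) h ⊚ ps_ce a x;
  ps_ce_id : forall (U V : ob M) (f : hom1 U V) x, ps_ce (hom2_id f) x = idc (ps_ar f x);
  ps_ce_vcomp : forall (U V : ob M) (f g h : hom1 U V) (b : hom2 g h) (a : hom2 f g) x,
    ps_ce (hom2_vcomp b a) x = ps_ce b x ⊚ ps_ce a x;
  (* unit and composition constraints *)
  ps_unit : forall (U : ob M) (x : ps_ob U), Hom x (ps_ar (hid U) x);
  ps_unit_iso : forall (U : ob M) x, is_iso (ps_unit (U := U) x);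
  ps_unit_nat : forall (U : ob M) (x y : ps_ob U) (h : Hom x y),
    ps_unit y ⊚ h = fmap (ps_ar (hid U)) h ⊚ ps_unit x;
  ps_comp : forall (U V W : ob M) (g : hom1 V W) (f : hom1 U V) (x : ps_ob W),
    Hom (ps_ar f (ps_ar g x)) (ps_ar (hcomp g f) x);
  ps_comp_iso : forall (U V W : ob M) (g : hom1 V W) (f : hom1 U V) x, is_iso (ps_comp g f x);
  ps_comp_nat : forall (U V W : ob M) (g : hom1 V W) (f : hom1 U V) x y (h : Hom x y),
    ps_comp g f y ⊚ fmap (ps_ar f) (fmap (ps_ar g) h) =
    fmap (ps_ar (hcomp g f)) h ⊚ ps_comp g f x;
  ps_comp_natl : forall (U V W : ob M) (g g' : hom1 V W) (b : hom2 g g') (f : hom1 U V) x,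
    ps_comp g' f x ⊚ fmap (ps_ar f) (ps_ce b x) = ps_ce (hom2_rwhisk b f) x ⊚ ps_comp g f x;
  ps_comp_natr : forall (U V W : ob M) (g : hom1 V W) (f f' : hom1 U V) (a : hom2 f f') x,
    ps_comp g f' x ⊚ ps_ce a (ps_ar g x) = ps_ce (hom2_lwhisk g a) x ⊚ ps_comp g f x;
  (* coherence *)
  ps_idl : forall (U V : ob M) (f : hom1 U V) x,
    ps_ce (f := hcomp (hid V) f) (hom2_of_eq (hcomp_idl f)) x
      ⊚ ps_comp (hid V) f x ⊚ fmap (ps_ar f) (ps_unit x) = idc (ps_ar f x);
  ps_idr : forall (U V : ob M) (f : hom1 U V) x,
    ps_ce (f := hcomp f (hid U)) (hom2_of_eq (hcomp_idr f)) x
      ⊚ ps_comp f (hid U) x ⊚ ps_unit (ps_ar f x) = idc (ps_ar f x);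
  ps_assoc : forall (U V W Z : ob M) (h : hom1 W Z) (g : hom1 V W) (f : hom1 U V) x,
    ps_ce (f := hcomp h (hcomp g f)) (g := hcomp (hcomp h g) f)
        (hom2_of_eq (hcomp_assoc h g f)) x
      ⊚ ps_comp h (hcomp g f) x ⊚ ps_comp g f (ps_ar h x) =
    ps_comp (hcomp h g) f x ⊚ fmap (ps_ar f) (ps_comp h g x)
}.

Arguments ps_ar {_} _ {_ _} _. Arguments ps_ce {_} _ {_ _ _ _} _ _.
Arguments ps_unit {_} _ {_} _. Arguments ps_comp {_} _ {_ _ _} _ _ _.

(** The functor [M(U, L) -> F U] that sends [f] to [F f x]. *)
Definition restrict (M : TwoCat) (F : psfunctor M) (L : ob M) (x : F L) (U : ob M) :
  Functor (homcat U L) (F U).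
Proof.
  refine {| fob := fun f : homcat U L => ps_ar F (f : hom1 U L) x;
            fmap := fun (f g : homcat U L) (a : Hom f g) => ps_ce F a x |}.
  - intros f. apply ps_ce_id.
  - intros f g h b a. apply ps_ce_vcomp.
Defined.

Definition universal (M : TwoCat) (F : psfunctor M) (L : ob M) (x : F L) : Prop :=
  forall U : ob M, is_equivalence (restrict x U).

Definition birepresents (M : TwoCat) (F : psfunctor M) (L : ob M) : Prop :=
  exists x : F L, universal x.

Lemma src_hom1 (M : TwoCat) (U V : ob M) (f : hom1 U V) : src1 f = U.
Proof. apply (hom_ar_bd f). Qed.
Lemma tgt_hom1 (M : TwoCat) (U V : ob M) (f : hom1 U V) : tgt1 f = V.
Proof. apply (hom_ar_bd f). Qed.
Lemma src_hom2 (M : TwoCat) (f g : ar M) (a : hom2 f g) : src2 a = f.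
Proof. apply (hom_ce_bd a). Qed.
Lemma tgt_hom2 (M : TwoCat) (f g : ar M) (a : hom2 f g) : tgt2 a = g.
Proof. apply (hom_ce_bd a). Qed.
Ltac bd_hom tac := match goal with
  | |- context [src1 (hom_ar ?f)] => rw (src_hom1 f) tac
  | |- context [tgt1 (hom_ar ?f)] => rw (tgt_hom1 f) tac
  | |- context [src2 (hom_ce ?a)] => rw (src_hom2 a) tac
  | |- context [tgt2 (hom_ce ?a)] => rw (tgt_hom2 a) tac
  end.
Ltac bd_gen tac ::= bd_hom tac.

Lemma lwhisk_id1' (M : TwoCat) (a : ce M) A : tgt1 (src2 a) = A -> id1 A ▹ a = a.
Proof. intros <-. apply lwhisk_id1. Qed.
Lemma rwhisk_id1' (M : TwoCat) (a : ce M) A : src1 (src2 a) = A -> a ◃ id1 A = a.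
Proof. intros <-. apply rwhisk_id1. Qed.

(** [nf] distributes whiskering and tensoring over vertical composition, merges
    iterated whiskerings and removes identities. *)

Ltac nf_step tac := match goal with
  | |- context [?A ⋉₂ id2 ?f] => rw (ltens2_id2 A f) tac
  | |- context [id2 ?f ⋊₂ ?A] => rw (rtens2_id2 f A) tac
  | |- context [?A ⋉₂ (?B ⋉₂ ?a)] => rw (ltens2_ltens2 A B a) tac
  | |- context [(?A ⋉₂ ?a) ⋊₂ ?B] => rw (lrtens2 A a B) tac
  | |- context [(?a ⋊₂ ?A) ⋊₂ ?B] => rw (rtens2_rtens2 a A B) tac
  | |- context [?g ▹ id2 ?f] => rw (@lwhisk_id2 _ f g) tac
  | |- context [id2 ?g ◃ ?f] => rw (@rwhisk_id2 _ f g) tac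
  | |- context [id1 ?A ▹ ?a] => rw (@lwhisk_id1' _ a A) tac
  | |- context [?a ◃ id1 ?A] => rw (@rwhisk_id1' _ a A) tac
  | |- context [id2 ?f • ?a] => rw (@vcomp_idl' _ a f) tac
  | |- context [?a • id2 ?f] => rw (@vcomp_idr' _ a f) tac
  | |- context [?A ⋉₂ (?b • ?a)] => rw (@ltens2_vcomp _ A a b) tac
  | |- context [(?b • ?a) ⋊₂ ?A] => rw (@rtens2_vcomp _ a b A) tac
  | |- context [?A ⋉₂ (?g ▹ ?a)] => rw (@ltens2_lwhisk _ A g a) tac
  | |- context [?A ⋉₂ (?a ◃ ?f)] => rw (@ltens2_rwhisk _ A a f) tac
  | |- context [(?g ▹ ?a) ⋊₂ ?A] => rw (@rtens2_lwhisk _ g a A) tac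
  | |- context [(?a ◃ ?f) ⋊₂ ?A] => rw (@rtens2_rwhisk _ a f A) tac
  | |- context [?g ▹ (?b • ?a)] => rw (@lwhisk_vcomp _ g a b) tac
  | |- context [(?b • ?a) ◃ ?f] => rw (@rwhisk_vcomp _ a b f) tac
  | |- context [(?g ▹ ?a) ◃ ?f] => rw (@lrwhisk _ g a f) tac
  | |- context [?h ▹ (?g ▹ ?a)] => rw_rev (@lwhisk_comp1 _ g h a) tac
  | |- context [(?a ◃ ?g) ◃ ?f] => rw_rev (@rwhisk_comp1 _ a f g) tac
  | |- context [?c • (?b • ?a)] => rw (@vcomp_assoc _ a b c) tac
  end.

Ltac nf := repeat (nf_step bd).

(** [nfb] also normalizes the 1-cells. *)
Ltac nfb := repeat first [ nf_step bd | bd_step bd ].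

Ltac split2 := split; simpl; bd.

Lemma whisk_exchange' (M : TwoCat) (a b : ce M) f f' g g' :
  a ⦂ f ⟹ f' -> b ⦂ g ⟹ g' -> tgt1 f = src1 g ->
  (b ◃ f') • (g ▹ a) = (g' ▹ a) • (b ◃ f).
Proof. intros [<- <-] [<- <-]. apply whisk_exchange. Qed.

Lemma homcat_iso (M : TwoCat) (U V : ob M) (f g : homcat U V) (a : hom2 f g) :
  invertible a -> is_iso (C := homcat U V) a.
Proof.
  intros [b [E [E1 E2]]]. rewrite src_hom2, tgt_hom2 in *.
  exists (Build_hom2 E). now split; apply hom2_eq.
Qed.

Ltac bd2 := split; simpl; bd.
Ltac hom2_tac := intros; apply hom2_eq; simpl; nfb; try reflexivity.

(** The pseudofunctor [M(- ⊗ B, C)]. *)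
Section TensorHom.
Context (M : GrayMonoid) (B C : ob M).

Definition th_ob (U V : ob M) (f : hom1 U V) (x : hom1 (V ⊗ B) C) : hom1 (U ⊗ B) C.
Proof. exists (x ∘ (f ⋊ B)). abstract bd2. Defined.

Definition th_fun (U V : ob M) (f : hom1 U V) :
  Functor (homcat (V ⊗ B) C) (homcat (U ⊗ B) C).
Proof.
  unshelve refine {| fob := th_ob f : homcat _ _ -> homcat _ _ |}; simpl.
  - intros x y a. exists (a ◃ (f ⋊ B)). abstract bd2.
  - hom2_tac.
  - hom2_tac.
Defined.

Definition th_ce (U V : ob M) (f g : hom1 U V) (a : hom2 f g) (x : hom1 (V ⊗ B) C) :
  hom2 (th_ob f x) (th_ob g x).
Proof. exists (x ▹ (a ⋊₂ B)). abstract bd2. Defined.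

Definition th_unit (U : ob M) (x : hom1 (U ⊗ B) C) : hom2 x (th_ob (hid U) x).
Proof. exists (id2 x). abstract bd2. Defined.

Definition th_comp (U V W : ob M) (g : hom1 V W) (f : hom1 U V) (x : hom1 (W ⊗ B) C) :
  hom2 (th_ob f (th_ob g x)) (th_ob (hcomp g f) x).
Proof. exists (id2 (x ∘ (g ⋊ B) ∘ (f ⋊ B))). abstract bd2. Defined.

Definition tensor_hom : psfunctor M.
Proof.
  unshelve refine {|
    ps_ob := fun U => homcat (U ⊗ B) C;
    ps_ar := th_fun;
    ps_ce := th_ce;
    ps_unit := th_unit;
    ps_comp := th_comp
  |}; simpl.
  2-3, 5, 7-12: hom2_tac.
  - intros U V f g a x y h. apply hom2_eq; simpl.
    symmetry. apply (whisk_exchange' (f := f ⋊ B) (f' := g ⋊ B)); [bd2 | apply hom_ce_bd | bd].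
  - intros U x. apply homcat_iso. exists (id2 x). apply inverse_id2.
  - intros U V W g f x. apply homcat_iso. eexists. apply inverse_id2.
Defined.
End TensorHom.

(** [M] is left closed: each [- ⊗ B] has a right biadjoint, that is, each
    [M(- ⊗ B, C)] is birepresentable.  The universal element is the evaluation, and
    [f ↦ ev B C ∘ (f ⊗ B)] is the closedness equivalence
    [M(X, [B, C]) -> M(ich ⊗ B, C)]. *)
Record LeftClosed (M : GrayMonoid) := {
  ihom : ob M -> ob M -> ob M;
  ev : ob M -> ob M -> ar M;
  ev_bd : forall B C : ob M, ev B C ⦂ ihom B C ⊗ B ⟶ C;
  ev_universal : forall B C : ob M,
    universal (F := tensor_hom B C) (L := ihom B C) (Build_hom1 (ev_bd B C))
}.

(** * Truncated pseudo-cosimplicial diagrams and their bicategorical limits *)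

Record TruncatedDiagram (M : TwoCat) (X0 X1 X2 : ob M) := {
  d0 : ar M;
  d1 : ar M;
  e0 : ar M;
  e1 : ar M;
  e2 : ar M;
  d0_bd : d0 ⦂ X0 ⟶ X1;
  d1_bd : d1 ⦂ X0 ⟶ X1;
  e0_bd : e0 ⦂ X1 ⟶ X2;
  e1_bd : e1 ⦂ X1 ⟶ X2;
  e2_bd : e2 ⦂ X1 ⟶ X2;
  k00 : ce M;
  k01 : ce M;
  k21 : ce M;
  k00_iso : k00 ⦂ e0 ∘ d0 ≅ e1 ∘ d0;
  k01_iso : k01 ⦂ e0 ∘ d1 ≅ e2 ∘ d0;
  k21_iso : k21 ⦂ e2 ∘ d1 ≅ e1 ∘ d1
}.

Section PseudoCones.
Context (M : TwoCat) (X0 X1 X2 : ob M) (D : TruncatedDiagram X0 X1 X2).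

Record PseudoCone (U : ob M) := {
  p0 : ar M;
  p1 : ar M;
  p2 : ar M;
  p0_bd : p0 ⦂ U ⟶ X0;
  p1_bd : p1 ⦂ U ⟶ X1;
  p2_bd : p2 ⦂ U ⟶ X2;
  pd0 : ce M;
  pd1 : ce M;
  pe0 : ce M;
  pe1 : ce M;
  pe2 : ce M;
  pd0_iso : pd0 ⦂ d0 D ∘ p0 ≅ p1;
  pd1_iso : pd1 ⦂ d1 D ∘ p0 ≅ p1;
  pe0_iso : pe0 ⦂ e0 D ∘ p1 ≅ p2;
  pe1_iso : pe1 ⦂ e1 D ∘ p1 ≅ p2;
  pe2_iso : pe2 ⦂ e2 D ∘ p1 ≅ p2;
  pk00 : pe1 • (e1 D ▹ pd0) • (k00 D ◃ p0) = pe0 • (e0 D ▹ pd0);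
  pk01 : pe2 • (e2 D ▹ pd0) • (k01 D ◃ p0) = pe0 • (e0 D ▹ pd1);
  pk21 : pe1 • (e1 D ▹ pd1) • (k21 D ◃ p0) = pe2 • (e2 D ▹ pd1)
}.

Record PseudoConeHom (U : ob M) (x y : PseudoCone U) := {
  t0 : ce M;
  t1 : ce M;
  t2 : ce M;
  t0_bd : t0 ⦂ p0 x ⟹ p0 y;
  t1_bd : t1 ⦂ p1 x ⟹ p1 y;
  t2_bd : t2 ⦂ p2 x ⟹ p2 y;
  td0 : pd0 y • (d0 D ▹ t0) = t1 • pd0 x;
  td1 : pd1 y • (d1 D ▹ t0) = t1 • pd1 x;
  te0 : pe0 y • (e0 D ▹ t1) = t2 • pe0 x;
  te1 : pe1 y • (e1 D ▹ t1) = t2 • pe1 x;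
  te2 : pe2 y • (e2 D ▹ t1) = t2 • pe2 x
}.

Lemma cone_hom_eq (U : ob M) (x y : PseudoCone U) (s t : PseudoConeHom x y) :
  t0 s = t0 t -> t1 s = t1 t -> t2 s = t2 t -> s = t.
Proof.
  destruct s, t; simpl. intros <- <- <-. f_equal; apply proof_irrelevance.
Qed.

(* boundaries *)
Lemma src_d0 : src1 (d0 D) = X0. Proof. apply d0_bd. Qed.
Lemma tgt_d0 : tgt1 (d0 D) = X1. Proof. apply d0_bd. Qed.
Lemma src_d1 : src1 (d1 D) = X0. Proof. apply d1_bd. Qed.
Lemma tgt_d1 : tgt1 (d1 D) = X1. Proof. apply d1_bd. Qed.
Lemma src_e0 : src1 (e0 D) = X1. Proof. apply e0_bd. Qed.
Lemma tgt_e0 : tgt1 (e0 D) = X2. Proof. apply e0_bd. Qed.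
Lemma src_e1 : src1 (e1 D) = X1. Proof. apply e1_bd. Qed.
Lemma tgt_e1 : tgt1 (e1 D) = X2. Proof. apply e1_bd. Qed.
Lemma src_e2 : src1 (e2 D) = X1. Proof. apply e2_bd. Qed.
Lemma tgt_e2 : tgt1 (e2 D) = X2. Proof. apply e2_bd. Qed.
Lemma src_k00 : src2 (k00 D) = e0 D ∘ d0 D. Proof. apply k00_iso. Qed.
Lemma tgt_k00 : tgt2 (k00 D) = e1 D ∘ d0 D. Proof. apply k00_iso. Qed.
Lemma src_k01 : src2 (k01 D) = e0 D ∘ d1 D. Proof. apply k01_iso. Qed.
Lemma tgt_k01 : tgt2 (k01 D) = e2 D ∘ d0 D. Proof. apply k01_iso. Qed.
Lemma src_k21 : src2 (k21 D) = e2 D ∘ d1 D. Proof. apply k21_iso. Qed.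
Lemma tgt_k21 : tgt2 (k21 D) = e1 D ∘ d1 D. Proof. apply k21_iso. Qed.

Lemma src_p0 (U : ob M) (x : PseudoCone U) : src1 (p0 x) = U. Proof. apply p0_bd. Qed.
Lemma tgt_p0 (U : ob M) (x : PseudoCone U) : tgt1 (p0 x) = X0. Proof. apply p0_bd. Qed.
Lemma src_p1 (U : ob M) (x : PseudoCone U) : src1 (p1 x) = U. Proof. apply p1_bd. Qed.
Lemma tgt_p1 (U : ob M) (x : PseudoCone U) : tgt1 (p1 x) = X1. Proof. apply p1_bd. Qed.
Lemma src_p2 (U : ob M) (x : PseudoCone U) : src1 (p2 x) = U. Proof. apply p2_bd. Qed.
Lemma tgt_p2 (U : ob M) (x : PseudoCone U) : tgt1 (p2 x) = X2. Proof. apply p2_bd. Qed.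
Lemma src_pd0 (U : ob M) (x : PseudoCone U) : src2 (pd0 x) = d0 D ∘ p0 x.
Proof. apply pd0_iso. Qed.
Lemma tgt_pd0 (U : ob M) (x : PseudoCone U) : tgt2 (pd0 x) = p1 x.
Proof. apply pd0_iso. Qed.
Lemma src_pd1 (U : ob M) (x : PseudoCone U) : src2 (pd1 x) = d1 D ∘ p0 x.
Proof. apply pd1_iso. Qed.
Lemma tgt_pd1 (U : ob M) (x : PseudoCone U) : tgt2 (pd1 x) = p1 x.
Proof. apply pd1_iso. Qed.
Lemma src_pe0 (U : ob M) (x : PseudoCone U) : src2 (pe0 x) = e0 D ∘ p1 x.
Proof. apply pe0_iso. Qed.
Lemma tgt_pe0 (U : ob M) (x : PseudoCone U) : tgt2 (pe0 x) = p2 x.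
Proof. apply pe0_iso. Qed.
Lemma src_pe1 (U : ob M) (x : PseudoCone U) : src2 (pe1 x) = e1 D ∘ p1 x.
Proof. apply pe1_iso. Qed.
Lemma tgt_pe1 (U : ob M) (x : PseudoCone U) : tgt2 (pe1 x) = p2 x.
Proof. apply pe1_iso. Qed.
Lemma src_pe2 (U : ob M) (x : PseudoCone U) : src2 (pe2 x) = e2 D ∘ p1 x.
Proof. apply pe2_iso. Qed.
Lemma tgt_pe2 (U : ob M) (x : PseudoCone U) : tgt2 (pe2 x) = p2 x.
Proof. apply pe2_iso. Qed.
Lemma src_t0 (U : ob M) (x y : PseudoCone U) (t : PseudoConeHom x y) : src2 (t0 t) = p0 x.
Proof. apply t0_bd. Qed.
Lemma tgt_t0 (U : ob M) (x y : PseudoCone U) (t : PseudoConeHom x y) : tgt2 (t0 t) = p0 y.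
Proof. apply t0_bd. Qed.
Lemma src_t1 (U : ob M) (x y : PseudoCone U) (t : PseudoConeHom x y) : src2 (t1 t) = p1 x.
Proof. apply t1_bd. Qed.
Lemma tgt_t1 (U : ob M) (x y : PseudoCone U) (t : PseudoConeHom x y) : tgt2 (t1 t) = p1 y.
Proof. apply t1_bd. Qed.
Lemma src_t2 (U : ob M) (x y : PseudoCone U) (t : PseudoConeHom x y) : src2 (t2 t) = p2 x.
Proof. apply t2_bd. Qed.
Lemma tgt_t2 (U : ob M) (x y : PseudoCone U) (t : PseudoConeHom x y) : tgt2 (t2 t) = p2 y.
Proof. apply t2_bd. Qed.
End PseudoCones.

Ltac bd_cone tac := match goal with
  | |- context [src1 (d0 ?D)] => rw (src_d0 D) tac
  | |- context [tgt1 (d0 ?D)] => rw (tgt_d0 D) tac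
  | |- context [src1 (d1 ?D)] => rw (src_d1 D) tac
  | |- context [tgt1 (d1 ?D)] => rw (tgt_d1 D) tac
  | |- context [src1 (e0 ?D)] => rw (src_e0 D) tac
  | |- context [tgt1 (e0 ?D)] => rw (tgt_e0 D) tac
  | |- context [src1 (e1 ?D)] => rw (src_e1 D) tac
  | |- context [tgt1 (e1 ?D)] => rw (tgt_e1 D) tac
  | |- context [src1 (e2 ?D)] => rw (src_e2 D) tac
  | |- context [tgt1 (e2 ?D)] => rw (tgt_e2 D) tac
  | |- context [src2 (k00 ?D)] => rw (src_k00 D) tac
  | |- context [tgt2 (k00 ?D)] => rw (tgt_k00 D) tac
  | |- context [src2 (k01 ?D)] => rw (src_k01 D) tac
  | |- context [tgt2 (k01 ?D)] => rw (tgt_k01 D) tac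
  | |- context [src2 (k21 ?D)] => rw (src_k21 D) tac
  | |- context [tgt2 (k21 ?D)] => rw (tgt_k21 D) tac
  | |- context [src1 (p0 ?x)] => rw (src_p0 x) tac
  | |- context [tgt1 (p0 ?x)] => rw (tgt_p0 x) tac
  | |- context [src1 (p1 ?x)] => rw (src_p1 x) tac
  | |- context [tgt1 (p1 ?x)] => rw (tgt_p1 x) tac
  | |- context [src1 (p2 ?x)] => rw (src_p2 x) tac
  | |- context [tgt1 (p2 ?x)] => rw (tgt_p2 x) tac
  | |- context [src2 (pd0 ?x)] => rw (src_pd0 x) tac
  | |- context [tgt2 (pd0 ?x)] => rw (tgt_pd0 x) tac
  | |- context [src2 (pd1 ?x)] => rw (src_pd1 x) tac
  | |- context [tgt2 (pd1 ?x)] => rw (tgt_pd1 x) tac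
  | |- context [src2 (pe0 ?x)] => rw (src_pe0 x) tac
  | |- context [tgt2 (pe0 ?x)] => rw (tgt_pe0 x) tac
  | |- context [src2 (pe1 ?x)] => rw (src_pe1 x) tac
  | |- context [tgt2 (pe1 ?x)] => rw (tgt_pe1 x) tac
  | |- context [src2 (pe2 ?x)] => rw (src_pe2 x) tac
  | |- context [tgt2 (pe2 ?x)] => rw (tgt_pe2 x) tac
  | |- context [src2 (t0 ?x)] => rw (src_t0 x) tac
  | |- context [tgt2 (t0 ?x)] => rw (tgt_t0 x) tac
  | |- context [src2 (t1 ?x)] => rw (src_t1 x) tac
  | |- context [tgt2 (t1 ?x)] => rw (tgt_t1 x) tac
  | |- context [src2 (t2 ?x)] => rw (src_t2 x) tac
  | |- context [tgt2 (t2 ?x)] => rw (tgt_t2 x) tac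
  end.
Ltac bd_gen tac ::= first [ bd_hom tac | bd_cone tac ].

Section PseudoConeFunctor.
Context (M : TwoCat) (X0 X1 X2 : ob M) (D : TruncatedDiagram X0 X1 X2).

(** A compatibility square of cone morphisms, and its behaviour under composition and
    restriction. *)
Lemma square_id (x x' : ar M) (d : ar M) (phi : ce M) : phi ⦂ d ∘ x ⟹ x' -> tgt1 x = src1 d ->
  phi • (d ▹ id2 x) = id2 x' • phi.
Proof. intros [E1 E2] E. nfb. reflexivity. Qed.

Lemma square_comp (d : ar M) (x y z x' y' z' : ar M) (s t s' t' p q r : ce M) :
  s ⦂ x ⟹ y -> t ⦂ y ⟹ z -> s' ⦂ x' ⟹ y' -> t' ⦂ y' ⟹ z' ->
  p ⦂ d ∘ x ⟹ x' -> q ⦂ d ∘ y ⟹ y' -> r ⦂ d ∘ z ⟹ z' -> tgt1 x = src1 d ->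
  q • (d ▹ s) = s' • p -> r • (d ▹ t) = t' • q ->
  r • (d ▹ (t • s)) = (t' • s') • p.
Proof.
  intros [S1 S2] [T1 T2] [S1' S2'] [T1' T2'] [P1 P2] [Q1 Q2] [R1 R2] E H1 H2.
  assert (E' : tgt1 y = src1 d) by (rewrite <- S2, tgt_glob, S1; exact E).
  rewrite lwhisk_vcomp by bd.
  rewrite vcomp_assoc by bd. rewrite H2.
  rewrite <- (vcomp_assoc (a := d ▹ s)) by bd. rewrite H1.
  rewrite vcomp_assoc by bd. reflexivity.
Qed.

Lemma square_rwhisk (d : ar M) (x y x' y' : ar M) (s s' p q : ce M) f :
  s ⦂ x ⟹ y -> s' ⦂ x' ⟹ y' -> p ⦂ d ∘ x ⟹ x' -> q ⦂ d ∘ y ⟹ y' ->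
  tgt1 x = src1 d -> tgt1 f = src1 x ->
  q • (d ▹ s) = s' • p ->
  (q ◃ f) • (d ▹ (s ◃ f)) = (s' ◃ f) • (p ◃ f).
Proof.
  intros [S1 S2] [S1' S2'] [P1 P2] [Q1 Q2] E F H.
  assert (E' : tgt1 y = src1 d) by (rewrite <- S2, tgt_glob, S1; exact E).
  assert (F' : src1 y = src1 x) by (rewrite <- S2, src_glob, S1; reflexivity).
  assert (G : src1 x' = src1 x) by (rewrite <- P2, src_glob, P1; bd).
  rewrite <- lrwhisk by bd. rewrite <- !rwhisk_vcomp by bd. now rewrite H.
Qed.

Lemma square_lwhisk (d : ar M) (x x' : ar M) (p a : ce M) f g :
  p ⦂ d ∘ x ⟹ x' -> a ⦂ f ⟹ g -> tgt1 x = src1 d -> tgt1 f = src1 x ->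
  (p ◃ g) • (d ▹ (x ▹ a)) = (x' ▹ a) • (p ◃ f).
Proof.
  intros [P1 P2] [A1 A2] E F.
  rewrite <- lwhisk_comp1 by bd.
  apply (whisk_exchange' (f := f) (f' := g) (g := d ∘ x) (g' := x')); [now split | now split | bd].
Qed.

Lemma square_inv (d : ar M) (x y x' y' : ar M) (s s' p q i i' : ce M) :
  s ⦂ x ⟹ y -> s' ⦂ x' ⟹ y' -> p ⦂ d ∘ x ⟹ x' -> q ⦂ d ∘ y ⟹ y' ->
  tgt1 x = src1 d -> inverse_of s i -> inverse_of s' i' ->
  q • (d ▹ s) = s' • p -> p • (d ▹ i) = i' • q.
Proof.
  intros [S1 S2] [S1' S2'] [P1 P2] [Q1 Q2] E [[I1 I2] [I3 I4]] [[I1' I2'] [I3' I4']] H.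
  rewrite S2 in I1, I4. rewrite S1 in I2, I3. rewrite S2' in I1', I4'. rewrite S1' in I2', I3'.
  assert (E' : tgt1 y = src1 d) by (rewrite <- S2, tgt_glob, S1; exact E).
  assert (K : i' • (q • (d ▹ s)) • (d ▹ i) = i' • (s' • p) • (d ▹ i)) by now rewrite H.
  rewrite (vcomp_assoc (a := p)), I3', (vcomp_idl' P2) in K by bd.
  rewrite <- K, <- (vcomp_assoc (a := d ▹ i)), <- (vcomp_assoc (a := d ▹ i)),
    <- lwhisk_vcomp, I4 by bd.
  nfb; reflexivity.
Qed.

Definition cone_hom_id (U : ob M) (x : PseudoCone D U) : PseudoConeHom x x.
Proof.
  refine {| t0 := id2 (p0 x); t1 := id2 (p1 x); t2 := id2 (p2 x) |}; try apply is2_id2.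
  - apply square_id; [apply pd0_iso | bd].
  - apply square_id; [apply pd1_iso | bd].
  - apply square_id; [apply pe0_iso | bd].
  - apply square_id; [apply pe1_iso | bd].
  - apply square_id; [apply pe2_iso | bd].
Defined.

Ltac cone_bd := first
  [ apply pd0_iso | apply pd1_iso | apply pe0_iso | apply pe1_iso | apply pe2_iso
  | apply t0_bd | apply t1_bd | apply t2_bd | apply td0 | apply td1 | apply te0
  | apply te1 | apply te2 | bd ].

Definition cone_hom_comp (U : ob M) (x y z : PseudoCone D U) (t : PseudoConeHom y z)
    (s : PseudoConeHom x y) : PseudoConeHom x z.
Proof.
  refine {| t0 := t0 t • t0 s; t1 := t1 t • t1 s; t2 := t2 t • t2 s |}.
  1-3: eapply is2_vcomp; cone_bd.
  all: eapply square_comp; cone_bd.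
Defined.

Definition PseudoConeCat (U : ob M) : Category.
Proof.
  refine {| Obj := PseudoCone D U; Hom := @PseudoConeHom M X0 X1 X2 D U;
            idc := @cone_hom_id U; cc := @cone_hom_comp U |};
    intros; apply cone_hom_eq; simpl; nfb; reflexivity.
Defined.

Lemma cone_iso (U : ob M) (x y : PseudoCone D U) (t : PseudoConeHom x y) :
  invertible (t0 t) -> invertible (t1 t) -> invertible (t2 t) ->
  is_iso (C := PseudoConeCat U) t.
Proof.
  intros [i I] [j J] [k K].
  assert (B0 : i ⦂ p0 y ⟹ p0 x) by (destruct I as [I _]; now rewrite src_t0, tgt_t0 in I).
  assert (B1 : j ⦂ p1 y ⟹ p1 x) by (destruct J as [J _]; now rewrite src_t1, tgt_t1 in J).
  assert (B2 : k ⦂ p2 y ⟹ p2 x) by (destruct K as [K _]; now rewrite src_t2, tgt_t2 in K).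
  unshelve eexists.
  - refine {| t0 := i; t1 := j; t2 := k |}; trivial.
    3-5: eapply (square_inv (t1_bd t) (t2_bd t)).
    1-2: eapply (square_inv (t0_bd t) (t1_bd t)).
    all: first [eassumption | cone_bd].
  - destruct (proj2 I) as [I1 I2], (proj2 J) as [J1 J2], (proj2 K) as [K1 K2].
    rewrite src_t0 in I1. rewrite tgt_t0 in I2. rewrite src_t1 in J1.
    rewrite tgt_t1 in J2. rewrite src_t2 in K1. rewrite tgt_t2 in K2.
    now split; apply cone_hom_eq.
Qed.

Definition cone_ob (U V : ob M) (f : hom1 U V) (x : PseudoCone D V) : PseudoCone D U.
Proof.
  refine {| p0 := p0 x ∘ f; p1 := p1 x ∘ f; p2 := p2 x ∘ f;
            pd0 := pd0 x ◃ f; pd1 := pd1 x ◃ f;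
            pe0 := pe0 x ◃ f; pe1 := pe1 x ◃ f; pe2 := pe2 x ◃ f |}.
  1-3: split; bd.
  1-5: rewrite comp1_assoc by bd; apply iso2_rwhisk; [cone_bd | bd].
  all: rewrite <- !lrwhisk, rwhisk_comp1, <- !rwhisk_vcomp by bd; f_equal.
  - apply pk00.
  - apply pk01.
  - apply pk21.
Defined.

Definition cone_map (U V : ob M) (f : hom1 U V) (x y : PseudoCone D V)
    (t : PseudoConeHom x y) : PseudoConeHom (cone_ob f x) (cone_ob f y).
Proof.
  refine {| t0 := t0 t ◃ f : ce M; t1 := t1 t ◃ f : ce M; t2 := t2 t ◃ f : ce M |}; simpl.
  1-3: split; bd.
  all: eapply square_rwhisk; cone_bd.
Defined.

Definition cone_fun (U V : ob M) (f : hom1 U V) :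
  Functor (PseudoConeCat V) (PseudoConeCat U).
Proof.
  refine {| fob := cone_ob f : PseudoConeCat V -> PseudoConeCat U;
            fmap := @cone_map U V f |};
    intros; apply cone_hom_eq; simpl; nfb; reflexivity.
Defined.

Definition cone_ce (U V : ob M) (f g : hom1 U V) (a : hom2 f g) (x : PseudoCone D V) :
  PseudoConeHom (cone_ob f x) (cone_ob g x).
Proof.
  refine {| t0 := p0 x ▹ a : ce M; t1 := p1 x ▹ a : ce M; t2 := p2 x ▹ a : ce M |}; simpl.
  1-3: split; bd.
  all: eapply square_lwhisk; first [apply hom_ce_bd | cone_bd].
Defined.

Definition cone_unit (U : ob M) (x : PseudoCone D U) : PseudoConeHom x (cone_ob (hid U) x).
Proof.
  refine {| t0 := id2 (p0 x); t1 := id2 (p1 x); t2 := id2 (p2 x) |}; simpl.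
  1-3: split; bd.
  all: nfb; reflexivity.
Defined.

Definition cone_comp (U V W : ob M) (g : hom1 V W) (f : hom1 U V) (x : PseudoCone D W) :
  PseudoConeHom (cone_ob f (cone_ob g x)) (cone_ob (hcomp g f) x).
Proof.
  refine {| t0 := id2 (p0 x ∘ g ∘ f); t1 := id2 (p1 x ∘ g ∘ f);
            t2 := id2 (p2 x ∘ g ∘ f) |}; simpl.
  1-3: split; bd.
  all: nfb; reflexivity.
Defined.

(** The pseudofunctor of pseudo-cones over [D]. *)
Definition pseudo_cones : psfunctor M.
Proof.
  unshelve refine {|
    ps_ob := PseudoConeCat;
    ps_ar := cone_fun;
    ps_ce := cone_ce;
    ps_unit := cone_unit;
    ps_comp := cone_comp
  |}; simpl.
  2-3, 5, 7-12: intros; apply cone_hom_eq; simpl; nfb; reflexivity.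
  - intros U V f g a x y h. apply cone_hom_eq; simpl; symmetry;
      apply whisk_exchange' with (f := hom_ar f); first [apply hom_ce_bd | cone_bd].
  - intros U x. apply cone_iso; eexists; apply inverse_id2.
  - intros U V W g f x. apply cone_iso; eexists; apply inverse_id2.
Defined.

(** [L] is a bicategorical limit of [D]. *)
Definition is_bilimit (L : ob M) : Prop := birepresents pseudo_cones L.
End PseudoConeFunctor.

(** * Monoidal objects *)

Record MonoidalObject (M : GrayMonoid) := {
  carrier : ob M;
  mul : ar M;
  one : ar M;
  asc : ce M;
  lun : ce M;
  run : ce M;
  mul_bd : mul ⦂ carrier ⊗ carrier ⟶ carrier;
  one_bd : one ⦂ unit0 M ⟶ carrier;
  asc_iso : asc ⦂ mul ∘ (mul ⋊ carrier) ≅ mul ∘ (carrier ⋉ mul);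
  lun_iso : lun ⦂ mul ∘ (one ⋊ carrier) ≅ id1 carrier;
  run_iso : run ⦂ mul ∘ (carrier ⋉ one) ≅ id1 carrier;
  pentagon :
    (asc ◃ ((carrier ⊗ carrier) ⋉ mul)) • (mul ▹ inv2 (ich mul mul))
      • (asc ◃ (mul ⋊ (carrier ⊗ carrier))) =
    (mul ▹ (carrier ⋉₂ asc)) • (asc ◃ (carrier ⋉ mul ⋊ carrier)) • (mul ▹ (asc ⋊₂ carrier));
  triangle :
    (mul ▹ (carrier ⋉₂ lun)) • (asc ◃ (carrier ⋉ one ⋊ carrier)) = mul ▹ (run ⋊₂ carrier)
}.

Lemma src_mul (M : GrayMonoid) (A : MonoidalObject M) :
  src1 (mul A) = carrier A ⊗ carrier A.
Proof. apply mul_bd. Qed.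
Lemma tgt_mul (M : GrayMonoid) (A : MonoidalObject M) : tgt1 (mul A) = carrier A.
Proof. apply mul_bd. Qed.
Lemma src_asc (M : GrayMonoid) (A : MonoidalObject M) :
  src2 (asc A) = mul A ∘ (mul A ⋊ carrier A).
Proof. apply asc_iso. Qed.
Lemma tgt_asc (M : GrayMonoid) (A : MonoidalObject M) :
  tgt2 (asc A) = mul A ∘ (carrier A ⋉ mul A).
Proof. apply asc_iso. Qed.
Ltac bd_mon tac := match goal with
  | |- context [src1 (mul ?A)] => rw (src_mul A) tac
  | |- context [tgt1 (mul ?A)] => rw (tgt_mul A) tac
  | |- context [src2 (asc ?A)] => rw (src_asc A) tac
  | |- context [tgt2 (asc ?A)] => rw (tgt_asc A) tac
  end.
Ltac bd_gen tac ::= first [ bd_hom tac | bd_mon tac | bd_cone tac ].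

(** Reassociation of vertical composites of 2-cells whose composability is assumed. *)

Ltac adj := repeat first
  [ rewrite src_vcomp by adj | rewrite tgt_vcomp by adj ]; congruence.
Ltac va := repeat match goal with
  | |- context [(?c • ?b) • ?a] => rewrite <- (@vcomp_assoc _ a b c) by adj
  end; reflexivity.

Lemma rwhisk_vcomp4 (M : TwoCat) (c1 c2 c3 c4 : ce M) f :
  tgt2 c4 = src2 c3 -> tgt2 c3 = src2 c2 -> tgt2 c2 = src2 c1 -> tgt1 f = src1 (src2 c4) ->
  (c1 • c2 • c3 • c4) ◃ f = (c1 ◃ f) • (c2 ◃ f) • (c3 ◃ f) • (c4 ◃ f).
Proof.
  intros E1 E2 E3 E.
  assert (G : src1 (src2 c3) = src1 (src2 c4)) by (rewrite <- E1; apply src_glob).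
  assert (G' : src1 (src2 c2) = src1 (src2 c3)) by (rewrite <- E2; apply src_glob).
  rewrite !rwhisk_vcomp by adj. reflexivity.
Qed.

Lemma rwhisk_vcomp6 (M : TwoCat) (c1 c2 c3 c4 c5 c6 : ce M) f :
  tgt2 c6 = src2 c5 -> tgt2 c5 = src2 c4 ->
  tgt2 c4 = src2 c3 -> tgt2 c3 = src2 c2 -> tgt2 c2 = src2 c1 -> tgt1 f = src1 (src2 c6) ->
  (c1 • c2 • c3 • c4 • c5 • c6) ◃ f =
  (c1 ◃ f) • (c2 ◃ f) • (c3 ◃ f) • (c4 ◃ f) • (c5 ◃ f) • (c6 ◃ f).
Proof.
  intros E1 E2 E3 E4 E5 E.
  assert (G : src1 (src2 c5) = src1 (src2 c6)) by (rewrite <- E1; apply src_glob).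
  assert (G' : src1 (src2 c4) = src1 (src2 c5)) by (rewrite <- E2; apply src_glob).
  assert (G'' : src1 (src2 c3) = src1 (src2 c4)) by (rewrite <- E3; apply src_glob).
  assert (G3 : src1 (src2 c2) = src1 (src2 c3)) by (rewrite <- E4; apply src_glob).
  rewrite !rwhisk_vcomp by adj. reflexivity.
Qed.

Lemma cancel_ends (M : TwoCat) (x y r1 r2 z w : ce M) :
  tgt2 w = src2 z -> tgt2 z = src2 r2 -> tgt2 r2 = src2 r1 -> tgt2 r1 = src2 y ->
  tgt2 y = src2 x -> x • y = id2 (tgt2 r1) -> z • w = id2 (src2 r2) ->
  x • (y • r1 • r2 • z) • w = r1 • r2.
Proof.
  intros A1 A2 A3 A4 A5 E1 E2.
  transitivity ((x • y) • (r1 • (r2 • (z • w)))); [va |].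
  now rewrite E1, E2, vcomp_idr, vcomp_idl' by adj.
Qed.

Lemma glue_right (M : TwoCat) (c1 c2 c3 c4 c5 c6 c3' c4' c5' b d : ce M) :
  tgt2 c6 = src2 c5 -> tgt2 c5 = src2 c4 -> tgt2 c4 = src2 c3 -> tgt2 c3 = src2 c2 ->
  tgt2 c2 = src2 c1 -> tgt2 c6 = src2 c4' -> tgt2 c4' = src2 c3' -> tgt2 c3' = src2 c5' ->
  tgt2 c5' = src2 c2 -> tgt2 c3' = src2 d -> tgt2 d = src2 b ->
  (c3 • c4) • c5 = c5' • (c3' • c4') -> b • d = c1 • c2 • c5' ->
  c1 • (c2 • c3) • c4 • (c5 • c6) = b • (d • c3' • c4' • c6).
Proof.
  intros A1 A2 A3 A4 A5 A6 A7 A8 A9 A10 A11 K E.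
  transitivity ((c1 • c2) • (((c3 • c4) • c5) • c6)); [va | rewrite K].
  transitivity ((b • d) • (c3' • (c4' • c6))); [rewrite E |]; va.
Qed.

Lemma glue_left (M : TwoCat) (p1 p2 p3 p4 p5 p6 p7 p8 p9 q6 q7 r1 r2 s1 s2 b : ce M) :
  tgt2 p9 = src2 p8 -> tgt2 p8 = src2 p7 -> tgt2 p7 = src2 p6 -> tgt2 p6 = src2 p5 ->
  tgt2 p5 = src2 p4 -> tgt2 p4 = src2 p3 -> tgt2 p3 = src2 p2 -> tgt2 p2 = src2 p1 ->
  tgt2 p8 = src2 q6 -> tgt2 q6 = src2 q7 -> tgt2 q7 = src2 p5 -> tgt2 q6 = src2 r2 ->
  tgt2 r2 = src2 r1 -> tgt2 r1 = src2 p2 -> tgt2 r2 = src2 s2 -> tgt2 s2 = src2 s1 ->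
  tgt2 s1 = src2 b ->
  p6 • p7 = q7 • q6 -> p3 • (p4 • p5) • q7 = r1 • r2 -> (p1 • p2) • r1 = b • (s1 • s2) ->
  p1 • (p2 • p3) • p4 • (p5 • p6) • (p7 • p8) • p9 = b • (s1 • s2 • r2 • q6 • p8 • p9).
Proof.
  intros A1 A2 A3 A4 A5 A6 A7 A8 A9 A10 A11 A12 A13 A14 A15 A16 A17 K E L.
  transitivity ((p1 • p2) • ((p3 • (p4 • p5)) • ((p6 • p7) • (p8 • p9)))); [va | rewrite K].
  transitivity ((p1 • p2) • ((p3 • (p4 • p5) • q7) • (q6 • (p8 • p9)))); [va | rewrite E].
  transitivity (((p1 • p2) • r1) • (r2 • (q6 • (p8 • p9)))); [va | rewrite L; va].
Qed.

(** * Centre pieces *)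

Section CentrePieces.
Context (M : BraidedGrayMonoid) (A : MonoidalObject M).
Local Notation a := (carrier A).
Local Notation m := (mul A).

(** The two composites
    [m (m ⊗ 1) (u ⊗ 1 ⊗ 1) ⟹ m (1 ⊗ m) (1 ⊗ 1 ⊗ u) c_{U, A ⊗ A}]. *)
Definition piece_left (U : ob M) (u : ar M) (gamma : ce M) : ce M :=
  (asc A ◃ (((a ⊗ a) ⋉ u) ∘ br U (a ⊗ a)))
    • (m ▹ inv2 (ich m u) ◃ br U (a ⊗ a))
    • ((m ∘ (a ⋉ u)) ▹ brr U m)
    • (gamma ◃ (U ⋉ m))
    • (m ▹ inv2 (ich u m))
    • (asc A ◃ (u ⋊ (a ⊗ a))).

Definition piece_right (U : ob M) (u : ar M) (gamma : ce M) : ce M :=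
  ((m ∘ (a ⋉ m) ∘ ((a ⊗ a) ⋉ u)) ▹ brR U a a)
    • (m ▹ (a ⋉₂ gamma) ◃ (br U a ⋊ a))
    • (asc A ◃ ((a ⋉ u ⋊ a) ∘ (br U a ⋊ a)))
    • (m ▹ (gamma ⋊₂ a)).

Record CentrePiece (U : ob M) := {
  cp_ar : ar M;
  cp_ce : ce M;
  cp_ar_bd : cp_ar ⦂ U ⟶ a;
  cp_ce_iso : cp_ce ⦂ m ∘ (cp_ar ⋊ a) ≅ m ∘ (a ⋉ cp_ar) ∘ br U a;
  cp_eq : piece_left U cp_ar cp_ce = piece_right U cp_ar cp_ce
}.

Record CentrePieceHom (U : ob M) (x y : CentrePiece U) := {
  cph_ce : ce M;
  cph_bd : cph_ce ⦂ cp_ar x ⟹ cp_ar y;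
  cph_eq : cp_ce y • (m ▹ (cph_ce ⋊₂ a)) = (m ▹ (a ⋉₂ cph_ce) ◃ br U a) • cp_ce x
}.

Lemma cph_ext (U : ob M) (x y : CentrePiece U) (s t : CentrePieceHom x y) :
  cph_ce s = cph_ce t -> s = t.
Proof. destruct s, t; simpl. intros <-. f_equal; apply proof_irrelevance. Qed.

Lemma src_cp (U : ob M) (x : CentrePiece U) : src1 (cp_ar x) = U.
Proof. apply cp_ar_bd. Qed.
Lemma tgt_cp (U : ob M) (x : CentrePiece U) : tgt1 (cp_ar x) = a.
Proof. apply cp_ar_bd. Qed.
Lemma src_cp_ce (U : ob M) (x : CentrePiece U) : src2 (cp_ce x) = m ∘ (cp_ar x ⋊ a).
Proof. apply cp_ce_iso. Qed.
Lemma tgt_cp_ce (U : ob M) (x : CentrePiece U) :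
  tgt2 (cp_ce x) = m ∘ (a ⋉ cp_ar x) ∘ br U a.
Proof. apply cp_ce_iso. Qed.
Lemma src_cph (U : ob M) (x y : CentrePiece U) (t : CentrePieceHom x y) :
  src2 (cph_ce t) = cp_ar x.
Proof. apply cph_bd. Qed.
Lemma tgt_cph (U : ob M) (x y : CentrePiece U) (t : CentrePieceHom x y) :
  tgt2 (cph_ce t) = cp_ar y.
Proof. apply cph_bd. Qed.
End CentrePieces.

Ltac bd_piece tac := match goal with
  | |- context [src1 (cp_ar ?x)] => rw (src_cp x) tac
  | |- context [tgt1 (cp_ar ?x)] => rw (tgt_cp x) tac
  | |- context [src2 (cp_ce ?x)] => rw (src_cp_ce x) tac
  | |- context [tgt2 (cp_ce ?x)] => rw (tgt_cp_ce x) tac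
  | |- context [src2 (cph_ce ?t)] => rw (src_cph t) tac
  | |- context [tgt2 (cph_ce ?t)] => rw (tgt_cph t) tac
  end.
Ltac bd_gen tac ::= first [ bd_hom tac | bd_mon tac | bd_piece tac | bd_cone tac ].

Section CentrePieceCategory.
Context (M : BraidedGrayMonoid) (A : MonoidalObject M).
Local Notation a := (carrier A).
Local Notation m := (mul A).

Definition cph_id (U : ob M) (x : CentrePiece A U) : CentrePieceHom x x.
Proof.
  refine {| cph_ce := id2 (cp_ar x) |}; [apply is2_id2 | nfb; reflexivity].
Defined.

Definition cph_comp (U : ob M) (x y z : CentrePiece A U) (t : CentrePieceHom y z)
    (s : CentrePieceHom x y) : CentrePieceHom x z.
Proof.
  refine {| cph_ce := cph_ce t • cph_ce s |}; [eapply is2_vcomp; apply cph_bd |].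
  rewrite rtens2_vcomp, ltens2_vcomp, rwhisk_vcomp, !lwhisk_vcomp, vcomp_assoc, cph_eq by bd.
  rewrite <- (vcomp_assoc (b := cp_ce y)), cph_eq by bd.
  apply vcomp_assoc; bd.
Defined.

Definition CP (U : ob M) : Category.
Proof.
  refine {| Obj := CentrePiece A U; Hom := @CentrePieceHom M A U;
            idc := @cph_id U; cc := @cph_comp U |};
    intros; apply cph_ext; simpl; nfb; reflexivity.
Defined.

(** [γ] pasted with the pseudonaturality of the braiding at [f]. *)
Definition cp_restrict_ce (u f : ar M) (gamma : ce M) : ce M :=
  ((m ∘ (a ⋉ u)) ▹ brl f a) • (gamma ◃ (f ⋊ a)).

Section Restriction.
Context (U V : ob M) (u f : ar M) (gamma : ce M).
Hypotheses (u_s : src1 u = U) (u_t : tgt1 u = a) (f_s : src1 f = V) (f_t : tgt1 f = U)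
  (gamma_s : src2 gamma = m ∘ (u ⋊ a)) (gamma_t : tgt2 gamma = m ∘ (a ⋉ u) ∘ br U a).
Local Notation aa := (a ⊗ a).
Local Notation F := (f ⋊ (a ⊗ a)).
Local Notation P := (m ∘ (a ⋉ m) ∘ ((a ⊗ a) ⋉ u)).
Local Notation gamma' := (cp_restrict_ce u f gamma).

Lemma piece_right_restrict :
  piece_right A V (u ∘ f) gamma' = (P ▹ brl f aa) • (piece_right A U u gamma ◃ F).
Proof.
  unfold piece_right.
  replace ((m ∘ (a ⋉ m) ∘ (aa ⋉ (u ∘ f))) ▹ brR V a a) with ((P ∘ (aa ⋉ f)) ▹ brR V a a)
    by (f_equal; bd).
  replace (m ▹ (a ⋉₂ gamma') ◃ (br V a ⋊ a)) with
    (((P ▹ (a ⋉₂ brl f a)) ◃ (br V a ⋊ a))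
       • (m ▹ (a ⋉₂ gamma) ◃ ((a ⋉ f ⋊ a) ∘ (br V a ⋊ a))))
    by (unfold cp_restrict_ce; nfb; reflexivity).
  replace (asc A ◃ ((a ⋉ (u ∘ f) ⋊ a) ∘ (br V a ⋊ a))) with
    (asc A ◃ ((a ⋉ u ⋊ a) ∘ (a ⋉ f ⋊ a) ∘ (br V a ⋊ a))) by (f_equal; bd).
  replace (m ▹ (gamma' ⋊₂ a)) with
    (((m ∘ (m ⋊ a) ∘ (a ⋉ u ⋊ a)) ▹ (brl f a ⋊₂ a)) • ((m ▹ (gamma ⋊₂ a)) ◃ F))
    by (unfold cp_restrict_ce; nfb; reflexivity).
  rewrite rwhisk_vcomp4 by bd.
  apply glue_right with (c5' := (P ∘ (a ⋉ br U a)) ▹ (brl f a ⋊₂ a)).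
  1-11: bd.
  - pose proof (@whisk_exchange M (brl f a ⋊₂ a)
      ((m ▹ (a ⋉₂ gamma)) • (asc A ◃ (a ⋉ u ⋊ a)))) as K.
    transitivity ((((m ▹ (a ⋉₂ gamma)) • (asc A ◃ (a ⋉ u ⋊ a))) ◃ tgt2 (brl f a ⋊₂ a))
      • (src2 ((m ▹ (a ⋉₂ gamma)) • (asc A ◃ (a ⋉ u ⋊ a))) ▹ (brl f a ⋊₂ a))).
    { clear K. nfb. reflexivity. }
    rewrite K by bd. nfb. reflexivity.
  - pose proof (brR_mod1 f a a) as E. rewrite f_t, f_s in E.
    transitivity (P ▹ (brl f aa • (brR U a a ◃ F))); [nfb; reflexivity | rewrite E].
    nfb; reflexivity.
Qed.

Lemma piece_left_restrict :
  piece_left A V (u ∘ f) gamma' = (P ▹ brl f aa) • (piece_left A U u gamma ◃ F).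
Proof.
  unfold piece_left.
  assert (L : inv2 (ich (u ∘ f) m) = ((u ⋊ a) ▹ inv2 (ich f m)) • (inv2 (ich u m) ◃ F)).
  { apply inv2_eq. rewrite ich_compl, src_mul, tgt_mul by bd.
    apply inverse_vcomp; [bd | |].
    - apply inverse_lwhisk; [bd | apply inv2_spec, ich_iso].
    - apply inverse_rwhisk; [bd | apply inv2_spec, ich_iso]. }
  assert (L' : inv2 (ich m (u ∘ f)) =
    (inv2 (ich m u) ◃ (aa ⋉ f)) • ((a ⋉ u) ▹ inv2 (ich m f))).
  { apply inv2_eq. rewrite ich_compr, src_mul, tgt_mul by bd.
    apply inverse_vcomp; [bd | |].
    - apply inverse_rwhisk; [bd | apply inv2_spec, ich_iso].
    - apply inverse_lwhisk; [bd | apply inv2_spec, ich_iso]. }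
  rewrite L, L'. clear L L'.
  pose proof (brl_brr f m) as B. rewrite f_s, f_t, src_mul, tgt_mul in B.
  pose proof (inv2_spec (proj2 (ich_iso f m))) as [[F1 F2] [F3 F4]].
  pose proof (inv2_spec (proj2 (ich_iso m f))) as [[G1 G2] [G3 G4]].
  pose proof (inv2_spec (proj2 (ich_iso u m))) as [[H1 H2] _].
  pose proof (inv2_spec (proj2 (ich_iso m u))) as [[I1 I2] _].
  set (xf := inv2 (ich f m)) in *. set (xg := inv2 (ich m f)) in *.
  set (xu := inv2 (ich u m)) in *. set (xm := inv2 (ich m u)) in *.
  clearbody xf xg xu xm.
  rewrite src_ich in F2, F3, G2, G3, H2, I2. rewrite tgt_ich in F1, F4, G1, G4, H1, I1.
  rewrite u_s, u_t, src_mul, tgt_mul in *. rewrite f_s, f_t in *.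
  replace (asc A ◃ ((aa ⋉ (u ∘ f)) ∘ br V aa)) with
    (asc A ◃ ((aa ⋉ u) ∘ (aa ⋉ f) ∘ br V aa)) by (f_equal; bd).
  replace (m ▹ ((xm ◃ (aa ⋉ f)) • ((a ⋉ u) ▹ xg)) ◃ br V aa) with
    ((m ▹ xm ◃ ((aa ⋉ f) ∘ br V aa)) • ((m ∘ (a ⋉ u)) ▹ xg ◃ br V aa))
    by (nfb; reflexivity).
  replace ((m ∘ (a ⋉ (u ∘ f))) ▹ brr V m) with ((m ∘ (a ⋉ u) ∘ (a ⋉ f)) ▹ brr V m)
    by (f_equal; bd).
  replace (gamma' ◃ (V ⋉ m)) with
    (((m ∘ (a ⋉ u)) ▹ brl f a ◃ (V ⋉ m)) • (gamma ◃ ((f ⋊ a) ∘ (V ⋉ m))))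
    by (unfold cp_restrict_ce; nfb; reflexivity).
  replace (m ▹ (((u ⋊ a) ▹ xf) • (xu ◃ F))) with
    (((m ∘ (u ⋊ a)) ▹ xf) • ((m ▹ xu) ◃ F)) by (nfb; reflexivity).
  replace (asc A ◃ ((u ∘ f) ⋊ aa)) with ((asc A ◃ (u ⋊ aa)) ◃ F) by (nfb; reflexivity).
  rewrite rwhisk_vcomp6 by bd.
  apply glue_left with (q7 := (m ∘ (a ⋉ u) ∘ br U a) ▹ xf)
    (r1 := (m ∘ (a ⋉ u) ∘ (m ⋊ U)) ▹ brl f aa).
  1-17: clear F3 F4 G3 G4 B; bd.
  - rewrite <- rwhisk_comp1 by (clear F3 F4 G3 G4 B; bd).
    clear F3 F4 G3 G4 B.
    pose proof (@whisk_exchange M xf gamma) as K. rewrite F1, F2, gamma_s, gamma_t in K.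
    rewrite K by bd. reflexivity.
  - transitivity ((m ∘ (a ⋉ u)) ▹ ((xg ◃ br V aa)
      • (((a ⋉ f) ▹ brr V m) • (brl f a ◃ (V ⋉ m))) • (br U a ▹ xf))).
    { clear F3 F4 G3 G4 B. nfb. reflexivity. }
    transitivity ((m ∘ (a ⋉ u)) ▹ (((m ⋊ U) ▹ brl f aa) • (brr U m ◃ F))).
    + f_equal. rewrite <- B. clear B. apply cancel_ends.
      1-5: clear F3 F4 G3 G4; bd.
      * rewrite <- rwhisk_vcomp, G3, rwhisk_id2 by (clear F3 F4 G3 G4; bd).
        f_equal. clear F3 F4 G3 G4. bd.
      * rewrite <- lwhisk_vcomp, F4, lwhisk_id2 by (clear F3 F4 G3 G4; bd).
        f_equal. clear F3 F4 G3 G4. bd.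
    + clear F3 F4 G3 G4 B. nfb. reflexivity.
  - clear F3 F4 G3 G4 B.
    pose proof (@whisk_exchange M (brl f aa) ((asc A ◃ (aa ⋉ u)) • (m ▹ xm))) as K.
    transitivity ((((asc A ◃ (aa ⋉ u)) • (m ▹ xm)) ◃ tgt2 (brl f aa))
      • (src2 ((asc A ◃ (aa ⋉ u)) • (m ▹ xm)) ▹ brl f aa)).
    { clear K. nfb. reflexivity. }
    rewrite K by bd. nfb. reflexivity.
Qed.

End Restriction.
End CentrePieceCategory.

Section CentreFunctor.
Context (M : BraidedGrayMonoid) (A : MonoidalObject M).
Local Notation a := (carrier A).
Local Notation m := (mul A).

Definition cp_ob (U V : ob M) (f : hom1 V U) (x : CentrePiece A U) : CentrePiece A V.
Proof.
  refine {| cp_ar := cp_ar x ∘ f; cp_ce := cp_restrict_ce A (cp_ar x) f (cp_ce x) |}.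
  - abstract (split; bd).
  - unfold cp_restrict_ce.
    apply iso2_vcomp with (g := (m ∘ (a ⋉ cp_ar x) ∘ br U a) ∘ (f ⋊ a)).
    + rewrite rtens_comp1, comp1_assoc by bd.
      apply iso2_rwhisk; [apply cp_ce_iso | bd].
    + rewrite ltens_comp1 by bd.
      replace (m ∘ ((a ⋉ cp_ar x) ∘ (a ⋉ f)) ∘ br V a) with
        ((m ∘ (a ⋉ cp_ar x)) ∘ ((a ⋉ f) ∘ br V a)) by bd.
      rewrite <- comp1_assoc by bd.
      pose proof (brl_iso f a) as E. rewrite src_hom1, tgt_hom1 in E.
      apply iso2_lwhisk; [exact E | bd].
  - rewrite (@piece_left_restrict M A U V), (@piece_right_restrict M A U V), cp_eq;
      trivial; bd.
Defined.

Lemma cp_map_eq (U V : ob M) (f : hom1 V U) (x y : CentrePiece A U)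
    (t : CentrePieceHom x y) :
  cp_restrict_ce A (cp_ar y) f (cp_ce y) • (m ▹ ((cph_ce t ◃ f) ⋊₂ a)) =
  (m ▹ (a ⋉₂ (cph_ce t ◃ f)) ◃ br V a) • cp_restrict_ce A (cp_ar x) f (cp_ce x).
Proof.
  unfold cp_restrict_ce.
  transitivity (((m ∘ (a ⋉ cp_ar y)) ▹ brl f a)
    • ((cp_ce y • (m ▹ (cph_ce t ⋊₂ a))) ◃ (f ⋊ a))).
  { nfb. reflexivity. }
  rewrite cph_eq.
  pose proof (@whisk_exchange M (brl f a) (m ▹ (a ⋉₂ cph_ce t))) as K.
  transitivity (((tgt2 (m ▹ (a ⋉₂ cph_ce t)) ▹ brl f a)
    • ((m ▹ (a ⋉₂ cph_ce t)) ◃ src2 (brl f a))) • (cp_ce x ◃ (f ⋊ a))).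
  { clear K. nfb. reflexivity. }
  rewrite <- K by bd. clear K. nfb. reflexivity.
Qed.

Definition cp_map (U V : ob M) (f : hom1 V U) (x y : CentrePiece A U)
    (t : CentrePieceHom x y) : CentrePieceHom (cp_ob f x) (cp_ob f y).
Proof.
  refine {| cph_ce := cph_ce t ◃ f : ce M |}; simpl.
  - abstract (split; bd).
  - apply cp_map_eq.
Defined.

Definition cp_fun (U V : ob M) (f : hom1 V U) : Functor (CP A U) (CP A V).
Proof.
  refine {| fob := cp_ob f : CP A U -> CP A V; fmap := @cp_map U V f |};
    intros; apply cph_ext; simpl; nfb; reflexivity.
Defined.

Lemma cp_cell_eq (V U : ob M) (f g : hom1 V U) (b : hom2 f g) (x : CentrePiece A U) :
  cp_restrict_ce A (cp_ar x) g (cp_ce x) • (m ▹ ((cp_ar x ▹ b) ⋊₂ a)) =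
  (m ▹ (a ⋉₂ (cp_ar x ▹ b)) ◃ br V a) • cp_restrict_ce A (cp_ar x) f (cp_ce x).
Proof.
  unfold cp_restrict_ce.
  pose proof (@whisk_exchange M (b ⋊₂ a) (cp_ce x)) as K.
  pose proof (brl_nat b a) as N. rewrite src_hom2, tgt_hom2, src_hom1, tgt_hom1 in N.
  transitivity (((m ∘ (a ⋉ cp_ar x)) ▹ brl g a)
    • ((cp_ce x ◃ tgt2 (b ⋊₂ a)) • (src2 (cp_ce x) ▹ (b ⋊₂ a)))).
  { clear K N. nfb. reflexivity. }
  rewrite K by bd. clear K.
  transitivity (((m ∘ (a ⋉ cp_ar x)) ▹ (brl g a • (br U a ▹ (b ⋊₂ a))))
    • (cp_ce x ◃ (f ⋊ a))).
  { clear N. nfb. reflexivity. }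
  rewrite N. clear N. nfb. reflexivity.
Qed.

Definition cp_cell (V U : ob M) (f g : hom1 V U) (b : hom2 f g) (x : CentrePiece A U) :
  CentrePieceHom (cp_ob f x) (cp_ob g x).
Proof.
  refine {| cph_ce := cp_ar x ▹ b : ce M |}; simpl.
  - abstract (split; bd).
  - apply cp_cell_eq.
Defined.

Definition cp_unit (U : ob M) (x : CentrePiece A U) : CentrePieceHom x (cp_ob (hid U) x).
Proof.
  refine {| cph_ce := id2 (cp_ar x) |}; simpl.
  - abstract (split; bd).
  - abstract (unfold cp_restrict_ce; rewrite brl_id; nfb; reflexivity).
Defined.

Definition cp_comp (U V W : ob M) (g : hom1 V W) (f : hom1 U V) (x : CentrePiece A W) :
  CentrePieceHom (cp_ob f (cp_ob g x)) (cp_ob (hcomp g f) x).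
Proof.
  refine {| cph_ce := id2 (cp_ar x ∘ g ∘ f) |}; simpl.
  - abstract (split; bd).
  - abstract (unfold cp_restrict_ce; rewrite brl_comp by bd; nfb; reflexivity).
Defined.

Lemma cp_iso (U : ob M) (x y : CentrePiece A U) (t : CentrePieceHom x y) :
  invertible (cph_ce t) -> is_iso (C := CP A U) t.
Proof.
  intros [i I].
  assert (I0 : i ⦂ cp_ar y ⟹ cp_ar x) by (destruct I as [I _]; now rewrite src_cph, tgt_cph in I).
  assert (I1 : i • cph_ce t = id2 (cp_ar x)) by (destruct I as [_ [I _]]; now rewrite src_cph in I).
  assert (I2 : cph_ce t • i = id2 (cp_ar y)) by (destruct I as [_ [_ I]]; now rewrite tgt_cph in I).
  destruct I0 as [J1 J2].
  unshelve eexists.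
  - refine {| cph_ce := i |}; [now split |].
    transitivity (((m ▹ (a ⋉₂ (i • cph_ce t))) ◃ br U a) • cp_ce x • (m ▹ (i ⋊₂ a))).
    { rewrite I1. clear I I1 I2. nfb. reflexivity. }
    transitivity ((m ▹ (a ⋉₂ i) ◃ br U a)
      • (((m ▹ (a ⋉₂ cph_ce t)) ◃ br U a) • cp_ce x) • (m ▹ (i ⋊₂ a))).
    { clear I I1 I2. nfb. reflexivity. }
    replace (((m ▹ (a ⋉₂ cph_ce t)) ◃ br U a) • cp_ce x) with
      (cp_ce y • (m ▹ (cph_ce t ⋊₂ a))) by (rewrite cph_eq; f_equal; nfb; reflexivity).
    transitivity ((m ▹ (a ⋉₂ i) ◃ br U a) • cp_ce y • (m ▹ ((cph_ce t • i) ⋊₂ a))).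
    { clear I I1 I2. nfb. reflexivity. }
    rewrite I2. clear I I1 I2. nfb. reflexivity.
  - now split; apply cph_ext.
Qed.

(** The pseudofunctor of centre pieces for [A]. *)
Definition centre_pieces : psfunctor M.
Proof.
  unshelve refine {|
    ps_ob := CP A;
    ps_ar := fun V U f => cp_fun f;
    ps_ce := fun V U f g b => @cp_cell V U f g b;
    ps_unit := cp_unit;
    ps_comp := cp_comp
  |}; simpl.
  2-3, 5, 7-12: intros; apply cph_ext; simpl; nfb; reflexivity.
  - intros U V f g b x y h. apply cph_ext; simpl. symmetry.
    apply whisk_exchange' with (f := hom_ar f); [apply hom_ce_bd | apply cph_bd | bd].
  - intros U x. apply cp_iso. exists (id2 (cp_ar x)). apply inverse_id2.
  - intros U V W g f x. apply cp_iso. eexists. apply inverse_id2.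
Defined.

(** [L] is a centre of [A]. *)
Definition is_centre (L : ob M) : Prop := birepresents centre_pieces L.
End CentreFunctor.

(** * The diagram [CA]

    [A], [[A, A]] and [[A ⊗ A, A]], with face morphisms that correspond under the
    closedness equivalences to the morphisms named in the fields [ca_*_iso].  A 2-cell
    between morphisms [U ⟶ [A ⊗ A, A]] is determined by its image under
    [ev ∘ (- ⊗ A ⊗ A)]; the last three fields state that the images of the constraint
    2-cells are, modulo the chosen correspondences, given by associativity. *)

Section CADiagram.
Context (M : BraidedGrayMonoid) (H : LeftClosed M) (A : MonoidalObject M).
Local Notation a := (carrier A).
Local Notation m := (mul A).
Local Notation aa := (carrier A ⊗ carrier A).
Local Notation h := (ihom H (carrier A) (carrier A)).
Local Notation e := (ev H (carrier A) (carrier A)).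
Local Notation e' := (ev H (carrier A ⊗ carrier A) (carrier A)).

(** For [d : a ⟶ [a, a]] that corresponds to [f : a ⊗ a ⟶ a] by [delta], and for the
    [i]-th face [di : [a, a] ⟶ [a ⊗ a, a]] with its correspondence [epsi], the 2-cells
    from the transpose [e' (di d ⊗ 1 ⊗ 1)] of [di d] to
    [m (f ⊗ 1)], [f (1 ⊗ m)] and [m (1 ⊗ f) (c ⊗ 1)] respectively. *)
Definition transpose0 (d : ar M) (delta eps0 : ce M) : ce M :=
  (m ▹ (delta ⋊₂ a)) • (eps0 ◃ (d ⋊ aa)).

Definition transpose1 (d : ar M) (delta eps1 : ce M) : ce M :=
  (delta ◃ (a ⋉ m)) • (e ▹ inv2 (ich d m)) • (eps1 ◃ (d ⋊ aa)).

Definition transpose2 (d : ar M) (delta eps2 : ce M) : ce M :=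
  (m ▹ (a ⋉₂ delta) ◃ (br a a ⋊ a)) • ((m ∘ (a ⋉ e)) ▹ (brl d a ⋊₂ a))
    • (eps2 ◃ (d ⋊ aa)).

Record CADiagram := {
  ca_diagram :> TruncatedDiagram a h (ihom H aa a);
  ca_d0 : ce M;
  ca_d1 : ce M;
  ca_e0 : ce M;
  ca_e1 : ce M;
  ca_e2 : ce M;
  ca_d0_iso : ca_d0 ⦂ e ∘ (d0 ca_diagram ⋊ a) ≅ m;
  ca_d1_iso : ca_d1 ⦂ e ∘ (d1 ca_diagram ⋊ a) ≅ m ∘ br a a;
  ca_e0_iso : ca_e0 ⦂ e' ∘ (e0 ca_diagram ⋊ aa) ≅ m ∘ (e ⋊ a);
  ca_e1_iso : ca_e1 ⦂ e' ∘ (e1 ca_diagram ⋊ aa) ≅ e ∘ (h ⋉ m);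
  ca_e2_iso : ca_e2 ⦂ e' ∘ (e2 ca_diagram ⋊ aa) ≅ m ∘ (a ⋉ e) ∘ (br h a ⋊ a);
  (* [m (m ⊗ 1) ≅ m (1 ⊗ m)] *)
  ca_k00 :
    transpose1 (d0 ca_diagram) ca_d0 ca_e1 • (e' ▹ (k00 ca_diagram ⋊₂ aa)) =
    asc A • transpose0 (d0 ca_diagram) ca_d0 ca_e0;
  (* [m (m c ⊗ 1) ≅ m (1 ⊗ m) (c ⊗ 1)] *)
  ca_k01 :
    transpose2 (d0 ca_diagram) ca_d0 ca_e2 • (e' ▹ (k01 ca_diagram ⋊₂ aa)) =
    (asc A ◃ (br a a ⋊ a)) • transpose0 (d1 ca_diagram) ca_d1 ca_e0;
  (* [m (1 ⊗ m c) (c ⊗ 1) ≅ m (1 ⊗ m) c_{a, a ⊗ a} ≅ m (m ⊗ 1) c_{a, a ⊗ a} ≅ m c (1 ⊗ m)] *)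
  ca_k21 :
    (asc A ◃ br a aa) • (m ▹ brr a m) • transpose1 (d1 ca_diagram) ca_d1 ca_e1
      • (e' ▹ (k21 ca_diagram ⋊₂ aa)) =
    ((m ∘ (a ⋉ m)) ▹ brR a a a) • transpose2 (d1 ca_diagram) ca_d1 ca_e2
}.
End CADiagram.

(* Main.v *)
Require Import Defs.
From Stdlib Require Import ClassicalEpsilon.

Set Implicit Arguments.
Unset Strict Implicit.

(** A pseudo-cone over [CA] from [U] amounts to [u : U ⟶ A] with an invertible
    [θ : ∂₀ u ⟹ ∂₁ u] subject to one descent equation.  Closedness turns [θ] into an
    invertible 2-cell [m (u ⊗ 1) ⟹ m c (u ⊗ 1)], and composition with the naturality
    [c (u ⊗ 1) ≅ (1 ⊗ u) c] gives the 2-cell [γ] of a centre piece.  The two sides of the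
    descent equation are 2-cells between morphisms [U ⟶ [A ⊗ A, A]]; their transposes
    are, up to the same invertible 2-cells at both ends, the two composites in the
    axiom for [γ].  Hence the categories of pseudo-cones and of centre pieces are
    equivalent, pseudonaturally in [U], and have the same birepresenting objects. *)

(** * Equivalences of categories and birepresentability *)

(** The braiding [c_{U,A}] of a centre piece does not occur in [CA], which only contains braidings
    of [A] and [[A, A]] with [A]. The transpose of [θ] therefore ends in [m c_{A,A} (u ⊗ 1)], and
    every occurrence of [γ] costs a naturality cell [brl u A]. The two composites of the axiom need
    these cells at different places. They are all obtained from one cell [brl u (A ⊗ A)] placed
    after both transposes: [brR_mod1] splits it into the two that the composite with two factors [γ]
    needs, and [brl_brr] trades it for the one that the other composite needs. A pseudo-cone also
    has legs to [[A, A]] and [[A ⊗ A, A]], which a centre piece lacks and which are fixed only up to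
    isomorphism. So the comparison is not bijective on objects; it is shown to be fully faithful and
    essentially surjective. *)

Lemma is_iso_cc (C : Category) (x y z : C) (g : Hom y z) (f : Hom x y) :
  is_iso g -> is_iso f -> is_iso (g ⊚ f).
Proof.
  intros [g' [G1 G2]] [f' [F1 F2]]. exists (f' ⊚ g'). split.
  - now rewrite cc_assoc, <- (cc_assoc f'), G1, cc_idr.
  - now rewrite cc_assoc, <- (cc_assoc g), F2, cc_idr.
Qed.

Lemma is_iso_fmap (C D : Category) (F : Functor C D) (x y : C) (f : Hom x y) :
  is_iso f -> is_iso (fmap F f).
Proof.
  intros [g [G1 G2]]. exists (fmap F g). now rewrite <- !fmap_cc, G1, G2, !fmap_id.
Qed.

Lemma is_iso_sym (C : Category) (x y : C) (f : Hom x y) :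
  is_iso f -> exists g : Hom y x, is_iso g.
Proof. intros [g [G1 G2]]. exists g. now exists f. Qed.

Lemma iso_cancel_l (C : Category) (x y z : C) (g : Hom y z) (f f' : Hom x y) :
  is_iso g -> g ⊚ f = g ⊚ f' -> f = f'.
Proof.
  intros [g' [G1 _]] E. now rewrite <- (cc_idl f), <- (cc_idl f'), <- G1, <- !cc_assoc, E.
Qed.

Lemma iso_cancel_r (C : Category) (x y z : C) (g : Hom x y) (f f' : Hom y z) :
  is_iso g -> f ⊚ g = f' ⊚ g -> f = f'.
Proof.
  intros [g' [_ G2]] E. now rewrite <- (cc_idr f), <- (cc_idr f'), <- G2, !cc_assoc, E.
Qed.

Definition fully_faithful (C D : Category) (F : Functor C D) : Prop :=
  forall (x y : C) (g : Hom (F x) (F y)), exists! f : Hom x y, fmap F f = g.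

Definition ess_surjective (C D : Category) (F : Functor C D) : Prop :=
  forall y : D, exists (x : C) (f : Hom (F x) y), is_iso f.

Lemma ff_inj (C D : Category) (F : Functor C D) (x y : C) (f g : Hom x y) :
  fully_faithful F -> fmap F f = fmap F g -> f = g.
Proof.
  intros H E. destruct (H x y (fmap F g)) as [k [_ K]].
  now rewrite <- (K f E), <- (K g eq_refl).
Qed.

Lemma ff_reflects_iso (C D : Category) (F : Functor C D) (x y : C) (f : Hom x y) :
  fully_faithful F -> is_iso (fmap F f) -> is_iso f.
Proof.
  intros H [g [G1 G2]]. destruct (H y x g) as [k [K _]]. exists k.
  split; apply (ff_inj H); now rewrite fmap_cc, fmap_id, K.
Qed.

(** The right-hand side consists of existence statements in [Prop], whereas a quasi-inverse is data;
    indefinite description chooses its values on objects and morphisms. The functor laws survive the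
    choices because each chosen morphism is the only one that makes [eps] natural. *)
Lemma equivalence_ff_es (C D : Category) (F : Functor C D) :
  is_equivalence F <-> fully_faithful F /\ ess_surjective F.
Proof.
  split.
  - intros [G [[eta [N I]] [eps [N' I']]]]. simpl in *.
    assert (FI : forall x y (f f' : Hom x y), fmap F f = fmap F f' -> f = f').
    { intros x y f f' E. apply (iso_cancel_r (I x)). rewrite <- !N. now rewrite E. }
    assert (GI : forall x y (f f' : Hom x y), fmap G f = fmap G f' -> f = f').
    { intros x y f f' E. apply (iso_cancel_r (I' x)). rewrite <- !N'. now rewrite E. }
    split; [| intros y; now exists (G y), (eps y)].
    intros x y g. destruct (I x) as [i [J1 J2]].
    (* Naturality of [eta] sees [F] only through [G], so the image of this candidate is recognised
       as [g] after applying the faithful [G]. *)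
    exists (eta y ⊚ fmap G g ⊚ i).
    assert (E : fmap F (eta y ⊚ fmap G g ⊚ i) = g).
    { apply GI, (iso_cancel_l (I y)). rewrite N.
      now rewrite <- (cc_assoc (eta y ⊚ fmap G g)), J1, cc_idr. }
    split; [exact E |]. intros f' E'. apply FI. congruence.
  - intros [FF ES].
    assert (K : forall y : D, { x : C & { f : Hom (F x) y | is_iso f } }).
    { intros y. destruct (constructive_indefinite_description _ (ES y)) as [x X].
      exists x. now apply constructive_indefinite_description. }
    pose (gob := fun y => projT1 (K y)).
    pose (eps := fun y : D => proj1_sig (projT2 (K y)) : Hom (F (gob y)) y).
    assert (epsI : forall y, is_iso (eps y)) by (intros y; apply (proj2_sig (projT2 (K y)))).
    clearbody eps. clearbody gob. clear K.
    assert (K : forall (y z : D) (f : Hom y z),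
      { g : Hom (gob y) (gob z) | eps z ⊚ fmap F g = f ⊚ eps y }).
    { intros y z f. apply constructive_indefinite_description.
      destruct (epsI z) as [i [I1 I2]].
      destruct (FF _ _ (i ⊚ (f ⊚ eps y))) as [g [E _]].
      exists g. now rewrite E, cc_assoc, I2, cc_idl. }
    assert (U : forall y z (g g' : Hom (gob y) (gob z)),
      eps z ⊚ fmap F g = eps z ⊚ fmap F g' -> g = g').
    { intros y z g g' E. apply (ff_inj FF), (iso_cancel_l (epsI z)), E. }
    unshelve eexists.
    { refine {| fob := gob; fmap := fun y z f => proj1_sig (K y z f) |}.
      - intros y. apply U. rewrite (proj2_sig (K y y _)).
        now rewrite fmap_id, cc_idl, cc_idr.
      - intros x y z g f. apply U. rewrite (proj2_sig (K x z _)), fmap_cc, cc_assoc,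
          (proj2_sig (K y z g)), <- !cc_assoc. now rewrite (proj2_sig (K x y f)). }
    split.
    + assert (E : forall x, { f : Hom (gob (F x)) x | fmap F f = eps (F x) }).
      { intros x. apply constructive_indefinite_description.
        destruct (FF _ _ (eps (F x))) as [f [E _]]. now exists f. }
      exists (fun x => proj1_sig (E x)). simpl. split.
      * intros x y f. apply (ff_inj FF). rewrite !fmap_cc.
        rewrite (proj2_sig (E x)), (proj2_sig (E y)). apply (proj2_sig (K _ _ _)).
      * intros x. apply (ff_reflects_iso FF). now rewrite (proj2_sig (E x)).
    + exists eps. simpl. split; [| exact epsI].
      intros x y f. apply (proj2_sig (K _ _ _)).
Qed.

Lemma nat_iso_sym (C D : Category) (F G : Functor C D) : nat_iso F G -> nat_iso G F.
Proof.
  intros [eta [N I]].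
  exists (fun x => proj1_sig (constructive_indefinite_description _ (I x))). split.
  - intros x y f.
    destruct (constructive_indefinite_description _ (I x)) as [i [I1 I2]].
    destruct (constructive_indefinite_description _ (I y)) as [j [J1 J2]]. simpl.
    apply (iso_cancel_l (I y)), (iso_cancel_r (I x)).
    now rewrite !cc_assoc, J2, cc_idl, N, <- !cc_assoc, I1, cc_idr.
  - intros x.
    destruct (constructive_indefinite_description _ (I x)) as [i [I1 I2]]. simpl.
    now exists (eta x).
Qed.

Lemma equivalence_nat_iso (C D : Category) (F G : Functor C D) :
  nat_iso F G -> is_equivalence F -> is_equivalence G.
Proof.
  intros [eta [N I]]. rewrite !equivalence_ff_es. intros [FF ES]. split.
  - intros x y g. destruct (I y) as [i [I1 I2]].
    destruct (FF x y (i ⊚ (g ⊚ eta x))) as [f [E U]]. exists f. split.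
    + apply (iso_cancel_r (I x)). now rewrite <- N, E, cc_assoc, I2, cc_idl.
    + intros f' E'. apply U. now rewrite <- E', <- N, cc_assoc, I1, cc_idl.
  - intros y. destruct (ES y) as [x [f J]].
    destruct (is_iso_sym (I x)) as [i K]. exists x, (f ⊚ i). now apply is_iso_cc.
Qed.

Lemma equivalence_comp (C D E : Category) (G : Functor D E) (F : Functor C D) :
  is_equivalence G -> is_equivalence F -> is_equivalence (functor_comp G F).
Proof.
  rewrite !equivalence_ff_es. intros [GF GS] [FF FS]. split.
  - intros x y g. simpl in *. destruct (GF _ _ g) as [h [H1 H2]].
    destruct (FF x y h) as [f [F1 F2]]. exists f. split.
    + now rewrite F1.
    + intros f' K. symmetry in K. apply F2. symmetry. apply (ff_inj GF). congruence.
  - intros z. destruct (GS z) as [y [g G1]], (FS y) as [x [f F1]].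
    exists x, (g ⊚ fmap G f). apply is_iso_cc; [assumption | now apply is_iso_fmap].
Qed.

Lemma equivalence_cancel (C D E : Category) (G : Functor D E) (F : Functor C D) :
  is_equivalence G -> is_equivalence (functor_comp G F) -> is_equivalence F.
Proof.
  rewrite !equivalence_ff_es. intros [GF GS] [FF FS]. split.
  - intros x y g. destruct (FF x y (fmap G g)) as [f [F1 F2]]. exists f. split.
    + apply (ff_inj GF), F1.
    + intros f' K. apply F2. simpl. now rewrite K.
  - intros y. destruct (FS (G y)) as [x [f I]]. simpl in *.
    destruct (GF _ _ f) as [h [H _]]. exists x, h.
    apply (ff_reflects_iso GF). now rewrite H.
Qed.

Lemma restrict_iso (M : TwoCat) (F : psfunctor M) (L U : ob M) (x y : F L) (h : Hom x y) :
  is_iso h -> nat_iso (restrict x U) (restrict y U).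
Proof.
  intros I. exists (fun f : homcat U L => fmap (ps_ar F (f : hom1 U L)) h). split.
  - intros f g b. symmetry. apply (@ps_ce_nat M F U L f g b x y h).
  - intros f. now apply (is_iso_fmap (ps_ar F (f : hom1 U L))).
Qed.

Lemma birepresents_equivalence (M : TwoCat) (F G : psfunctor M)
    (Phi : forall U : ob M, Functor (F U) (G U)) (L : ob M) :
  (forall U, is_equivalence (Phi U)) ->
  (forall (x : F L) (U : ob M),
    nat_iso (functor_comp (Phi U) (restrict x U)) (restrict (Phi L x) U)) ->
  birepresents F L <-> birepresents G L.
Proof.
  intros E N. split.
  - intros [x X]. exists (Phi L x). intros U.
    apply (equivalence_nat_iso (N x U)). now apply equivalence_comp.
  - intros [y Y].
    (* The universal element [y] need not lie in the image of [Phi L]. It is only isomorphic to some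
       [Phi L x], and [restrict_iso] transfers universality along that isomorphism. *)
    destruct (proj2 (proj1 (equivalence_ff_es _) (E L)) y) as [x [f I]].
    exists x. intros U. apply (equivalence_cancel (E U)).
    apply (equivalence_nat_iso (nat_iso_sym (N x U))).
    apply (equivalence_nat_iso (nat_iso_sym (restrict_iso U I))), Y.
Qed.

(** * Invertible 2-cells and transposition *)

Lemma invertible_vcomp (M : TwoCat) (a b : ce M) : tgt2 a = src2 b ->
  invertible a -> invertible b -> invertible (b • a).
Proof. intros E [a' A'] [b' B']. exists (a' • b'). now apply inverse_vcomp. Qed.

Lemma invertible_lwhisk (M : TwoCat) g (a : ce M) : tgt1 (src2 a) = src1 g ->
  invertible a -> invertible (g ▹ a).
Proof. intros E [a' A']. exists (g ▹ a'). now apply inverse_lwhisk. Qed.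

Lemma invertible_rwhisk (M : TwoCat) (a : ce M) f : tgt1 f = src1 (src2 a) ->
  invertible a -> invertible (a ◃ f).
Proof. intros E [a' A']. exists (a' ◃ f). now apply inverse_rwhisk. Qed.

Lemma inv2_rwhisk (M : TwoCat) (x : ce M) (f : ar M) : tgt1 f = src1 (src2 x) -> invertible x ->
  inv2 (x ◃ f) = inv2 x ◃ f.
Proof. intros E I. apply inv2_eq, inverse_rwhisk; [exact E | now apply inv2_spec]. Qed.

Lemma invertible_rtens2 (M : GrayMonoid) (a : ce M) B : invertible a -> invertible (a ⋊₂ B).
Proof.
  intros [b [[B1 B2] [B3 B4]]]. exists (b ⋊₂ B). unfold inverse_of, is2.
  rewrite !src_rtens2, !tgt_rtens2, <- !rtens2_vcomp, B1, B2, B3, B4, !rtens2_id2 by congruence.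
  auto.
Qed.

Lemma invertible_ltens2 (M : GrayMonoid) (a : ce M) B : invertible a -> invertible (B ⋉₂ a).
Proof.
  intros [b [[B1 B2] [B3 B4]]]. exists (B ⋉₂ b). unfold inverse_of, is2.
  rewrite !src_ltens2, !tgt_ltens2, <- !ltens2_vcomp, B1, B2, B3, B4, !ltens2_id2 by congruence.
  auto.
Qed.

Lemma invertible_inv2 (M : TwoCat) (a : ce M) : invertible a -> invertible (inv2 a).
Proof. intros I. exists a. now apply inverse_sym, inv2_spec. Qed.

Lemma invertible_id2 (M : TwoCat) (f : ar M) : invertible (id2 f).
Proof. apply iso2_id2. Qed.

Lemma vcomp_cancel_l (M : TwoCat) (c x y : ce M) : invertible c ->
  tgt2 x = src2 c -> tgt2 y = src2 c -> c • x = c • y -> x = y.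
Proof.
  intros [d [[D1 D2] [D3 _]]] X Y E.
  rewrite <- (vcomp_idl x), <- (vcomp_idl y), X, Y, <- D3, <- !vcomp_assoc, E by congruence.
  reflexivity.
Qed.

Lemma vcomp_cancel_r (M : TwoCat) (c x y : ce M) : invertible c ->
  src2 x = tgt2 c -> src2 y = tgt2 c -> x • c = y • c -> x = y.
Proof.
  intros [d [[D1 D2] [_ D3]]] X Y E.
  rewrite <- (vcomp_idr x), <- (vcomp_idr y), X, Y, <- D3, !vcomp_assoc, E by congruence.
  reflexivity.
Qed.

Section Transpose.
Context (M : GrayMonoid) (H : LeftClosed M) (B C U : ob M) (f g : ar M).
Hypotheses (Hf : f ⦂ U ⟶ ihom H B C) (Hg : g ⦂ U ⟶ ihom H B C).

(** Full faithfulness of the closedness equivalence, unbundled from [hom1] and [hom2] so that it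
    applies to bare cells in the whiskering calculus. *)
Lemma transpose_unique (r : ce M) : r ⦂ ev H B C ∘ (f ⋊ B) ⟹ ev H B C ∘ (g ⋊ B) ->
  exists s, s ⦂ f ⟹ g /\ ev H B C ▹ (s ⋊₂ B) = r /\
    forall t, t ⦂ f ⟹ g -> ev H B C ▹ (t ⋊₂ B) = r -> s = t.
Proof.
  intros R.
  destruct (proj1 (proj1 (equivalence_ff_es _) (@ev_universal M H B C U))
    (Build_hom1 Hf) (Build_hom1 Hg) (Build_hom2 R)) as [[s S] [E1 E2]].
  exists s. split; [exact S | split].
  - exact (f_equal (fun x : hom2 _ _ => hom_ce x) E1).
  - intros t T E. specialize (E2 (Build_hom2 T)).
    refine (f_equal (fun x : hom2 _ _ => hom_ce x) (E2 _)). now apply hom2_eq.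
Qed.

Lemma transpose_inj (s t : ce M) : s ⦂ f ⟹ g -> t ⦂ f ⟹ g ->
  ev H B C ▹ (s ⋊₂ B) = ev H B C ▹ (t ⋊₂ B) -> s = t.
Proof.
  intros S T E. destruct Hf as [F1 F2], Hg as [G1 G2], S as [S1 S2], T as [T1 T2].
  pose proof (ev_bd H B C) as [V1 V2].
  destruct (@transpose_unique (ev H B C ▹ (s ⋊₂ B))) as [r [_ [_ R]]].
  - split; bd.
  - now rewrite <- (R s), <- (R t).
Qed.
End Transpose.

Lemma transpose_iso (M : GrayMonoid) (H : LeftClosed M) (B C U : ob M) (f g : ar M) (r : ce M) :
  f ⦂ U ⟶ ihom H B C -> g ⦂ U ⟶ ihom H B C ->
  r ⦂ ev H B C ∘ (f ⋊ B) ≅ ev H B C ∘ (g ⋊ B) ->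
  exists s, s ⦂ f ≅ g /\ ev H B C ▹ (s ⋊₂ B) = r.
Proof.
  intros Hf Hg [R [r' R']].
  destruct (transpose_unique Hf Hg R) as [s [S [E _]]].
  assert (Q : r' ⦂ ev H B C ∘ (g ⋊ B) ⟹ ev H B C ∘ (f ⋊ B)).
  { destruct R as [R1 R2], R' as [[? ?] _]; split; congruence. }
  destruct (transpose_unique Hg Hf Q) as [s' [S' [E' _]]].
  exists s. split; [| exact E]. split; [exact S |]. exists s'.
  destruct R as [R1 R2], R' as [_ [R3 R4]]. rewrite R1 in R3. rewrite R2 in R4.
  pose proof Hf as [F1 F2]. pose proof Hg as [G1 G2].
  pose proof (ev_bd H B C) as [V1 V2].
  destruct S as [S1 S2], S' as [S1' S2'].
  repeat split; try congruence.
  - rewrite S1. apply (transpose_inj Hf Hf); try (split; bd).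
    rewrite rtens2_vcomp, lwhisk_vcomp, E, E', R3, rtens2_id2, lwhisk_id2 by bd. reflexivity.
  - rewrite S2. apply (transpose_inj Hg Hg); try (split; bd).
    rewrite rtens2_vcomp, lwhisk_vcomp, E, E', R4, rtens2_id2, lwhisk_id2 by bd. reflexivity.
Qed.

(** * Boundaries of evaluation and of the correspondences of [CA] *)

Lemma src_ev (M : GrayMonoid) (H : LeftClosed M) B C : src1 (ev H B C) = ihom H B C ⊗ B.
Proof. apply ev_bd. Qed.
Lemma tgt_ev (M : GrayMonoid) (H : LeftClosed M) B C : tgt1 (ev H B C) = C.
Proof. apply ev_bd. Qed.
Lemma src_inv_ich (M : GrayMonoid) (f g : ar M) : src2 (inv2 (ich f g)) = (tgt1 f ⋉ g) ∘ (f ⋊ src1 g).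
Proof. rewrite src_inv2 by apply ich_iso. apply tgt_ich. Qed.
Lemma tgt_inv_ich (M : GrayMonoid) (f g : ar M) : tgt2 (inv2 (ich f g)) = (f ⋊ tgt1 g) ∘ (src1 f ⋉ g).
Proof. rewrite tgt_inv2 by apply ich_iso. apply src_ich. Qed.

Section Boundaries.
Context (M : BraidedGrayMonoid) (H : LeftClosed M) (A : MonoidalObject M) (CA : CADiagram H A).
Local Notation a := (carrier A).
Local Notation m := (mul A).
Local Notation aa := (carrier A ⊗ carrier A).
Local Notation h := (ihom H (carrier A) (carrier A)).
Local Notation e := (ev H (carrier A) (carrier A)).
Local Notation e' := (ev H (carrier A ⊗ carrier A) (carrier A)).

Lemma src_ca_d0 : src2 (ca_d0 CA) = e ∘ (d0 CA ⋊ a). Proof. apply ca_d0_iso. Qed.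
Lemma tgt_ca_d0 : tgt2 (ca_d0 CA) = m. Proof. apply ca_d0_iso. Qed.
Lemma src_ca_d1 : src2 (ca_d1 CA) = e ∘ (d1 CA ⋊ a). Proof. apply ca_d1_iso. Qed.
Lemma tgt_ca_d1 : tgt2 (ca_d1 CA) = m ∘ br a a. Proof. apply ca_d1_iso. Qed.
Lemma src_ca_e0 : src2 (ca_e0 CA) = e' ∘ (e0 CA ⋊ aa). Proof. apply ca_e0_iso. Qed.
Lemma tgt_ca_e0 : tgt2 (ca_e0 CA) = m ∘ (e ⋊ a). Proof. apply ca_e0_iso. Qed.
Lemma src_ca_e1 : src2 (ca_e1 CA) = e' ∘ (e1 CA ⋊ aa). Proof. apply ca_e1_iso. Qed.
Lemma tgt_ca_e1 : tgt2 (ca_e1 CA) = e ∘ (h ⋉ m). Proof. apply ca_e1_iso. Qed.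
Lemma src_ca_e2 : src2 (ca_e2 CA) = e' ∘ (e2 CA ⋊ aa). Proof. apply ca_e2_iso. Qed.
Lemma tgt_ca_e2 : tgt2 (ca_e2 CA) = m ∘ (a ⋉ e) ∘ (br h a ⋊ a). Proof. apply ca_e2_iso. Qed.
Lemma src_inv_ca_d0 : src2 (inv2 (ca_d0 CA)) = m.
Proof. rewrite src_inv2 by apply ca_d0_iso. apply tgt_ca_d0. Qed.
Lemma tgt_inv_ca_d0 : tgt2 (inv2 (ca_d0 CA)) = e ∘ (d0 CA ⋊ a).
Proof. rewrite tgt_inv2 by apply ca_d0_iso. apply src_ca_d0. Qed.
End Boundaries.

Ltac bd_ca tac := match goal with
  | |- context [src1 (ev ?H ?B ?C)] => rw (src_ev H B C) tac
  | |- context [tgt1 (ev ?H ?B ?C)] => rw (tgt_ev H B C) tac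
  | |- context [src2 (inv2 (ich ?f ?g))] => rw (src_inv_ich f g) tac
  | |- context [tgt2 (inv2 (ich ?f ?g))] => rw (tgt_inv_ich f g) tac
  | |- context [src2 (ca_d0 ?D)] => rw (src_ca_d0 D) tac
  | |- context [tgt2 (ca_d0 ?D)] => rw (tgt_ca_d0 D) tac
  | |- context [src2 (ca_d1 ?D)] => rw (src_ca_d1 D) tac
  | |- context [tgt2 (ca_d1 ?D)] => rw (tgt_ca_d1 D) tac
  | |- context [src2 (ca_e0 ?D)] => rw (src_ca_e0 D) tac
  | |- context [tgt2 (ca_e0 ?D)] => rw (tgt_ca_e0 D) tac
  | |- context [src2 (ca_e1 ?D)] => rw (src_ca_e1 D) tac
  | |- context [tgt2 (ca_e1 ?D)] => rw (tgt_ca_e1 D) tac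
  | |- context [src2 (ca_e2 ?D)] => rw (src_ca_e2 D) tac
  | |- context [tgt2 (ca_e2 ?D)] => rw (tgt_ca_e2 D) tac
  | |- context [src2 (inv2 (ca_d0 ?D))] => rw (src_inv_ca_d0 D) tac
  | |- context [tgt2 (inv2 (ca_d0 ?D))] => rw (tgt_inv_ca_d0 D) tac
  end.
Ltac bd_gen tac ::=
  first [ bd_hom tac | bd_mon tac | bd_piece tac | bd_cone tac | bd_ca tac ].

(** * Transposes of faces applied to a 2-cell *)

Lemma ich_inv_natl (M : GrayMonoid) (x : ce M) k :
  inv2 (ich (tgt2 x) k) • ((tgt1 (src2 x) ⋉ k) ▹ (x ⋊₂ src1 k)) =
  ((x ⋊₂ tgt1 k) ◃ (src1 (src2 x) ⋉ k)) • inv2 (ich (src2 x) k).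
Proof.
  assert (I1 := proj2 (ich_iso (tgt2 x) k)). assert (I2 := proj2 (ich_iso (src2 x) k)).
  apply (vcomp_cancel_l I1); [bd | bd |].
  apply (vcomp_cancel_r I2); [bd | bd |].
  pose proof (inv2_r I1) as E1. pose proof (inv2_l I2) as E2. pose proof (ich_natl x k) as N.
  transitivity ((ich (tgt2 x) k • inv2 (ich (tgt2 x) k))
    • (((tgt1 (src2 x) ⋉ k) ▹ (x ⋊₂ src1 k)) • ich (src2 x) k)).
  { clear E1 E2 N. nfb. reflexivity. }
  rewrite E1, <- N.
  transitivity (ich (tgt2 x) k • ((x ⋊₂ tgt1 k) ◃ (src1 (src2 x) ⋉ k))
    • (inv2 (ich (src2 x) k) • ich (src2 x) k)).
  { rewrite E2. clear E1 E2 N. nfb. reflexivity. }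
  clear E1 E2 N. nfb. reflexivity.
Qed.

(** This is [ich_compl] solved for the inverse interchange at [d], the form in which it occurs when
    [transpose1] is whiskered with [u]. *)
Lemma ich_inv_compl (M : GrayMonoid) (u d k : ar M) : tgt1 u = src1 d ->
  ((d ⋊ tgt1 k) ▹ ich u k) • inv2 (ich (d ∘ u) k) = inv2 (ich d k) ◃ (u ⋊ src1 k).
Proof.
  intros E.
  assert (I1 := proj2 (ich_iso (d ∘ u) k)). assert (I2 := proj2 (ich_iso d k)).
  apply (vcomp_cancel_r I1); [bd | bd |].
  pose proof (inv2_l I1) as E1. pose proof (inv2_l I2) as E2.
  transitivity (((d ⋊ tgt1 k) ▹ ich u k) • (inv2 (ich (d ∘ u) k) • ich (d ∘ u) k)).
  { clear E1 E2. nfb. reflexivity. }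
  rewrite E1, ich_compl by exact E.
  transitivity (((inv2 (ich d k) • ich d k) ◃ (u ⋊ src1 k)) • ((d ⋊ tgt1 k) ▹ ich u k)).
  { rewrite E2. clear E1 E2. nfb. reflexivity. }
  clear E1 E2. nfb. reflexivity.
Qed.

Section TransposeSquares.
Context (M : BraidedGrayMonoid) (H : LeftClosed M) (A : MonoidalObject M).
Local Notation a := (carrier A).
Local Notation m := (mul A).
Local Notation aa := (carrier A ⊗ carrier A).
Local Notation h := (ihom H (carrier A) (carrier A)).
Local Notation e := (ev H (carrier A) (carrier A)).
Local Notation e' := (ev H (carrier A ⊗ carrier A) (carrier A)).

(** A 2-cell [theta] out of [d ∘ u] need not be whiskered from one out of [d]. Before [theta] can be
    moved, the interchange and [eps] must therefore be evaluated at [d ∘ u] as a whole; the price is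
    the extra cell [ich u m]. *)
Lemma transpose1_rwhisk (U : ob M) (u d f E : ar M) (delta eps : ce M) :
  src1 u = U -> tgt1 u = a -> src1 d = a -> tgt1 d = h -> src1 f = aa -> tgt1 f = a ->
  src2 delta = e ∘ (d ⋊ a) -> tgt2 delta = f ->
  src1 E = h -> tgt1 E = ihom H aa a ->
  src2 eps = e' ∘ (E ⋊ aa) -> tgt2 eps = e ∘ (h ⋉ m) ->
  transpose1 H A d delta eps ◃ (u ⋊ aa) =
  (f ▹ ich u m) • (delta ◃ ((u ⋊ a) ∘ (U ⋉ m))) • (e ▹ inv2 (ich (d ∘ u) m))
    • (eps ◃ ((d ∘ u) ⋊ aa)).
Proof.
  intros u_s u_t d_s d_t f_s f_t delta_s delta_t E_s E_t eps_s eps_t. unfold transpose1.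
  pose proof (@ich_inv_compl M u d m) as K. rewrite src_mul, tgt_mul in K.
  transitivity ((delta ◃ ((a ⋉ m) ∘ (u ⋊ aa))) • (e ▹ (inv2 (ich d m) ◃ (u ⋊ aa)))
    • (eps ◃ ((d ∘ u) ⋊ aa))).
  { clear K. nfb. reflexivity. }
  rewrite <- K by bd. clear K.
  pose proof (@whisk_exchange' M (ich u m) delta ((u ⋊ a) ∘ (U ⋉ m)) ((a ⋉ m) ∘ (u ⋊ aa))
    (e ∘ (d ⋊ a)) f) as K.
  transitivity (((delta ◃ ((a ⋉ m) ∘ (u ⋊ aa))) • ((e ∘ (d ⋊ a)) ▹ ich u m))
    • (e ▹ inv2 (ich (d ∘ u) m)) • (eps ◃ ((d ∘ u) ⋊ aa))).
  { clear K. nfb. reflexivity. }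
  rewrite K by first [bd | split; bd]. clear K. nfb. reflexivity.
Qed.

(** The counterpart for the braiding: [brl_comp] merges the naturality cells at [d] and at [u] into
    the one at [d ∘ u]. The cell at [u] is put in front on the left, so that no inverse of it is
    needed. *)
Lemma transpose2_rwhisk (U : ob M) (u d f E : ar M) (delta eps : ce M) :
  src1 u = U -> tgt1 u = a -> src1 d = a -> tgt1 d = h -> src1 f = aa -> tgt1 f = a ->
  src2 delta = e ∘ (d ⋊ a) -> tgt2 delta = f ->
  src1 E = h -> tgt1 E = ihom H aa a ->
  src2 eps = e' ∘ (E ⋊ aa) -> tgt2 eps = m ∘ (a ⋉ e) ∘ (br h a ⋊ a) ->
  ((m ∘ (a ⋉ f)) ▹ (brl u a ⋊₂ a)) • (transpose2 H A d delta eps ◃ (u ⋊ aa)) =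
  (m ▹ (a ⋉₂ delta) ◃ ((a ⋉ u ⋊ a) ∘ (br U a ⋊ a)))
    • ((m ∘ (a ⋉ e)) ▹ (brl (d ∘ u) a ⋊₂ a)) • (eps ◃ ((d ∘ u) ⋊ aa)).
Proof.
  intros u_s u_t d_s d_t f_s f_t delta_s delta_t E_s E_t eps_s eps_t. unfold transpose2.
  pose proof (@whisk_exchange' M (brl u a ⋊₂ a) (m ▹ (a ⋉₂ delta))
    ((br a a ⋊ a) ∘ (u ⋊ aa)) ((a ⋉ u ⋊ a) ∘ (br U a ⋊ a))
    (m ∘ (a ⋉ e) ∘ (a ⋉ d ⋊ a)) (m ∘ (a ⋉ f))) as K.
  transitivity (((m ∘ (a ⋉ f)) ▹ (brl u a ⋊₂ a))
    • ((m ▹ (a ⋉₂ delta)) ◃ ((br a a ⋊ a) ∘ (u ⋊ aa)))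
    • ((m ∘ (a ⋉ e)) ▹ (brl d a ⋊₂ a) ◃ (u ⋊ aa)) • (eps ◃ ((d ∘ u) ⋊ aa))).
  { clear K. nfb. reflexivity. }
  rewrite <- K by first [bd | split; bd]. clear K.
  rewrite brl_comp by bd. nfb. reflexivity.
Qed.

Context (U : ob M) (u d d' f f' E : ar M) (delta delta' eps theta g : ce M).
Hypotheses (u_s : src1 u = U) (u_t : tgt1 u = a)
  (d_s : src1 d = a) (d_t : tgt1 d = h) (d'_s : src1 d' = a) (d'_t : tgt1 d' = h)
  (f_s : src1 f = aa) (f_t : tgt1 f = a) (f'_s : src1 f' = aa) (f'_t : tgt1 f' = a)
  (delta_s : src2 delta = e ∘ (d ⋊ a)) (delta_t : tgt2 delta = f)
  (delta'_s : src2 delta' = e ∘ (d' ⋊ a)) (delta'_t : tgt2 delta' = f')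
  (theta_s : src2 theta = d ∘ u) (theta_t : tgt2 theta = d' ∘ u)
  (g_s : src2 g = f ∘ (u ⋊ a)) (g_t : tgt2 g = f' ∘ (u ⋊ a))
  (E_s : src1 E = h) (E_t : tgt1 E = ihom H aa a)
  (eps_s : src2 eps = e' ∘ (E ⋊ aa)).
Hypothesis g_theta : g • (delta ◃ (u ⋊ a)) = (delta' ◃ (u ⋊ a)) • (e ▹ (theta ⋊₂ a)).

Lemma eps_exchange (t : ar M) : src1 t = h ⊗ aa -> tgt2 eps = t ->
  (eps ◃ ((d' ∘ u) ⋊ aa)) • (e' ▹ ((E ▹ theta) ⋊₂ aa)) =
  (t ▹ (theta ⋊₂ aa)) • (eps ◃ ((d ∘ u) ⋊ aa)).
Proof.
  intros t_s eps_t.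
  rewrite <- (@whisk_exchange' M (theta ⋊₂ aa) eps ((d ∘ u) ⋊ aa) ((d' ∘ u) ⋊ aa)
    (e' ∘ (E ⋊ aa)) t) by first [bd | split; bd].
  nfb. reflexivity.
Qed.

(** By [g_theta], [g] is the transpose of [theta]. The three squares compute the transpose of
    [E ▹ theta] for the three faces: [m (g ⊗ 1)] here, then [g (1 ⊗ m)] conjugated by interchange,
    then [m (1 ⊗ g) (c ⊗ 1)] up to the naturality of the braiding at [u]. *)
Lemma transpose0_square : tgt2 eps = m ∘ (e ⋊ a) ->
  (transpose0 A d' delta' eps ◃ (u ⋊ aa)) • (e' ▹ ((E ▹ theta) ⋊₂ aa)) =
  (m ▹ (g ⋊₂ a)) • (transpose0 A d delta eps ◃ (u ⋊ aa)).
Proof.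
  intros eps_t. unfold transpose0.
  transitivity ((m ▹ (delta' ⋊₂ a) ◃ (u ⋊ aa))
    • ((eps ◃ ((d' ∘ u) ⋊ aa)) • (e' ▹ ((E ▹ theta) ⋊₂ aa)))).
  { nfb. reflexivity. }
  rewrite (@eps_exchange (m ∘ (e ⋊ a))) by bd.
  transitivity ((m ▹ (((delta' ◃ (u ⋊ a)) • (e ▹ (theta ⋊₂ a))) ⋊₂ a))
    • (eps ◃ ((d ∘ u) ⋊ aa))).
  { nfb. reflexivity. }
  rewrite <- g_theta. nfb. reflexivity.
Qed.

Lemma transpose1_square : tgt2 eps = e ∘ (h ⋉ m) ->
  (transpose1 H A d' delta' eps ◃ (u ⋊ aa)) • (e' ▹ ((E ▹ theta) ⋊₂ aa)) =
  ((f' ▹ ich u m) • (g ◃ (U ⋉ m)) • (f ▹ inv2 (ich u m)))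
    • (transpose1 H A d delta eps ◃ (u ⋊ aa)).
Proof.
  intros eps_t.
  rewrite (@transpose1_rwhisk U u d f E), (@transpose1_rwhisk U u d' f' E) by bd.
  transitivity ((f' ▹ ich u m) • (delta' ◃ ((u ⋊ a) ∘ (U ⋉ m)))
    • (e ▹ inv2 (ich (d' ∘ u) m))
    • ((eps ◃ ((d' ∘ u) ⋊ aa)) • (e' ▹ ((E ▹ theta) ⋊₂ aa)))).
  { nfb. reflexivity. }
  rewrite (@eps_exchange (e ∘ (h ⋉ m))) by bd.
  pose proof (ich_inv_natl theta m) as K.
  replace (tgt1 (src2 theta)) with h in K by bd.
  replace (src1 (src2 theta)) with U in K by bd.
  rewrite theta_s, theta_t, src_mul, tgt_mul in K.
  transitivity ((f' ▹ ich u m) • (delta' ◃ ((u ⋊ a) ∘ (U ⋉ m)))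
    • (e ▹ (inv2 (ich (d' ∘ u) m) • ((h ⋉ m) ▹ (theta ⋊₂ aa))))
    • (eps ◃ ((d ∘ u) ⋊ aa))).
  { clear K. nfb. reflexivity. }
  rewrite K. clear K.
  transitivity ((f' ▹ ich u m) • (((delta' ◃ (u ⋊ a)) • (e ▹ (theta ⋊₂ a))) ◃ (U ⋉ m))
    • (e ▹ inv2 (ich (d ∘ u) m)) • (eps ◃ ((d ∘ u) ⋊ aa))).
  { nfb. reflexivity. }
  rewrite <- g_theta.
  pose proof (inv2_l (proj2 (ich_iso u m))) as K.
  (* A cancelling pair of interchange cells is inserted to create the factor [f ▹ ich u m] with
     which the whiskered [transpose1] at [d] begins. *)
  transitivity ((f' ▹ ich u m) • (g ◃ (U ⋉ m)) • (f ▹ (inv2 (ich u m) • ich u m))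
    • (delta ◃ ((u ⋊ a) ∘ (U ⋉ m))) • (e ▹ inv2 (ich (d ∘ u) m))
    • (eps ◃ ((d ∘ u) ⋊ aa))).
  { rewrite K. clear K. nfb. reflexivity. }
  clear K. nfb. reflexivity.
Qed.

Lemma transpose2_square : tgt2 eps = m ∘ (a ⋉ e) ∘ (br h a ⋊ a) ->
  ((m ∘ (a ⋉ f')) ▹ (brl u a ⋊₂ a)) • (transpose2 H A d' delta' eps ◃ (u ⋊ aa))
    • (e' ▹ ((E ▹ theta) ⋊₂ aa)) =
  (m ▹ (a ⋉₂ g) ◃ (br U a ⋊ a)) • ((m ∘ (a ⋉ f)) ▹ (brl u a ⋊₂ a))
    • (transpose2 H A d delta eps ◃ (u ⋊ aa)).
Proof.
  intros eps_t.
  rewrite (@transpose2_rwhisk U u d' f' E) by bd.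
  rewrite <- (@vcomp_assoc M (transpose2 H A d delta eps ◃ (u ⋊ aa)))
    by (unfold transpose2; bd).
  rewrite (@transpose2_rwhisk U u d f E) by bd.
  transitivity ((m ▹ (a ⋉₂ delta') ◃ ((a ⋉ u ⋊ a) ∘ (br U a ⋊ a)))
    • ((m ∘ (a ⋉ e)) ▹ (brl (d' ∘ u) a ⋊₂ a))
    • ((eps ◃ ((d' ∘ u) ⋊ aa)) • (e' ▹ ((E ▹ theta) ⋊₂ aa)))).
  { nfb. reflexivity. }
  rewrite (@eps_exchange (m ∘ (a ⋉ e) ∘ (br h a ⋊ a))) by bd.
  pose proof (brl_nat theta a) as K.
  replace (tgt1 (src2 theta)) with h in K by bd.
  replace (src1 (src2 theta)) with U in K by bd.
  rewrite theta_s, theta_t in K.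
  transitivity ((m ▹ (a ⋉₂ delta') ◃ ((a ⋉ u ⋊ a) ∘ (br U a ⋊ a)))
    • ((m ∘ (a ⋉ e)) ▹ ((brl (d' ∘ u) a • (br h a ▹ (theta ⋊₂ a))) ⋊₂ a))
    • (eps ◃ ((d ∘ u) ⋊ aa))).
  { clear K. nfb. reflexivity. }
  rewrite K. clear K.
  transitivity ((m ▹ (a ⋉₂ ((delta' ◃ (u ⋊ a)) • (e ▹ (theta ⋊₂ a)))) ◃ (br U a ⋊ a))
    • ((m ∘ (a ⋉ e)) ▹ (brl (d ∘ u) a ⋊₂ a)) • (eps ◃ ((d ∘ u) ⋊ aa))).
  { nfb. reflexivity. }
  rewrite <- g_theta. nfb. reflexivity.
Qed.
End TransposeSquares.

(** * The descent equation and the axiom of centre pieces *)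

Section Descent.
Context (M : BraidedGrayMonoid) (H : LeftClosed M) (A : MonoidalObject M) (CA : CADiagram H A).
Local Notation a := (carrier A).
Local Notation m := (mul A).
Local Notation aa := (carrier A ⊗ carrier A).
Local Notation h := (ihom H (carrier A) (carrier A)).
Local Notation e := (ev H (carrier A) (carrier A)).
Local Notation e' := (ev H (carrier A ⊗ carrier A) (carrier A)).

(** The transpose of [theta], along the correspondences of [d0] with [m] and of [d1]
    with [m ∘ br a a]. *)
Definition half_braiding (u : ar M) (theta : ce M) : ce M :=
  (ca_d1 CA ◃ (u ⋊ a)) • (e ▹ (theta ⋊₂ a)) • (inv2 (ca_d0 CA) ◃ (u ⋊ a)).

Definition piece_ce (u : ar M) (theta : ce M) : ce M :=
  (m ▹ brl u a) • half_braiding u theta.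

Context (U : ob M) (u : ar M) (theta : ce M).
Hypotheses (u_s : src1 u = U) (u_t : tgt1 u = a)
  (theta_s : src2 theta = d0 CA ∘ u) (theta_t : tgt2 theta = d1 CA ∘ u).

Lemma src_half_braiding : src2 (half_braiding u theta) = m ∘ (u ⋊ a).
Proof. unfold half_braiding. bd. Qed.
Lemma tgt_half_braiding : tgt2 (half_braiding u theta) = m ∘ br a a ∘ (u ⋊ a).
Proof. unfold half_braiding. bd. Qed.

(** This supplies the hypothesis [g_theta] of the three squares for [d0] and [d1]. *)
Lemma half_braiding_eq :
  half_braiding u theta • (ca_d0 CA ◃ (u ⋊ a)) = (ca_d1 CA ◃ (u ⋊ a)) • (e ▹ (theta ⋊₂ a)).
Proof.
  unfold half_braiding. pose proof (inv2_l (proj2 (ca_d0_iso CA))) as K.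
  transitivity ((ca_d1 CA ◃ (u ⋊ a)) • (e ▹ (theta ⋊₂ a))
    • ((inv2 (ca_d0 CA) • ca_d0 CA) ◃ (u ⋊ a))).
  { clear K. nfb. reflexivity. }
  rewrite K. clear K. nfb. reflexivity.
Qed.

Local Notation F := (u ⋊ aa).
Local Notation P := (m ∘ (a ⋉ m)).
Local Notation T00 := (transpose0 A (d0 CA) (ca_d0 CA) (ca_e0 CA)).
Local Notation T01 := (transpose0 A (d1 CA) (ca_d1 CA) (ca_e0 CA)).
Local Notation T10 := (transpose1 H A (d0 CA) (ca_d0 CA) (ca_e1 CA)).
Local Notation T11 := (transpose1 H A (d1 CA) (ca_d1 CA) (ca_e1 CA)).
Local Notation T20 := (transpose2 H A (d0 CA) (ca_d0 CA) (ca_e2 CA)).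
Local Notation T21 := (transpose2 H A (d1 CA) (ca_d1 CA) (ca_e2 CA)).
(** By [ca_k21] this cell, whiskered with [u], relates the transposes of both sides of
    the descent equation to the two composites of the centre piece axiom. *)
Local Notation comparison := ((asc A ◃ br a aa) • (m ▹ brr a m) • T11).

(** Each factor of the descent composite turns into one of [piece_right]: [k21] gives [brR] by
    [ca_k21], [e2 CA ▹ theta] gives the half-braiding in [1 ⊗ γ], [k01] gives associativity by
    [ca_k01], and [e0 CA ▹ theta] gives the half-braiding in [γ ⊗ 1]. Splitting [brl u aa] by
    [brR_mod1] yields the two cells [brl u a] that complete these half-braidings to [piece_ce]. *)
Lemma piece_right_transpose :
  piece_right A U u (piece_ce u theta) • (T00 ◃ F) =
  (P ▹ brl u aa) • (comparison ◃ F)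
    • (e' ▹ (((k21 CA ◃ u) • (e2 CA ▹ theta) • (k01 CA ◃ u) • (e0 CA ▹ theta)) ⋊₂ aa)).
Proof.
  assert (g_s := src_half_braiding). assert (g_t := tgt_half_braiding).
  assert (GE := half_braiding_eq).
  assert (R0 := @transpose0_square M H A u (d0 CA) (d1 CA) m (e0 CA)
    (ca_d0 CA) (ca_d1 CA) (ca_e0 CA) theta (half_braiding u theta)).
  assert (R2 := @transpose2_square M H A U u (d0 CA) (d1 CA) m (m ∘ br a a) (e2 CA)
    (ca_d0 CA) (ca_d1 CA) (ca_e2 CA) theta (half_braiding u theta)).
  spec R0 ltac:(first [exact GE | bd]). spec R2 ltac:(first [exact GE | bd]).
  clear GE.
  assert (K01 := ca_k01 CA). assert (K21 := ca_k21 CA).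
  assert (T00_s : src2 T00 = e' ∘ (e0 CA ⋊ aa) ∘ (d0 CA ⋊ aa)) by (unfold transpose0; bd).
  assert (T00_t : tgt2 T00 = m ∘ (m ⋊ a)) by (unfold transpose0; bd).
  assert (T01_s : src2 T01 = e' ∘ (e0 CA ⋊ aa) ∘ (d1 CA ⋊ aa)) by (unfold transpose0; bd).
  assert (T01_t : tgt2 T01 = m ∘ (m ⋊ a) ∘ (br a a ⋊ a)) by (unfold transpose0; bd).
  assert (T20_s : src2 T20 = e' ∘ (e2 CA ⋊ aa) ∘ (d0 CA ⋊ aa)) by (unfold transpose2; bd).
  assert (T20_t : tgt2 T20 = P ∘ (br a a ⋊ a)) by (unfold transpose2; bd).
  assert (T21_s : src2 T21 = e' ∘ (e2 CA ⋊ aa) ∘ (d1 CA ⋊ aa)) by (unfold transpose2; bd).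
  assert (T21_t : tgt2 T21 = P ∘ (a ⋉ br a a) ∘ (br a a ⋊ a)) by (unfold transpose2; bd).
  assert (T11_s : src2 T11 = e' ∘ (e1 CA ⋊ aa) ∘ (d1 CA ⋊ aa)) by (unfold transpose1; bd).
  assert (T11_t : tgt2 T11 = m ∘ br a a ∘ (a ⋉ m)) by (unfold transpose1; bd).
  unfold piece_right, piece_ce.
  set (g := half_braiding u theta) in *.
  set (t00 := T00) in *. set (t01 := T01) in *. set (t20 := T20) in *.
  set (t21 := T21) in *. set (t11 := T11) in *.
  clearbody g t00 t01 t20 t21 t11.
  symmetry.
  transitivity ((P ▹ brl u aa)
    • (((asc A ◃ br a aa) • (m ▹ brr a m) • t11 • (e' ▹ (k21 CA ⋊₂ aa))) ◃ F)
    • (e' ▹ ((e2 CA ▹ theta) ⋊₂ aa)) • (e' ▹ (k01 CA ⋊₂ aa) ◃ F)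
    • (e' ▹ ((e0 CA ▹ theta) ⋊₂ aa))).
  { clear R0 R2 K01 K21. nfb. reflexivity. }
  rewrite K21. clear K21.
  transitivity ((P ▹ (brl u aa • (brR a a a ◃ F))) • (t21 ◃ F)
    • (e' ▹ ((e2 CA ▹ theta) ⋊₂ aa)) • (e' ▹ (k01 CA ⋊₂ aa) ◃ F)
    • (e' ▹ ((e0 CA ▹ theta) ⋊₂ aa))).
  { clear R0 R2 K01. nfb. reflexivity. }
  assert (B := brR_mod1 u a a). rewrite u_s, u_t in B. rewrite B. clear B.
  transitivity (((P ∘ (aa ⋉ u)) ▹ brR U a a) • (P ▹ (a ⋉₂ brl u a) ◃ (br U a ⋊ a))
    • (((m ∘ (a ⋉ (m ∘ br a a))) ▹ (brl u a ⋊₂ a)) • (t21 ◃ F)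
    • (e' ▹ ((e2 CA ▹ theta) ⋊₂ aa))) • (e' ▹ (k01 CA ⋊₂ aa) ◃ F)
    • (e' ▹ ((e0 CA ▹ theta) ⋊₂ aa))).
  { clear R0 R2 K01. nfb. reflexivity. }
  rewrite R2. clear R2.
  transitivity (((P ∘ (aa ⋉ u)) ▹ brR U a a) • (P ▹ (a ⋉₂ brl u a) ◃ (br U a ⋊ a))
    • (m ▹ (a ⋉₂ g) ◃ (br U a ⋊ a)) • (P ▹ (brl u a ⋊₂ a))
    • ((t20 • (e' ▹ (k01 CA ⋊₂ aa))) ◃ F)
    • (e' ▹ ((e0 CA ▹ theta) ⋊₂ aa))).
  { clear R0 K01. nfb. reflexivity. }
  rewrite K01. clear K01.
  (* The second [brl u a] still has to pass the associativity cell in order to meet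
     [m ▹ (g ⋊₂ a)]. *)
  assert (X := @whisk_exchange' M (brl u a ⋊₂ a) (asc A)
    ((br a a ⋊ a) ∘ F) ((a ⋉ u ⋊ a) ∘ (br U a ⋊ a)) (m ∘ (m ⋊ a)) P).
  spec X ltac:(first [bd | split; bd]).
  transitivity (((P ∘ (aa ⋉ u)) ▹ brR U a a) • (P ▹ (a ⋉₂ brl u a) ◃ (br U a ⋊ a))
    • (m ▹ (a ⋉₂ g) ◃ (br U a ⋊ a))
    • ((P ▹ (brl u a ⋊₂ a)) • (asc A ◃ ((br a a ⋊ a) ∘ F)))
    • ((t01 ◃ F) • (e' ▹ ((e0 CA ▹ theta) ⋊₂ aa)))).
  { clear R0 X. nfb. reflexivity. }
  rewrite R0, <- X. clear R0 X.
  nfb. reflexivity.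
Qed.

(** Here [k00] gives the first associativity cell by [ca_k00], and [e1 CA ▹ theta] gives the
    half-braiding between two interchange cells. The later of these combines with [brl u aa] and the
    cell [brr a m] of the comparison into the remaining structural cells of [piece_left]. *)
Lemma piece_left_transpose :
  piece_left A U u (piece_ce u theta) • (T00 ◃ F) =
  (P ▹ brl u aa) • (comparison ◃ F)
    • (e' ▹ (((e1 CA ▹ theta) • (k00 CA ◃ u)) ⋊₂ aa)).
Proof.
  assert (g_s := src_half_braiding). assert (g_t := tgt_half_braiding).
  assert (GE := half_braiding_eq).
  assert (R1 := @transpose1_square M H A U u (d0 CA) (d1 CA) m (m ∘ br a a) (e1 CA)
    (ca_d0 CA) (ca_d1 CA) (ca_e1 CA) theta (half_braiding u theta)).
  spec R1 ltac:(first [exact GE | bd]).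
  clear GE.
  assert (K00 := ca_k00 CA).
  assert (T00_s : src2 T00 = e' ∘ (e0 CA ⋊ aa) ∘ (d0 CA ⋊ aa)) by (unfold transpose0; bd).
  assert (T00_t : tgt2 T00 = m ∘ (m ⋊ a)) by (unfold transpose0; bd).
  assert (T10_s : src2 T10 = e' ∘ (e1 CA ⋊ aa) ∘ (d0 CA ⋊ aa)) by (unfold transpose1; bd).
  assert (T10_t : tgt2 T10 = P) by (unfold transpose1; bd).
  assert (T11_s : src2 T11 = e' ∘ (e1 CA ⋊ aa) ∘ (d1 CA ⋊ aa)) by (unfold transpose1; bd).
  assert (T11_t : tgt2 T11 = m ∘ br a a ∘ (a ⋉ m)) by (unfold transpose1; bd).
  unfold piece_left, piece_ce.
  set (g := half_braiding u theta) in *.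
  set (t00 := T00) in *. set (t10 := T10) in *. set (t11 := T11) in *.
  clearbody g t00 t10 t11.
  symmetry.
  transitivity ((P ▹ brl u aa) • (((asc A ◃ br a aa) • (m ▹ brr a m)) ◃ F)
    • ((t11 ◃ F) • (e' ▹ ((e1 CA ▹ theta) ⋊₂ aa))) • (e' ▹ (k00 CA ⋊₂ aa) ◃ F)).
  { clear R1 K00. nfb. reflexivity. }
  rewrite R1. clear R1.
  transitivity ((P ▹ brl u aa) • (((asc A ◃ br a aa) • (m ▹ brr a m)) ◃ F)
    • ((m ∘ br a a) ▹ ich u m) • (g ◃ (U ⋉ m)) • (m ▹ inv2 (ich u m))
    • ((t10 • (e' ▹ (k00 CA ⋊₂ aa))) ◃ F)).
  { clear K00. nfb. reflexivity. }
  rewrite K00. clear K00.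
  assert (X := @whisk_exchange' M (brl u aa) (asc A)
    (br a aa ∘ F) ((aa ⋉ u) ∘ br U aa) (m ∘ (m ⋊ a)) P).
  spec X ltac:(first [bd | split; bd]).
  transitivity (((P ▹ brl u aa) • (asc A ◃ (br a aa ∘ F))) • (m ▹ brr a m ◃ F)
    • ((m ∘ br a a) ▹ ich u m) • (g ◃ (U ⋉ m)) • (m ▹ inv2 (ich u m))
    • (asc A ◃ F) • (t00 ◃ F)).
  { clear X. nfb. reflexivity. }
  rewrite <- X. clear X.
  assert (B := brl_brr u m). rewrite u_s, u_t, src_mul, tgt_mul in B.
  assert (I := inv2_l (proj2 (ich_iso m u))).
  (* The axiom [brl_brr] is solved for its last three factors, since [piece_left] contains the
     inverse of [ich m u]. The resulting [brl u a] completes [g] to [piece_ce]. *)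
  assert (B' : ((m ⋊ a) ▹ brl u aa) • (brr a m ◃ F) • (br a a ▹ ich u m) =
    (inv2 (ich m u) ◃ br U aa) • ((a ⋉ u) ▹ brr U m) • (brl u a ◃ (U ⋉ m))).
  { transitivity ((inv2 (ich m u) ◃ br U aa)
      • (((a ⋉ u) ▹ brr U m) • (brl u a ◃ (U ⋉ m)))).
    - rewrite <- B. clear B.
      transitivity (((inv2 (ich m u) • ich m u) ◃ br U aa) • ((m ⋊ a) ▹ brl u aa)
        • (brr a m ◃ F) • (br a a ▹ ich u m)).
      + rewrite I. clear I. nfb. reflexivity.
      + clear I. nfb. reflexivity.
    - clear B I. nfb. reflexivity. }
  clear B I.
  transitivity ((asc A ◃ ((aa ⋉ u) ∘ br U aa))
    • (m ▹ (((m ⋊ a) ▹ brl u aa) • (brr a m ◃ F) • (br a a ▹ ich u m)))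
    • (g ◃ (U ⋉ m)) • (m ▹ inv2 (ich u m)) • (asc A ◃ F) • (t00 ◃ F)).
  { clear B'. nfb. reflexivity. }
  rewrite B'. clear B'. nfb. reflexivity.
Qed.
End Descent.

Ltac invertible_tac := repeat first
  [ assumption
  | apply invertible_id2
  | apply ich_iso | apply brl_iso | apply brr_iso | apply brR_iso | apply asc_iso
  | apply ca_d0_iso | apply ca_d1_iso | apply ca_e0_iso | apply ca_e1_iso | apply ca_e2_iso
  | apply k00_iso | apply k01_iso | apply k21_iso
  | apply pd0_iso | apply pd1_iso | apply pe0_iso | apply pe1_iso | apply pe2_iso
  | apply cp_ce_iso
  | apply invertible_inv2
  | apply invertible_rtens2 | apply invertible_ltens2
  | apply invertible_vcomp; [bd | |]
  | apply invertible_lwhisk; [bd |]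
  | apply invertible_rwhisk; [bd |] ].

(** * Descent data and centre pieces *)

Section DescentEquivalence.
Context (M : BraidedGrayMonoid) (H : LeftClosed M) (A : MonoidalObject M) (CA : CADiagram H A).
Local Notation a := (carrier A).
Local Notation m := (mul A).
Local Notation aa := (carrier A ⊗ carrier A).
Local Notation e := (ev H (carrier A) (carrier A)).

Section Cell.
Context (U : ob M) (u : ar M) (theta : ce M).
Hypotheses (u_s : src1 u = U) (u_t : tgt1 u = a)
  (theta_s : src2 theta = d0 CA ∘ u) (theta_t : tgt2 theta = d1 CA ∘ u).

Lemma src_piece_ce : src2 (piece_ce CA u theta) = m ∘ (u ⋊ a).
Proof. unfold piece_ce, half_braiding. bd. Qed.

Lemma tgt_piece_ce : tgt2 (piece_ce CA u theta) = m ∘ (a ⋉ u) ∘ br U a.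
Proof. unfold piece_ce, half_braiding. bd. Qed.

Lemma piece_ce_iso : invertible theta ->
  piece_ce CA u theta ⦂ m ∘ (u ⋊ a) ≅ m ∘ (a ⋉ u) ∘ br U a.
Proof.
  intros I. split; [split; [apply src_piece_ce | apply tgt_piece_ce] |].
  unfold piece_ce, half_braiding. invertible_tac.
Qed.

(** Both transpose formulas have the same invertible cell at the start and the same one at the end.
    Cancelling the end and applying [transpose_inj] gives the descent equation; cancelling the start
    gives the axiom. *)
Lemma piece_eq_descent :
  piece_left A U u (piece_ce CA u theta) = piece_right A U u (piece_ce CA u theta) <->
  (k21 CA ◃ u) • (e2 CA ▹ theta) • (k01 CA ◃ u) • (e0 CA ▹ theta) =
  (e1 CA ▹ theta) • (k00 CA ◃ u).
Proof.
  pose proof (@piece_left_transpose M H A CA U u theta u_s u_t theta_s theta_t) as L.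
  pose proof (@piece_right_transpose M H A CA U u theta u_s u_t theta_s theta_t) as R.
  pose proof src_piece_ce as G1. pose proof tgt_piece_ce as G2.
  split; intros E.
  - rewrite E, R in L. clear R E.
    apply (@transpose_inj M H aa a U (e0 CA ∘ d0 CA ∘ u) (e1 CA ∘ d1 CA ∘ u)).
    1-4: split; clear L; bd.
    apply vcomp_cancel_l in L; [exact L | | |].
    + clear L. unfold transpose1. invertible_tac.
    + clear L. unfold transpose1. bd.
    + clear L. unfold transpose1. bd.
  - rewrite <- E, <- R in L. clear R E.
    apply vcomp_cancel_r in L; [exact L | | |]; clear L.
    + unfold transpose0. invertible_tac.
    + unfold piece_left, transpose0. bd.
    + unfold piece_right, transpose0. bd.
Qed.
End Cell.

Lemma piece_ce_surj (U : ob M) (u : ar M) (gamma : ce M) : u ⦂ U ⟶ a ->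
  gamma ⦂ m ∘ (u ⋊ a) ≅ m ∘ (a ⋉ u) ∘ br U a ->
  exists theta, theta ⦂ d0 CA ∘ u ≅ d1 CA ∘ u /\ piece_ce CA u theta = gamma.
Proof.
  intros [u_s u_t] [[g_s g_t] GI].
  assert (BI : invertible (m ▹ brl u a)) by invertible_tac.
  pose proof (inv2_spec BI) as [[B1 B2] [B3 B4]].
  assert (CI : invertible (ca_d1 CA ◃ (u ⋊ a))) by invertible_tac.
  pose proof (inv2_spec CI) as [[C1 C2] [C3 C4]].
  (* The prescribed transpose is the equation [piece_ce CA u theta = gamma] solved for
     [e ▹ (theta ⋊₂ a)]. *)
  destruct (@transpose_iso M H a a U (d0 CA ∘ u) (d1 CA ∘ u)
    (inv2 (ca_d1 CA ◃ (u ⋊ a)) • inv2 (m ▹ brl u a) • gamma • (ca_d0 CA ◃ (u ⋊ a))))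
    as [theta [T E]].
  1-2: split; bd.
  { split; [split |].
    - rewrite src_vcomp; clear B3 B4 C3 C4; bd.
    - clear B3 B4 C3 C4; bd.
    - clear B3 B4 C3 C4; invertible_tac. }
  exists theta. split; [exact T |].
  unfold piece_ce, half_braiding. rewrite E. clear E.
  assert (DI := inv2_r (proj2 (ca_d0_iso CA))).
  set (x := inv2 (m ▹ brl u a)) in *. set (y := inv2 (ca_d1 CA ◃ (u ⋊ a))) in *.
  clearbody x y.
  transitivity (((m ▹ brl u a) • (((ca_d1 CA ◃ (u ⋊ a)) • y) • x) • gamma)
    • ((ca_d0 CA • inv2 (ca_d0 CA)) ◃ (u ⋊ a))).
  { clear B3 B4 C3 C4 DI. nfb. reflexivity. }
  rewrite C4, DI.
  transitivity (((m ▹ brl u a) • x) • gamma).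
  { clear B3 B4 C3 C4 DI. nfb. reflexivity. }
  rewrite B4. clear B3 B4 C3 C4 DI. nfb. reflexivity.
Qed.

(** Precomposed with the invertible [ca_d0 CA ◃ (u ⋊ a)], the two sides of the second equation
    become the transposes of the two sides of the first, followed by one common invertible cell. *)
Lemma piece_ce_square (U : ob M) (u v : ar M) (s theta theta' : ce M) :
  u ⦂ U ⟶ a -> v ⦂ U ⟶ a -> s ⦂ u ⟹ v ->
  theta ⦂ d0 CA ∘ u ⟹ d1 CA ∘ u -> theta' ⦂ d0 CA ∘ v ⟹ d1 CA ∘ v ->
  theta' • (d0 CA ▹ s) = (d1 CA ▹ s) • theta <->
  piece_ce CA v theta' • (m ▹ (s ⋊₂ a)) = (m ▹ (a ⋉₂ s) ◃ br U a) • piece_ce CA u theta.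
Proof.
  intros [u_s u_t] [v_s v_t] [s_s s_t] [T1 T2] [T1' T2'].
  assert (L : (piece_ce CA v theta' • (m ▹ (s ⋊₂ a))) • (ca_d0 CA ◃ (u ⋊ a)) =
    ((m ▹ brl v a) • (ca_d1 CA ◃ (v ⋊ a))) • (e ▹ ((theta' • (d0 CA ▹ s)) ⋊₂ a))).
  { unfold piece_ce.
    assert (X := @whisk_exchange' M (s ⋊₂ a) (ca_d0 CA) (u ⋊ a) (v ⋊ a)
      (e ∘ (d0 CA ⋊ a)) m). spec X ltac:(first [bd | split; bd]).
    pose proof (@half_braiding_eq M H A CA v theta') as Q; spec Q bd.
    pose proof (@src_half_braiding M H A CA v theta') as q1; spec q1 bd.
    pose proof (@tgt_half_braiding M H A CA v theta') as q2; spec q2 bd.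
    set (g := half_braiding CA v theta') in *. clearbody g.
    transitivity ((m ▹ brl v a) • g • ((m ▹ (s ⋊₂ a)) • (ca_d0 CA ◃ (u ⋊ a)))).
    { clear X Q. nfb. reflexivity. }
    rewrite <- X.
    transitivity ((m ▹ brl v a) • (g • (ca_d0 CA ◃ (v ⋊ a)))
      • ((e ∘ (d0 CA ⋊ a)) ▹ (s ⋊₂ a))).
    { clear X Q. nfb. reflexivity. }
    rewrite Q. clear X Q. nfb. reflexivity. }
  assert (R : ((m ▹ (a ⋉₂ s) ◃ br U a) • piece_ce CA u theta) • (ca_d0 CA ◃ (u ⋊ a)) =
    ((m ▹ brl v a) • (ca_d1 CA ◃ (v ⋊ a))) • (e ▹ (((d1 CA ▹ s) • theta) ⋊₂ a))).
  { unfold piece_ce.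
    assert (X := @whisk_exchange' M (s ⋊₂ a) (ca_d1 CA) (u ⋊ a) (v ⋊ a)
      (e ∘ (d1 CA ⋊ a)) (m ∘ br a a)). spec X ltac:(first [bd | split; bd]).
    pose proof (brl_nat s a) as N. rewrite s_s, s_t, u_s, u_t in N.
    pose proof (@half_braiding_eq M H A CA u theta) as Q; spec Q bd.
    pose proof (@src_half_braiding M H A CA u theta) as q1; spec q1 bd.
    pose proof (@tgt_half_braiding M H A CA u theta) as q2; spec q2 bd.
    set (g := half_braiding CA u theta) in *. clearbody g.
    transitivity ((m ▹ (((a ⋉₂ s) ◃ br U a) • brl u a)) • (g • (ca_d0 CA ◃ (u ⋊ a)))).
    { clear X Q N. nfb. reflexivity. }
    rewrite Q, <- N.
    transitivity ((m ▹ brl v a) • (((m ∘ br a a) ▹ (s ⋊₂ a)) • (ca_d1 CA ◃ (u ⋊ a)))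
      • (e ▹ (theta ⋊₂ a))).
    { clear X Q N. nfb. reflexivity. }
    rewrite <- X. clear X Q N. nfb. reflexivity. }
  pose proof (@src_piece_ce u theta) as G1; spec G1 bd.
  pose proof (@tgt_piece_ce U u theta) as G2; spec G2 bd.
  pose proof (@src_piece_ce v theta') as G3; spec G3 bd.
  pose proof (@tgt_piece_ce U v theta') as G4; spec G4 bd.
  split; intros E.
  - rewrite E, <- R in L. clear R E.
    apply vcomp_cancel_r in L; [exact L | | |]; clear L.
    + invertible_tac.
    + bd.
    + bd.
  - rewrite E, R in L. clear R E. symmetry in L.
    apply (@transpose_inj M H a a U (d0 CA ∘ u) (d1 CA ∘ v)).
    1-4: split; clear L; bd.
    apply vcomp_cancel_l in L; [exact L | | |]; clear L.
    + invertible_tac.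
    + bd.
    + bd.
Qed.

(** By [brl_comp] the naturality cell at [u ∘ f] splits into those at [u] and [f], and the latter is
    exactly what restriction of centre pieces pastes on. *)
Lemma piece_ce_restrict (U V : ob M) (u f : ar M) (theta : ce M) : u ⦂ U ⟶ a -> f ⦂ V ⟶ U ->
  theta ⦂ d0 CA ∘ u ⟹ d1 CA ∘ u ->
  piece_ce CA (u ∘ f) (theta ◃ f) = cp_restrict_ce A u f (piece_ce CA u theta).
Proof.
  intros [u_s u_t] [f_s f_t] [T1 T2]. unfold cp_restrict_ce, piece_ce, half_braiding.
  rewrite brl_comp by bd. nfb. reflexivity.
Qed.
End DescentEquivalence.

(** * Pseudo-cones as centre pieces *)

Section ConeToPiece.
Context (M : TwoCat) (X0 X1 X2 : ob M) (D : TruncatedDiagram X0 X1 X2) (U : ob M).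

Definition cone_theta (x : PseudoCone D U) : ce M := inv2 (pd1 x) • pd0 x.

Lemma src_inv_pd1 (x : PseudoCone D U) : src2 (inv2 (pd1 x)) = p1 x.
Proof. rewrite src_inv2 by apply pd1_iso. apply tgt_pd1. Qed.
Lemma tgt_inv_pd1 (x : PseudoCone D U) : tgt2 (inv2 (pd1 x)) = d1 D ∘ p0 x.
Proof. rewrite tgt_inv2 by apply pd1_iso. apply src_pd1. Qed.
End ConeToPiece.

Ltac bd_inv_pd1 tac := match goal with
  | |- context [src2 (inv2 (pd1 ?x))] => rw (src_inv_pd1 x) tac
  | |- context [tgt2 (inv2 (pd1 ?x))] => rw (tgt_inv_pd1 x) tac
  end.
Ltac bd_gen tac ::= first
  [ bd_hom tac | bd_mon tac | bd_piece tac | bd_cone tac | bd_ca tac | bd_inv_pd1 tac ].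

Section ConeDescent.
Context (M : TwoCat) (X0 X1 X2 : ob M) (D : TruncatedDiagram X0 X1 X2) (U : ob M).

Lemma src_cone_theta (x : PseudoCone D U) : src2 (cone_theta x) = d0 D ∘ p0 x.
Proof. unfold cone_theta. bd. Qed.
Lemma tgt_cone_theta (x : PseudoCone D U) : tgt2 (cone_theta x) = d1 D ∘ p0 x.
Proof. unfold cone_theta. bd. Qed.
Lemma cone_theta_iso (x : PseudoCone D U) : invertible (cone_theta x).
Proof. unfold cone_theta. invertible_tac. Qed.

Lemma pd1_cone_theta (x : PseudoCone D U) : pd1 x • cone_theta x = pd0 x.
Proof.
  unfold cone_theta. rewrite vcomp_assoc, inv2_r by first [bd | apply pd1_iso].
  nfb. reflexivity.
Qed.

(** Followed by the invertible [pe1 x • (e1 D ▹ pd1 x)], both sides become [pe0 x • (e0 D ▹ pd0 x)]: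
    one by [pk00], the other by [pk21] and then [pk01]. *)
Lemma cone_descent (x : PseudoCone D U) :
  (k21 D ◃ p0 x) • (e2 D ▹ cone_theta x) • (k01 D ◃ p0 x) • (e0 D ▹ cone_theta x) =
  (e1 D ▹ cone_theta x) • (k00 D ◃ p0 x).
Proof.
  pose proof (src_cone_theta x) as T1. pose proof (tgt_cone_theta x) as T2.
  pose proof (pd1_cone_theta x) as E.
  pose proof (pk00 x) as K0. pose proof (pk01 x) as K1. pose proof (pk21 x) as K2.
  set (t := cone_theta x) in *. clearbody t.
  assert (I : invertible (pe1 x • (e1 D ▹ pd1 x))) by invertible_tac.
  apply (vcomp_cancel_l I); [bd | bd |]. clear I.
  transitivity (pe1 x • (e1 D ▹ (pd1 x • t)) • (k00 D ◃ p0 x)).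
  2: { clear E K0 K1 K2. nfb. reflexivity. }
  rewrite E, K0.
  transitivity ((pe1 x • (e1 D ▹ pd1 x) • (k21 D ◃ p0 x)) • (e2 D ▹ t) • (k01 D ◃ p0 x)
    • (e0 D ▹ t)).
  { clear E K0 K1 K2. nfb. reflexivity. }
  rewrite K2.
  transitivity ((pe2 x • (e2 D ▹ (pd1 x • t)) • (k01 D ◃ p0 x)) • (e0 D ▹ t)).
  { clear E K0 K1 K2. nfb. reflexivity. }
  rewrite E, K1.
  transitivity (pe0 x • (e0 D ▹ (pd1 x • t))).
  { clear E K0 K1 K2. nfb. reflexivity. }
  rewrite E. reflexivity.
Qed.

Lemma cone_hom_theta (x y : PseudoCone D U) (s : PseudoConeHom x y) :
  cone_theta y • (d0 D ▹ t0 s) = (d1 D ▹ t0 s) • cone_theta x.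
Proof.
  pose proof (src_cone_theta x) as T1. pose proof (tgt_cone_theta x) as T2.
  pose proof (src_cone_theta y) as T3. pose proof (tgt_cone_theta y) as T4.
  pose proof (pd1_cone_theta x) as E. pose proof (pd1_cone_theta y) as E'.
  pose proof (td0 s) as S0. pose proof (td1 s) as S1.
  set (t := cone_theta x) in *. set (t' := cone_theta y) in *. clearbody t t'.
  apply (vcomp_cancel_l (c := pd1 y)); [invertible_tac | bd | bd |].
  rewrite !vcomp_assoc, E', S0, S1, <- vcomp_assoc, E by bd. reflexivity.
Qed.

(** Since [pd0 x] and [pe0 x] are invertible, [td0] determines [t1] from [t0], and [te0] determines
    [t2] from [t1]. *)
Lemma cone_hom_t0_inj (x y : PseudoCone D U) (s t : PseudoConeHom x y) :
  t0 s = t0 t -> s = t.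
Proof.
  intros E0.
  assert (E1 : t1 s = t1 t).
  { apply (vcomp_cancel_r (c := pd0 x)); [invertible_tac | bd | bd |].
    rewrite <- !td0, E0. reflexivity. }
  apply cone_hom_eq; [exact E0 | exact E1 |].
  apply (vcomp_cancel_r (c := pe0 x)); [invertible_tac | bd | bd |].
  rewrite <- !te0, E1. reflexivity.
Qed.

Lemma square_fill (d x y x' y' : ar M) (s p q : ce M) :
  tgt1 x = src1 d -> s ⦂ x ⟹ y -> p ⦂ d ∘ x ≅ x' -> q ⦂ d ∘ y ⟹ y' ->
  exists s', s' ⦂ x' ⟹ y' /\ q • (d ▹ s) = s' • p.
Proof.
  intros E [S1 S2] [[P1 P2] PI] [Q1 Q2].
  pose proof (inv2_spec PI) as [[I1 I2] [I3 _]]. rewrite P1, P2 in *.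
  exists (q • (d ▹ s) • inv2 p). split; [split; bd |].
  rewrite <- vcomp_assoc, I3 by bd. clear I3. nfb. reflexivity.
Qed.

(** The squares at [pd0] and [pe0] force the components at [p1] and [p2]. The square at [pd1] is
    then the compatibility with [cone_theta]; those at [pe1] and [pe2] reduce to known squares
    through [pk00] and [pk01] and the interchange of [s] with [k00] and [k01]. *)
Lemma cone_hom_extend (x y : PseudoCone D U) (s : ce M) : s ⦂ p0 x ⟹ p0 y ->
  cone_theta y • (d0 D ▹ s) = (d1 D ▹ s) • cone_theta x ->
  exists t : PseudoConeHom x y, t0 t = s.
Proof.
  intros S E. pose proof S as [S1 S2].
  destruct (@square_fill (d0 D) (p0 x) (p0 y) (p1 x) (p1 y) s (pd0 x) (pd0 y))
    as [s1 [B1 E0]]; [bd | exact S | apply pd0_iso | apply pd0_iso |].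
  destruct (@square_fill (e0 D) (p1 x) (p1 y) (p2 x) (p2 y) s1 (pe0 x) (pe0 y))
    as [s2 [B2 F0]]; [bd | exact B1 | apply pe0_iso | apply pe0_iso |].
  pose proof B1 as [b1 b1']. pose proof B2 as [b2 b2'].
  assert (E1 : pd1 y • (d1 D ▹ s) = s1 • pd1 x).
  { pose proof (src_cone_theta x) as T1. pose proof (tgt_cone_theta x) as T2.
    pose proof (src_cone_theta y) as T3. pose proof (tgt_cone_theta y) as T4.
    pose proof (pd1_cone_theta x) as X. pose proof (pd1_cone_theta y) as Y.
    apply (vcomp_cancel_r (cone_theta_iso x)); [bd | bd |].
    rewrite <- !vcomp_assoc, X, <- E0, <- E, vcomp_assoc, Y by bd. reflexivity. }
  assert (F1 : pe1 y • (e1 D ▹ s1) = s2 • pe1 x).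
  { apply (vcomp_cancel_r (c := (e1 D ▹ pd0 x) • (k00 D ◃ p0 x)));
      [invertible_tac | bd | bd |].
    pose proof (pk00 x) as X. pose proof (pk00 y) as Y.
    pose proof (@whisk_exchange' M s (k00 D) (p0 x) (p0 y) (e0 D ∘ d0 D) (e1 D ∘ d0 D)) as K.
    spec K ltac:(first [bd | split; bd | exact S]).
    transitivity (pe1 y • (e1 D ▹ (s1 • pd0 x)) • (k00 D ◃ p0 x)).
    { clear E0 E1 F0 X Y K E. nfb. reflexivity. }
    rewrite <- E0.
    transitivity (pe1 y • (e1 D ▹ pd0 y) • (((e1 D ∘ d0 D) ▹ s) • (k00 D ◃ p0 x))).
    { clear E0 E1 F0 X Y K E. nfb. reflexivity. }
    rewrite <- K.
    transitivity ((pe1 y • (e1 D ▹ pd0 y) • (k00 D ◃ p0 y)) • ((e0 D ∘ d0 D) ▹ s)).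
    { clear E0 E1 F0 X Y K E. nfb. reflexivity. }
    rewrite Y.
    transitivity (pe0 y • (e0 D ▹ (pd0 y • (d0 D ▹ s)))).
    { clear E0 E1 F0 X Y K E. nfb. reflexivity. }
    rewrite E0.
    transitivity ((pe0 y • (e0 D ▹ s1)) • (e0 D ▹ pd0 x)).
    { clear E0 E1 F0 X Y K E. nfb. reflexivity. }
    rewrite F0.
    transitivity (s2 • (pe1 x • (e1 D ▹ pd0 x) • (k00 D ◃ p0 x))).
    { rewrite X. clear E0 E1 F0 X Y K E. nfb. reflexivity. }
    clear E0 E1 F0 X Y K E. nfb. reflexivity. }
  assert (F2 : pe2 y • (e2 D ▹ s1) = s2 • pe2 x).
  { apply (vcomp_cancel_r (c := (e2 D ▹ pd0 x) • (k01 D ◃ p0 x)));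
      [invertible_tac | bd | bd |].
    pose proof (pk01 x) as X. pose proof (pk01 y) as Y.
    pose proof (@whisk_exchange' M s (k01 D) (p0 x) (p0 y) (e0 D ∘ d1 D) (e2 D ∘ d0 D)) as K.
    spec K ltac:(first [bd | split; bd | exact S]).
    transitivity (pe2 y • (e2 D ▹ (s1 • pd0 x)) • (k01 D ◃ p0 x)).
    { clear E0 E1 F0 F1 X Y K E. nfb. reflexivity. }
    rewrite <- E0.
    transitivity (pe2 y • (e2 D ▹ pd0 y) • (((e2 D ∘ d0 D) ▹ s) • (k01 D ◃ p0 x))).
    { clear E0 E1 F0 F1 X Y K E. nfb. reflexivity. }
    rewrite <- K.
    transitivity ((pe2 y • (e2 D ▹ pd0 y) • (k01 D ◃ p0 y)) • ((e0 D ∘ d1 D) ▹ s)).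
    { clear E0 E1 F0 F1 X Y K E. nfb. reflexivity. }
    rewrite Y.
    transitivity (pe0 y • (e0 D ▹ (pd1 y • (d1 D ▹ s)))).
    { clear E0 E1 F0 F1 X Y K E. nfb. reflexivity. }
    rewrite E1.
    transitivity ((pe0 y • (e0 D ▹ s1)) • (e0 D ▹ pd1 x)).
    { clear E0 E1 F0 F1 X Y K E. nfb. reflexivity. }
    rewrite F0.
    transitivity (s2 • (pe2 x • (e2 D ▹ pd0 x) • (k01 D ◃ p0 x))).
    { rewrite X. clear E0 E1 F0 F1 X Y K E. nfb. reflexivity. }
    clear E0 E1 F0 F1 X Y K E. nfb. reflexivity. }
  exists (@Build_PseudoConeHom M X0 X1 X2 D U x y s s1 s2 S B1 B2 E0 E1 F0 F1 F2).
  reflexivity.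
Qed.

(** Take [∂₁ u] and [∂₀ ∂₁ u] as the other legs, with [theta] as [pd0] and identities as [pd1] and
    [pe0]. Then [pk00] and [pk01] can be solved for [pe1] and [pe2], and [pk21] becomes the descent
    equation. *)
Lemma cone_of_descent (u : ar M) (theta : ce M) : u ⦂ U ⟶ X0 ->
  theta ⦂ d0 D ∘ u ≅ d1 D ∘ u ->
  (k21 D ◃ u) • (e2 D ▹ theta) • (k01 D ◃ u) • (e0 D ▹ theta) =
  (e1 D ▹ theta) • (k00 D ◃ u) ->
  exists x : PseudoCone D U, p0 x = u /\ cone_theta x = theta.
Proof.
  intros B [[T1 T2] TI] E. pose proof B as [u_s u_t].
  assert (I1 : invertible ((e1 D ▹ theta) • (k00 D ◃ u))) by invertible_tac.
  assert (I2 : invertible ((e2 D ▹ theta) • (k01 D ◃ u))) by invertible_tac.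
  pose proof (invertible_inv2 I1) as J1. pose proof (invertible_inv2 I2) as J2.
  pose proof (inv2_spec I1) as [[A1 A2] [A3 A4]]. pose proof (inv2_spec I2) as [[B1 B2] [B3 B4]].
  set (x1 := inv2 ((e1 D ▹ theta) • (k00 D ◃ u))) in *.
  set (x2 := inv2 ((e2 D ▹ theta) • (k01 D ◃ u))) in *.
  clearbody x1 x2. clear I1 I2.
  replace (src2 ((e1 D ▹ theta) • (k00 D ◃ u))) with (e0 D ∘ d0 D ∘ u) in *
    by (clear E A3 A4 B3 B4; bd).
  replace (tgt2 ((e1 D ▹ theta) • (k00 D ◃ u))) with (e1 D ∘ d1 D ∘ u) in *
    by (clear E A3 A4 B3 B4; bd).
  replace (src2 ((e2 D ▹ theta) • (k01 D ◃ u))) with (e0 D ∘ d1 D ∘ u) in *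
    by (clear E A3 A4 B3 B4; bd).
  replace (tgt2 ((e2 D ▹ theta) • (k01 D ◃ u))) with (e2 D ∘ d1 D ∘ u) in *
    by (clear E A3 A4 B3 B4; bd).
  unshelve eexists (@Build_PseudoCone M X0 X1 X2 D U u (d1 D ∘ u) (e0 D ∘ (d1 D ∘ u))
    B _ _ theta (id2 (d1 D ∘ u)) (id2 (e0 D ∘ (d1 D ∘ u)))
    ((e0 D ▹ theta) • x1) x2 _ (iso2_id2 _) (iso2_id2 _) _ _ _ _ _).
  1, 2: split; clear E A3 A4 B3 B4; bd.
  - split; [split |]; assumption.
  - split; [split | invertible_tac]; clear E A3 A4 B3 B4; bd.
  - split; [split | assumption]; clear E A3 A4 B3 B4; bd.
  - transitivity ((e0 D ▹ theta) • (x1 • ((e1 D ▹ theta) • (k00 D ◃ u)))).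
    { clear E A3 A4 B3 B4. nfb. reflexivity. }
    rewrite A3. clear E A3 A4 B3 B4. nfb. reflexivity.
  - transitivity (x2 • ((e2 D ▹ theta) • (k01 D ◃ u))).
    { clear E A3 A4 B3 B4. nfb. reflexivity. }
    rewrite B3. clear E A3 A4 B3 B4. nfb. reflexivity.
  - apply (vcomp_cancel_r (c := ((e2 D ▹ theta) • (k01 D ◃ u)) • (e0 D ▹ theta)));
      [invertible_tac | clear E A3 A4 B3 B4; bd | clear E A3 A4 B3 B4; bd |].
    transitivity ((e0 D ▹ theta) • (x1
      • ((k21 D ◃ u) • (e2 D ▹ theta) • (k01 D ◃ u) • (e0 D ▹ theta)))).
    { clear E A3 A4 B3 B4. nfb. reflexivity. }
    rewrite E, A3.
    transitivity ((x2 • ((e2 D ▹ theta) • (k01 D ◃ u))) • (e0 D ▹ theta)).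
    { rewrite B3. clear E A3 A4 B3 B4. nfb. reflexivity. }
    clear E A3 A4 B3 B4. nfb. reflexivity.
  - split; [reflexivity |]. unfold cone_theta. simpl.
    (* [inv2] is a choice and does not compute; uniqueness of inverses identifies its value at an
       identity. *)
    rewrite (inv2_eq (inverse_id2 _)). now apply vcomp_idl'.
Qed.
End ConeDescent.

(** * The comparison functor *)

Section PieceOfCone.
Context (M : BraidedGrayMonoid) (H : LeftClosed M) (A : MonoidalObject M) (CA : CADiagram H A).

Definition piece_of_cone (U : ob M) (x : PseudoCone CA U) : CentrePiece A U.
Proof.
  refine {| cp_ar := p0 x; cp_ce := piece_ce CA (p0 x) (cone_theta x) |}.
  - apply p0_bd.
  - apply piece_ce_iso; first [apply src_cone_theta | apply tgt_cone_theta
      | apply cone_theta_iso | apply p0_bd].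
  - apply piece_eq_descent; first [apply src_cone_theta | apply tgt_cone_theta
      | apply cone_descent | apply p0_bd].
Defined.

Lemma cone_theta_bd (U : ob M) (x : PseudoCone CA U) :
  cone_theta x ⦂ d0 CA ∘ p0 x ⟹ d1 CA ∘ p0 x.
Proof. split; [apply src_cone_theta | apply tgt_cone_theta]. Qed.

Definition piece_of_cone_hom (U : ob M) (x y : PseudoCone CA U) (t : PseudoConeHom x y) :
  CentrePieceHom (piece_of_cone x) (piece_of_cone y).
Proof.
  refine {| cph_ce := t0 t : ce M |}; simpl.
  - apply t0_bd.
  - apply (piece_ce_square (p0_bd x) (p0_bd y) (t0_bd t) (cone_theta_bd x)
      (cone_theta_bd y)), cone_hom_theta.
Defined.

Definition piece_functor (U : ob M) : Functor (pseudo_cones CA U) (centre_pieces A U).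
Proof.
  refine {| fob := @piece_of_cone U : pseudo_cones CA U -> centre_pieces A U;
            fmap := @piece_of_cone_hom U |};
    intros; apply cph_ext; reflexivity.
Defined.

Lemma piece_functor_equivalence (U : ob M) : is_equivalence (piece_functor U).
Proof.
  apply equivalence_ff_es. split.
  - intros x y [s B E]. simpl in *.
    apply (piece_ce_square (p0_bd x) (p0_bd y) B (cone_theta_bd x) (cone_theta_bd y)) in E as E'.
    destruct (cone_hom_extend B E') as [t T]. exists t. split.
    + now apply cph_ext.
    + intros t' T'. apply cone_hom_t0_inj. rewrite T.
      now apply (f_equal (fun z => cph_ce z)) in T'.
  - intros [u g B G E]. destruct (piece_ce_surj CA B G) as [theta [T <-]].
    pose proof B as [u_s u_t]. pose proof T as [[T1 T2] TI].
    pose proof (proj1 (piece_eq_descent u_s u_t T1 T2) E) as E'.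
    destruct (cone_of_descent B T E') as [x [X1 X2]].
    exists x. unshelve eexists.
    (* [p0 x] equals [u] only propositionally. As boundaries of 2-cells are equations and not types,
       [id2 u] still serves as the isomorphism, without transport. *)
    + refine {| cph_ce := id2 u : ce M |}; simpl.
      * rewrite X1. apply is2_id2.
      * rewrite X1, X2.
        pose proof (piece_ce_iso u_s u_t T1 T2 TI) as [[G1 G2] _].
        clear E'. nfb. reflexivity.
    + apply (cp_iso (A := A)). apply invertible_id2.
Qed.

Lemma piece_of_cone_restrict (U V : ob M) (f : hom1 V U) (x : PseudoCone CA U) :
  cp_ce (piece_of_cone (cone_ob f x)) = cp_ce (cp_ob f (piece_of_cone x)).
Proof.
  simpl. rewrite <- (piece_ce_restrict (p0_bd x) (hom_ar_bd f) (cone_theta_bd x)).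
  f_equal. unfold cone_theta. simpl.
  rewrite inv2_rwhisk by first [bd | apply pd1_iso]. nfb. reflexivity.
Qed.

(** Restricting before or after the comparison gives the same 1-cell and, by
    [piece_of_cone_restrict], the same 2-cell, so identities are the components of the
    isomorphism. *)
Lemma piece_functor_restrict (L U : ob M) (x : pseudo_cones CA L) :
  nat_iso (functor_comp (piece_functor U) (restrict x U))
    (restrict (F := centre_pieces A) (piece_functor L x) U).
Proof.
  unshelve eexists.
  - intros f. refine {| cph_ce := id2 (p0 x ∘ (f : hom1 U L)) : ce M |}; simpl.
    + apply is2_id2.
    + pose proof (piece_of_cone_restrict f x) as E. simpl in E. rewrite E.
      pose proof (cp_ce_iso (cp_ob f (piece_of_cone x))) as [[G1 G2] _]. simpl in G1, G2.
      clear E. nfb. reflexivity.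
  - split.
    + intros f g b. apply cph_ext. simpl. nfb. reflexivity.
    + intros f. apply (cp_iso (A := A)). apply invertible_id2.
Qed.
End PieceOfCone.

Theorem proposition3p1 (M : BraidedGrayMonoid) (H : LeftClosed M) (A : MonoidalObject M)
  (CA : CADiagram H A) (L : ob M) : is_bilimit CA L <-> is_centre A L.
Proof.
  apply (@birepresents_equivalence M (pseudo_cones CA) (centre_pieces A) (piece_functor CA)).
  - apply piece_functor_equivalence.
  - intros x U. apply piece_functor_restrict.
Qed.
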